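(* Let $\alpha$ denote the real root of $4x^3-13x^2+10x-2$ lying in the interval $[0.7,1]$ (numerically $\alpha=0.70086\dots$). There is a deterministic polynomial-time online algorithm, which does not need to know the number $p$ of demand pairs in advance, such that for every $n$-node directed graph $G$ and every online sequence of $p$ demand pairs, the final preserver $H$ satisfies $$|E(H)| \le O\left(n^{\frac{2+\alpha}{3+\alpha}+o(1)}p^{\frac{2}{3+\alpha}} + n^{2-2\alpha+o(1)}p^{\alpha} + n\right) < O\left(n^{0.72}p^{0.56}+n^{0.6}p^{0.7}+n\right).$$
   Context: Online reachability preserver model: an $n$-node directed graph $G=(V,E)$ is given as input, and $H\subseteq G$ starts with no edges. Demand pairs $(s,t)\in V\times V$ then arrive one at a time; upon the arrival of $(s,t)$, and before the next pair arrives, the algorithm must irrevocably add edges of $G$ to $H$ so that $t$ is reachable from $s$ in $H$ whenever $t$ is reachable from $s$ in $G$. The process may stop at any time without warning; $p$ denotes the total number of demand pairs that arrive. *)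

(* Defs.v *)
From mathcomp Require Import all_boot.
Set Implicit Arguments.
Unset Strict Implicit.
Unset Printing Implicit Defensive.

(** A directed graph on the vertex set [{0, ..., n-1}] is its set of arcs, so
    that [#|H|] is [|E(H)|] and [H \subset G] is the subgraph relation between
    graphs on the same vertices.  Loops are allowed. *)
Definition digraph (n : nat) := {set 'I_n * 'I_n}.

Definition has_arc n (G : digraph n) : rel 'I_n := fun u v => (u, v) \in G.

Definition reachable n (G : digraph n) : rel 'I_n := connect (has_arc G).

(** A deterministic online algorithm is presented by its decisions: [A n G q] is
    the graph [H] maintained on input [G] once exactly the demand pairs [q] have
    arrived, in this order.  It is a function of the past demands only, so the
    algorithm knows neither the later demands nor how many of them will come. *)
Definition online_algorithm :=
  forall n : nat, digraph n -> seq ('I_n * 'I_n) -> digraph n.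

Definition online_reachability_preserver (A : online_algorithm) : Prop :=
  forall (n : nat) (G : digraph n),
  [/\ A n G [::] = set0,
      forall q, A n G q \subset G,
      forall q d, A n G q \subset A n G (rcons q d)
    & forall q s t, reachable G s t -> reachable (A n G (rcons q (s, t))) s t].

(** Structured random access machine programs.  Registers and memory cells,
    both indexed by [nat], hold natural numbers, and every operation and every
    test costs one unit of time.  Without multiplication the bit length of the
    values grows by O(1) per unit of time, so that polynomial time in this model
    is polynomial time on Turing machines. *)
Inductive program : Type :=
  | Const of nat & nat             (* r_x := k *)
  | Add of nat & nat & nat         (* r_x := r_y + r_z *)
  | Sub of nat & nat & nat         (* r_x := r_y - r_z, truncated at 0 *)
  | Read of nat & nat              (* r_x := mem[r_y] *)
  | Write of nat & nat             (* mem[r_x] := r_y *)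
  | Seq of program & program
  | If of nat & program & program  (* first branch if r_x is nonzero *)
  | While of nat & program.        (* loop as long as r_x is nonzero *)

Record machine_state := MachineState { regs : nat -> nat; mem : nat -> nat }.

Definition update (f : nat -> nat) (i v : nat) : nat -> nat :=
  fun j => if j == i then v else f j.

Definition set_reg (m : machine_state) (x v : nat) : machine_state :=
  MachineState (update (regs m) x v) (mem m).

Definition set_mem (m : machine_state) (a v : nat) : machine_state :=
  MachineState (regs m) (update (mem m) a v).

(** [runs P m t m']: started in state [m], the program [P] halts in state [m']
    after exactly [t] units of time. *)
Inductive runs :
    program -> machine_state -> nat -> machine_state -> Prop :=
  | RunConst m x k : runs (Const x k) m 1 (set_reg m x k)
  | RunAdd m x y z :
      runs (Add x y z) m 1 (set_reg m x (regs m y + regs m z))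
  | RunSub m x y z :
      runs (Sub x y z) m 1 (set_reg m x (regs m y - regs m z))
  | RunRead m x y :
      runs (Read x y) m 1 (set_reg m x (mem m (regs m y)))
  | RunWrite m x y :
      runs (Write x y) m 1 (set_mem m (regs m x) (regs m y))
  | RunSeq P Q m1 m2 m3 t1 t2 :
      runs P m1 t1 m2 -> runs Q m2 t2 m3 -> runs (Seq P Q) m1 (t1 + t2) m3
  | RunIfTrue x P Q m m' t :
      regs m x != 0 -> runs P m t m' -> runs (If x P Q) m t.+1 m'
  | RunIfFalse x P Q m m' t :
      regs m x == 0 -> runs Q m t m' -> runs (If x P Q) m t.+1 m'
  | RunWhileTrue x P m1 m2 m3 t1 t2 :
      regs m1 x != 0 -> runs P m1 t1 m2 -> runs (While x P) m2 t2 m3 ->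
      runs (While x P) m1 (t1 + t2).+1 m3
  | RunWhileFalse x P m : regs m x == 0 -> runs (While x P) m 1 m.

(** The adjacency matrix, row by row. *)
Definition encode_graph n (G : digraph n) : seq nat :=
  [seq nat_of_bool (has_arc G u v) | u <- enum 'I_n, v <- enum 'I_n].

Definition encode_demands n (q : seq ('I_n * 'I_n)) : seq nat :=
  flatten [seq [:: nat_of_ord d.1; nat_of_ord d.2] | d <- q].

Definition encode_input n (G : digraph n) (q : seq ('I_n * 'I_n)) : seq nat :=
  n :: size q :: encode_graph G ++ encode_demands q.

Definition initial_state (w : seq nat) : machine_state :=
  MachineState (fun=> 0) (nth 0 w).

(** The first [n * n] memory cells hold an adjacency matrix of [H]. *)
Definition outputs n (m : machine_state) (H : digraph n) : Prop :=
  forall u v : 'I_n, (mem m (u * n + v) != 0) = has_arc H u v.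

(** One fixed program computes all the decisions of [A] (for all sizes [n]), in
    time polynomial in the number of nodes and the number of past demands;
    serving a whole sequence is then polynomial as well. *)
Definition polynomial_time (A : online_algorithm) : Prop :=
  exists (P : program) (c k : nat),
  forall (n : nat) (G : digraph n) (q : seq ('I_n * 'I_n)),
  exists (t : nat) (m : machine_state),
  [/\ runs P (initial_state (encode_input G q)) t m,
      t <= c * (n + size q).+1 ^ k
    & outputs m (A n G q)].

(* Main.v *)
(** A demand (s,t) is served by deleting from G, one at a time, the arcs outside H
    whose deletion keeps t reachable from s, arcs leaving vertices with many
    descendants being tried first.  The pairs inside strong components are served
    beforehand, which costs at most 2n arcs.  Afterwards the tails of the arcs
    added for one demand have distinct numbers of descendants, so that, up to
    strong connectivity, they form a path.  The order of deletion implies that an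
    arc added for a later demand cannot be bypassed through older arcs or through
    arcs leaving vertices with fewer descendants; this is [no_bridge]
    for the system of all these paths.

    Consider p paths of l nodes each on n nodes, and split the paths through every
    node by time into early, middle and late ones.  By convexity many early paths
    are joined to many late ones by middle paths.  Since these joins are monotone,
    many of them come in pairs close to each other.  So many pairs of middle paths
    share a small cluster of nodes, and an induction on the number of nodes, applied
    to the cluster, gives p l^3 y^5 <= C n^2 for every y with C y^7 n <= p l and
    C y^14 <= l.  The best choice of y bounds the total size by
      O(n + p + n^(19/26) p^(14/26) + n^(28/47) p^(33/47)).
    This suffices because alpha <= 33/47: if p is at least n^2 the trivial bound n^2
    is enough, and otherwise decreasing the exponent of p by d and increasing that
    of n by 2d only weakens the last term.  No n^o(1) factor is lost. *)
From Stdlib Require Import FunctionalExtensionality.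
From mathcomp Require Import all_boot.
From mathcomp Require Import zify.
Require Import Defs.
Set Implicit Arguments.
Unset Strict Implicit.
Unset Printing Implicit Defensive.

(** * Finite counting *)

(** With blocks of a single node the counting already gives [p l^3 = O(n^2)], that is, total size
    [O((n p)^(2/3))], since no node shares its block with an earlier one. The factor [y^5] is gained
    by assuming the bound false: the blocks are then shorter than [y^5], and for block length [e] a
    cluster has [O(l m e)] nodes, [m] being the number of paths in each group at a node. The
    induction hypothesis is applied to the cluster with a smaller parameter [w]. Up to constants the
    estimates allow [w] between [y^(1/4)] and [y^(2/5)], and the integer cube root lies in this
    range. The obstacle to a bound free of logarithms is the dyadic splitting of the paths by the
    number of cluster nodes on them. Paths with fewer than about [l / e] such nodes are negligible,
    so that only about [log e] levels remain. Their number is bounded in terms of [y] alone, and its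
    square is absorbed by one spare factor [w]. *)

Lemma leq_card_rel (I J : finType) (A : {pred I}) (B : {pred J}) (r : I -> J -> bool) :
  (forall i, i \in A -> exists2 j, j \in B & r i j) ->
  (forall i i' j, i \in A -> i' \in A -> j \in B -> r i j -> r i' j -> i = i') ->
  #|A| <= #|B|.
Proof.
move=> ex inj.
have [->//|/card_gt0P [i0 i0A]] := posnP #|A|.
have [j0 _ _] := ex _ i0A.
pose f i := odflt j0 [pick j in B | r i j].
have fP i : i \in A -> f i \in B /\ r i (f i).
  move=> iA; rewrite /f; case: pickP => [j /andP[]//|no].
  by have [j jB rj] := ex _ iA; have := no j; rewrite jB rj.
rewrite -(card_in_imset (f := f) (D := A)).
  apply/subset_leq_card/subsetP => j /imsetP[i iA ->]; exact: (fP _ iA).1.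
move=> i i' iA i'A eqf; have [fB fr] := fP _ iA; have [_ fr'] := fP _ i'A.
by apply: (inj i i' (f i)) => //; rewrite eqf.
Qed.

Lemma sum_bool_card (I : finType) (P : pred I) : \sum_i (P i : nat) = #|[set i | P i]|.
Proof. by rewrite cardsE -sum1_card [RHS]big_mkcond; apply: eq_bigr => i _; case: ifP; rewrite unfold_in => ->. Qed.

Lemma exists_le_sum (I : finType) (P : pred I) :
  ([exists i, P i] : nat) <= \sum_i (P i : nat).
Proof. by case: existsP => // -[i Pi]; rewrite (bigD1 i) //= Pi. Qed.

Lemma exists_eq_sum (I : finType) (P : pred I) :
  (forall i j, P i -> P j -> i = j) ->
  ([exists i, P i] : nat) = \sum_i (P i : nat).
Proof.
move=> uniqP; apply/eqP; rewrite eqn_leq exists_le_sum /=.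
case: existsP => [[i Pi]|no].
  rewrite (bigD1 i) //= Pi big1 // => j ij; case Pj: (P j) => //.
  by rewrite (uniqP _ _ Pi Pj) eqxx in ij.
by rewrite big1 // => i _; case Pi: (P i) => //; case: no; exists i.
Qed.

Lemma leq_cauchy (I : finType) (f g : I -> nat) :
  (\sum_i f i * g i) ^ 2 <= (\sum_i f i ^ 2) * (\sum_i g i ^ 2).
Proof.
have -> : (\sum_i f i * g i) ^ 2 = \sum_i \sum_j (f i * g j) * (f j * g i).
  rewrite -mulnn big_distrlr /=; apply: eq_bigr => i _; apply: eq_bigr => j _; lia.
have e : (\sum_i f i ^ 2) * (\sum_i g i ^ 2) = \sum_i \sum_j (f i * g j) ^ 2.
  by rewrite big_distrlr /=; apply: eq_bigr => i _; apply: eq_bigr => j _; rewrite expnMn.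
(* After doubling, the terms for [(i, j)] and [(j, i)] can be paired. *)
rewrite -(leq_pmul2l (isT : 0 < 2)) [X in _ <= X]mul2n -addnn {1}e e.
rewrite [X in _ <= X + _]exchange_big /= -big_split /= big_distrr /=.
apply: leq_sum => i _; rewrite -big_split big_distrr /=.
by apply: leq_sum => j _; rewrite addnC; apply: (nat_Cauchy _ _).1.
Qed.

Lemma sqr_card_sum (I : finType) (P : pred I) :
  #|[set i | P i]| ^ 2 = \sum_i \sum_j (P i && P j : nat).
Proof.
rewrite -mulnn -!sum_bool_card big_distrlr /=; apply: eq_bigr => i _.
by apply: eq_bigr => j _; case: (P i); case: (P j).
Qed.

(** * Path systems *)

(** A path is the set of nodes on it, traversed in the order of [pos]; [tm] is
    the time at which a path arrives.  [no_bridge] forbids rivers [Q] that can be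
    left at [r] along an earlier path [A] and rejoined at a later node [s]
    through at most two further paths, which may arrive at any time. *)
Record psystem (V P : finType) := PSystem {
  inc : V -> P -> bool;
  pos : V -> nat;
  tm : P -> nat;
  pos_inj : forall Q v w, inc v Q -> inc w Q -> pos v = pos w -> v = w;
  tm_inj : forall v Q Q', inc v Q -> inc v Q' -> tm Q = tm Q' -> Q = Q';
  no_bridge : forall A Q B S r r' s s', tm A < tm Q -> inc r A -> inc r Q ->
    inc r' A -> pos r < pos r' -> inc s Q -> pos r < pos s ->
    inc r' B -> inc s' B -> pos r' <= pos s' ->
    inc s' S -> inc s S -> pos s' <= pos s -> False }.

Section PathSystems.
Variables (V P : finType) (X : psystem V P).
Notation inc := (inc X).
Notation pos := (pos X).
Notation tm := (tm X).

Lemma no_bridge3 A Q B r r' s : tm A < tm Q -> inc r A -> inc r Q ->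
  inc r' A -> pos r < pos r' -> inc s Q -> pos r < pos s ->
  inc r' B -> inc s B -> pos r' <= pos s -> False.
Proof.
by move=> AQ rA rQ r'A rr' sQ rs r'B sB r's; apply: (@no_bridge _ _ X A Q B B r r' s s).
Qed.

(** If [s] came after [r], the path [A] would itself be the bridge, rejoining [Q] at [s]. *)
Lemma share_lt A Q r s : tm A < tm Q -> inc r A -> inc r Q -> inc s A -> inc s Q -> r = s.
Proof.
move=> AQ rA rQ sA sQ; case: (ltngtP (pos r) (pos s)) => c.
- by case: (@no_bridge3 A Q A r s s).
- by case: (@no_bridge3 A Q A s r r).
- exact: (pos_inj rA sA c).
Qed.

Lemma share_one A Q r s : A != Q -> inc r A -> inc r Q -> inc s A -> inc s Q -> r = s.
Proof.
move=> AQ rA rQ sA sQ; case: (ltngtP (tm A) (tm Q)) => c.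
- exact: (share_lt c rA rQ sA sQ).
- exact: (share_lt c rQ rA sQ sA).
- by case/eqP: AQ; apply: (tm_inj rA rQ c).
Qed.

(** Of the two paths, the one that leaves [A] later would bridge the other from [A] to [w]. If both
    leave at the same node, they share two nodes. *)
Lemma hit_uniq A Q Q' r r' w : tm A < tm Q -> tm A < tm Q' ->
  inc r A -> inc r Q -> inc r' A -> inc r' Q' -> inc w Q -> inc w Q' ->
  pos r < pos w -> pos r' < pos w -> Q = Q'.
Proof.
move=> AQ AQ' rA rQ r'A r'Q' wQ wQ' rw r'w.
case: (ltngtP (pos r) (pos r')) => c.
- by case: (@no_bridge3 A Q Q' r r' w) => //; apply: ltnW.
- by case: (@no_bridge3 A Q' Q r' r w) => //; apply: ltnW.
- apply/eqP; case: eqVneq => // neq; move: rw.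
  by rewrite (@share_one Q Q' r w neq rQ _ wQ wQ') ?ltnn // (pos_inj rA r'A c).
Qed.

Definition idx A v := #|[set u | inc u A & pos u < pos v]|.

Lemma idx_lt A v w : inc v A -> pos v < pos w -> idx A v < idx A w.
Proof.
move=> vA vw; apply/proper_card/properP; split.
  by apply/subsetP => u; rewrite !inE => /andP[-> /=] uv; apply: ltn_trans vw.
by exists v; rewrite !inE ?vA ?vw ?ltnn ?andbF.
Qed.

Lemma idx_inj A v w : inc v A -> inc w A -> idx A v = idx A w -> v = w.
Proof.
move=> vA wA e; apply: (@pos_inj _ _ X A) => //.
by case: (ltngtP (pos v) (pos w)) => // c; [have := idx_lt vA c|have := idx_lt wA c]; rewrite e ltnn.
Qed.

Lemma idx_max A v : inc v A -> idx A v < #|[set u | inc u A]|.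
Proof.
move=> vA; apply/proper_card/properP; split.
  by apply/subsetP => u; rewrite !inE => /andP[].
by exists v; rewrite !inE ?ltnn ?andbF.
Qed.

Definition blk d A v := idx A v %/ d.

Lemma card_blk d A b : 0 < d -> #|[set v | inc v A & blk d A v == b]| <= d.
Proof.
move=> d0; rewrite -{2}(card_ord d).
apply: (@leq_card_rel _ _ _ _ (fun v (i : 'I_d) => idx A v %% d == i)).
  by move=> v _; exists (Ordinal (ltn_pmod (idx A v) d0)).
move=> v w j; rewrite !inE => /andP[vA /eqP vb] /andP[wA /eqP wb] _ /eqP vj /eqP wj.
apply: (idx_inj vA wA); rewrite (divn_eq (idx A v) d) (divn_eq (idx A w) d).
by rewrite vj wj -/(blk d A v) -/(blk d A w) vb wb.
Qed.

Lemma blk_le d A v w : inc v A -> inc w A -> pos v <= pos w -> blk d A v <= blk d A w.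
Proof.
move=> vA wA; rewrite leq_eqVlt => /orP[/eqP e|c].
  by rewrite (pos_inj vA wA e).
by apply/leq_div2r/ltnW/idx_lt.
Qed.
End PathSystems.

Lemma eq_of_sum_leq a b c e : a <= b -> c <= e -> a + c = b + e -> a = b /\ c = e.
Proof. lia. Qed.

Lemma half_of_sum c x j f g : x <= c * j -> j <= f + g -> 2 * c * g <= x -> x <= 2 * c * f.
Proof.
move=> xj jfg gx; have : c * j <= c * f + c * g by rewrite -mulnDr leq_mul2l jfg orbT.
by lia.
Qed.

(** For [k] classes on each of the [p * p] pairs of paths. In its application this makes the nodes
    that are first in their class at most half of all joined ones; 108 is [6 * 6 * 3]. *)
Lemma few_classes c n m l d p k : 0 < l -> 0 < d ->
  p * l <= 6 * (n * m) -> d * k <= 3 * l -> 108 * c * n <= d * m * l ^ 2 ->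
  c * (p * p * k) <= n * m ^ 3 * l.
Proof.
move=> l0 d0 pl kd dbig.
rewrite -(leq_pmul2l (_ : 0 < d * l ^ 2)) ?muln_gt0 ?d0 ?expn_gt0 ?l0 //.
have pl2 := leq_mul pl pl.
have := leq_mul (leq_mul (leqnn c) pl2) kd.
have := leq_mul dbig (leqnn (n * m ^ 2 * l)).
rewrite -!mulnn (expnS m 2) -mulnn; lia.
Qed.

Lemma levels_arith c n m l d p K b la : 0 < n -> 0 < m ->
  n * m ^ 3 * l <= 4 * c * la -> la ^ 2 <= K * (K * (12 * (n * m ^ 2 * d) * (p * b))) ->
  p * l <= 6 * (n * m) -> m ^ 3 * l ^ 3 <= 1152 * c ^ 2 * (K ^ 2 * d * b).
Proof.
move=> n0 m0 low sq pl.
have h1 := leq_mul (leq_mul low low) (leqnn l).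
have h2 := leq_mul (leqnn (16 * c ^ 2 * l)) sq.
have h3 := leq_mul (leqnn (16 * c ^ 2 * (K * (K * (12 * (n * m ^ 2 * d) * b))))) pl.
rewrite -(leq_pmul2l (_ : 0 < n ^ 2 * m ^ 3)) ?muln_gt0 ?expn_gt0 ?n0 ?m0 //.
move: h1 h2 h3; rewrite !(expnS _ 2) -!mulnn => h1 h2 h3.
apply: leq_trans (_ : n * (m * (m * m)) * l * (n * (m * (m * m)) * l) * l <= _); first by lia.
apply: leq_trans h1 _.
apply: leq_trans (_ : 16 * (c * c) * l * (la * la) <= _); first by lia.
apply: leq_trans h2 _.
apply: leq_trans (_ : 16 * (c * c) * (K * (K * (12 * (n * (m * m) * d) * b))) * (p * l) <= _); first by lia.
apply: leq_trans h3 _; lia.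
Qed.

(** * Regular systems *)

(** The paths through each node are grouped by time into [m] early, [m] middle
    and [m] late ones. *)
Section Regular.
Variables (V P : finType) (X : psystem V P).
Notation inc := (inc X).
Notation pos := (pos X).
Notation tm := (tm X).
Variables (E M L : V -> P -> bool) (m l d : nat).
Hypothesis E_inc : forall v Q, E v Q -> inc v Q.
Hypothesis M_inc : forall v Q, M v Q -> inc v Q.
Hypothesis L_inc : forall v Q, L v Q -> inc v Q.
Hypothesis E_M : forall v A Q, E v A -> M v Q -> tm A < tm Q.
Hypothesis M_L : forall v Q S, M v Q -> L v S -> tm Q < tm S.
Hypothesis card_E : forall v, #|[set Q | E v Q]| = m.
Hypothesis card_M : forall v, #|[set Q | M v Q]| = m.
Hypothesis card_L : forall v, #|[set Q | L v Q]| = m.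
Hypothesis len_le : forall Q, #|[set v | inc v Q]| <= l.
Hypothesis paths_le : #|P| * l <= 6 * (#|V| * m).
Hypothesis l_ge : 12 <= l.
Notation n := #|V|.
Notation p := #|P|.

Lemma sumM Q : \sum_v (M v Q : nat) <= l.
Proof.
rewrite sum_bool_card; apply: leq_trans (len_le Q); apply/subset_leq_card/subsetP => v.
by rewrite !inE; apply: M_inc.
Qed.

Lemma sumMv v : \sum_Q (M v Q : nat) = m.
Proof. by rewrite sum_bool_card card_M. Qed.
Lemma sumEv v : \sum_Q (E v Q : nat) = m.
Proof. by rewrite sum_bool_card card_E. Qed.
Lemma sumLv v : \sum_Q (L v Q : nat) = m.
Proof. by rewrite sum_bool_card card_L. Qed.

(** The middle path [Q] leads from [r] to the late path [S]. *)
Definition rung r Q s S := [&& M r Q, M s Q, L s S & pos r < pos s].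

Lemma rungP r Q s S : rung r Q s S ->
  [/\ M r Q, M s Q, L s S & pos r < pos s] /\
  [/\ inc r Q, inc s Q, inc s S & tm Q < tm S].
Proof.
move=> /and4P[a b c e]; split; split=> //; [exact: M_inc|exact: M_inc|exact: L_inc|exact: M_L b c].
Qed.

Lemma rung_uniq r Q s s' S : rung r Q s S -> rung r Q s' S -> s = s'.
Proof.
move=> /rungP[_ [_ sQ sS lt]] /rungP[_ [_ s'Q s'S _]].
exact: (share_lt lt sQ sS s'Q s'S).
Qed.

Definition hits r Q S := [exists s, rung r Q s S].
Definition joins r S := \sum_Q (hits r Q S : nat).

Definition mid_pairs := \sum_Q \sum_r \sum_s ([&& M r Q, M s Q & pos r < pos s] : nat).

(** A pair of nodes on a middle path extends by any of the [m] late paths at its second node. No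
    rung is lost by passing to [hits], because [r], [Q] and [S] determine the second node. *)
Lemma sum_joins : \sum_r \sum_S joins r S = m * mid_pairs.
Proof.
rewrite /mid_pairs big_distrr /= exchange_big /=.
under eq_bigr => S _ do rewrite exchange_big.
rewrite exchange_big /=; apply: eq_bigr => Q _.
rewrite exchange_big big_distrr /=; apply: eq_bigr => r _.
rewrite big_distrr /=.
under eq_bigr => S _ do rewrite (exists_eq_sum (fun s s' => @rung_uniq r Q s s' S)).
rewrite exchange_big /=; apply: eq_bigr => s _.
rewrite -[in RHS](sumLv s) big_distrl /=; apply: eq_bigr => S _.
by rewrite /rung; case: (M r Q); case: (M s Q); case: (L s S); case: (pos r < pos s).
Qed.

Lemma mid_pairs_sq : \sum_Q #|[set v | M v Q]| ^ 2 = 2 * mid_pairs + n * m.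
Proof.
rewrite /mid_pairs mul2n -addnn.
have -> : n * m = \sum_Q \sum_r (M r Q : nat).
  rewrite exchange_big /=; under eq_bigr => v _ do rewrite sumMv.
  by rewrite sum_nat_const.
rewrite -!big_split /=; apply: eq_bigr => Q _.
rewrite sqr_card_sum [X in _ = _ + X + _]exchange_big -!big_split /=; apply: eq_bigr => r _.
have -> : (M r Q : nat) = \sum_s ([&& M r Q, M s Q & r == s] : nat).
  rewrite (bigD1 r) //= eqxx big1 ?addn0; first by case: (M r Q).
  by move=> s sr; rewrite eq_sym (negbTE sr) !andbF.
rewrite -!big_split /=; apply: eq_bigr => s _.
case rQ: (M r Q); case sQ: (M s Q) => //=.
have [->|neq] := eqVneq r s; first by rewrite ltnn.
case: ltngtP => // c; case/eqP: neq.
by apply: (pos_inj (M_inc rQ) (M_inc sQ)).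
Qed.

(** Cauchy's inequality for the numbers of middle nodes on the paths, whose average is at least
    [l / 6]. With [12 <= l] the diagonal takes at most half of the sum of squares. *)
Lemma mid_pairs_low : n * m * l <= 24 * mid_pairs.
Proof.
have [->//|nm0] := posnP (n * m).
have cs := leq_cauchy (fun Q => #|[set v | M v Q]|) (fun _ : P => 1).
have sM : \sum_Q #|[set v | M v Q]| = n * m.
  under eq_bigr => Q _ do rewrite -sum_bool_card.
  rewrite exchange_big /=; under eq_bigr => v _ do rewrite sumMv.
  by rewrite sum_nat_const.
have one : \sum_(Q : P) 1 ^ 2 = p by rewrite sum_nat_const muln1.
have eM : \sum_Q #|[set v | M v Q]| * 1 = n * m.
  by rewrite -sM; apply: eq_bigr => Q _; rewrite muln1.
rewrite eM one mid_pairs_sq in cs.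
have pl := paths_le; rewrite -/(n * m) in pl.
set g := mid_pairs in cs *; set k := n * m in nm0 pl cs *.
have : k * (k * l) <= k * (6 * (2 * g + k)).
  have : k ^ 2 * l <= (2 * g + k) * p * l by rewrite leq_mul2r cs orbT.
  have : (2 * g + k) * (p * l) <= (2 * g + k) * (6 * k) by rewrite leq_mul2l pl orbT.
  lia.
rewrite leq_pmul2l // => {}cs.
have : k * 12 <= k * l by rewrite leq_mul2l l_ge orbT.
lia.
Qed.

(** The node [s'] of [Q'] determines [S]: two such late paths would leave [Q] and meet again at
    [s'], against [hit_uniq]. *)
Lemma card_cross r Q Q' : M r Q -> M r Q' ->
  #|[set S | [exists s, exists s', [&& rung r Q s S, rung r Q' s' S & pos s < pos s']]]| <= l.
Proof.
move=> rQ rQ'; apply: leq_trans (len_le Q').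
apply: (@leq_card_rel _ _ _ _ (fun S s' =>
  [exists s, [&& rung r Q s S, rung r Q' s' S & pos s < pos s']])).
  move=> S; rewrite inE => /existsP[s /existsP[s' H]]; exists s'; last by apply/existsP; exists s.
  by case/and3P: H => _ /rungP[_ []]; rewrite inE.
move=> S S' s' _ _ _ /existsP[s /and3P[r1 r2 lt]] /existsP[t /and3P[r3 r4 lt']].
case/rungP: r1 => _ [_ sQ sS tS]; case/rungP: r2 => _ [_ s'Q' s'S _].
case/rungP: r3 => _ [_ tQ tS' tSS]; case/rungP: r4 => _ [_ _ s'S' _].
exact: (hit_uniq tS tSS sQ sS tQ tS' s'S s'S' lt lt').
Qed.

(** The square counts pairs of middle paths through [r] that hit the same [S]. Each of the [m] equal
    pairs contributes at most [l * m]; a pair of distinct paths contributes at most [l] for each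
    order in which [S] can meet them. *)
Lemma sum_joins_sq : \sum_r \sum_S joins r S ^ 2 <= 3 * (n * m ^ 2 * l).
Proof.
rewrite -mulnA mulnCA -[n]/#|V| -sum_nat_const; apply: leq_sum => r _.
have -> : \sum_S joins r S ^ 2 = \sum_Q \sum_Q' \sum_S (hits r Q S && hits r Q' S : nat).
  have -> : \sum_S joins r S ^ 2 = \sum_S \sum_Q \sum_Q' (hits r Q S && hits r Q' S : nat).
    apply: eq_bigr => S _; rewrite -mulnn big_distrlr /=; apply: eq_bigr => Q _.
    by apply: eq_bigr => Q' _; case: (hits r Q S); case: (hits r Q' S).
  by rewrite exchange_big; apply: eq_bigr => Q _; rewrite exchange_big.
apply: (@leq_trans (\sum_Q \sum_Q' ((M r Q && (Q == Q')) * (l * m) + (M r Q && M r Q') * (2 * l)))).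
  apply: leq_sum => Q _; apply: leq_sum => Q' _.
  case rQ: (M r Q); last first.
    by rewrite big1 // => S _; rewrite /hits; case: existsP => // -[s /and4P[]]; rewrite rQ.
  have [<-|neq] /= := eqVneq Q Q'.
    rewrite mul1n; apply: leq_trans (leq_addr _ _).
    apply: (@leq_trans (\sum_S \sum_s (M s Q && L s S : nat))).
      apply: leq_sum => S _; rewrite andbb; apply: leq_trans (exists_le_sum _) _.
      by apply: leq_sum => s _; rewrite /rung; case: (M r Q); case: (M s Q); case: (L s S); case: (pos r < pos s).
    rewrite exchange_big /=; apply: (@leq_trans (\sum_s M s Q * m)).
      apply: leq_sum => s _; rewrite -(sumLv s) big_distrr /=; apply: leq_sum => S _.
      by case: (M s Q); case: (L s S).
    by rewrite -big_distrl leq_mul2r sumM orbT.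
  case rQ': (M r Q'); last first.
    rewrite big1 // => S _; rewrite andbC /hits; case: existsP => // -[s /and4P[]].
    by rewrite rQ'.
  rewrite mul0n add0n mul1n mul2n -addnn.
  apply: leq_trans (leq_add (card_cross rQ rQ') (card_cross rQ' rQ)).
  rewrite -!sum_bool_card -big_split /=; apply: leq_sum => S _.
  case/boolP: (hits r Q S) => //= /existsP[s rs].
  case/boolP: (hits r Q' S) => //= /existsP[s' rs'].
  have [[_ sQ _ lts] [_ _ sS tS]] := rungP rs.
  have [[_ sQ' _ lts'] [_ _ sS' _]] := rungP rs'.
  case: (ltngtP (pos s) (pos s')) => c.
  - rewrite (_ : [exists s0, _] = true) //.
    by apply/existsP; exists s; apply/existsP; exists s'; rewrite rs rs' c.
  - rewrite [X in _ + X](_ : _ = true :> nat) ?addn1 //; congr (nat_of_bool _).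
    by apply/existsP; exists s'; apply/existsP; exists s; rewrite rs rs' c.
  - have es := pos_inj sS sS' c; move: lts.
    rewrite -es in sQ'.
    by rewrite (share_one neq (M_inc rQ) (M_inc rQ') (M_inc sQ) (M_inc sQ')) ltnn.
have -> : \sum_Q \sum_Q' ((M r Q && (Q == Q')) * (l * m) + (M r Q && M r Q') * (2 * l)) =
    \sum_Q (M r Q * (l * m) + M r Q * (m * (2 * l))).
  apply: eq_bigr => Q _; rewrite big_split /= -!big_distrl /=; congr (_ * _ + _).
    by rewrite (bigD1 Q) //= eqxx big1 ?addn0 ?andbT // => Q' /negbTE; rewrite eq_sym => ->; rewrite andbF.
  rewrite [RHS]mulnA; congr (_ * _); rewrite -(sumMv r) big_distrr /=; apply: eq_bigr => Q' _.
  by case: (M r Q); case: (M r Q').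
by rewrite big_split /= -!big_distrl /= sumMv; lia.
Qed.

Lemma many_joined : n * m ^ 2 * l <= 1728 * \sum_r \sum_S ((0 < joins r S) : nat).
Proof.
have low : n * m ^ 2 * l <= 24 * \sum_r \sum_S joins r S.
  by rewrite sum_joins; have := mid_pairs_low; move/(leq_mul (leqnn m)); lia.
(* A division-free second moment argument: [144 j <= j^2 + 72^2] is summed over the positive [j].
   With 72 the left side is at least [6 b], twice the bound on the sum of squares. *)
have concl (b g q z : nat) : b <= 24 * g -> q <= 3 * b -> 144 * g <= q + 72 * 72 * z -> b <= 1728 * z.
  by move=> h1 h2 h3; lia.
apply: concl low sum_joins_sq _.
rewrite !big_distrr -big_split /=; apply: leq_sum => r _.
rewrite !big_distrr -big_split /=; apply: leq_sum => S _.
case: (joins r S) => // k; have := (nat_Cauchy k.+1 72).1.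
by rewrite ltn0Sn muln1 -mulnn; lia.
Qed.

Hypothesis d_gt0 : 0 < d.

(** By [rung_mono], along a fixed early [A] the nodes joined to a fixed late [S]
    reach [S] in the same order.  Cutting [A] and [S] into blocks of [d] nodes
    therefore leaves few classes of pairs of blocks, and two nodes of one class
    have both their ends close together. *)
Definition joined A S := [set r | E r A & 0 < joins r S].
(** Adding the two block numbers, instead of pairing them, leaves only [2 (l / d) + 1] classes.
    Nothing is lost: along [A] both numbers are monotone, so equal sums force both to be equal. *)
Definition class A S r :=
  blk X d A r + oapp (fun w : P * V => blk X d S w.2) 0 [pick w | rung r w.1 w.2 S].
Definition followers A S := [set r in joined A S |
  [exists r', [&& r' \in joined A S, pos r' < pos r & class A S r' == class A S r]]].

Definition nearE A Q v :=
  [exists r, [&& E r A, M r Q, pos r < pos v, blk X d A r == blk X d A v & E v A]].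
Definition nearL S Q Q' := [exists s, exists s',
  [&& M s Q, L s S, M s' Q', L s' S, pos s < pos s' & blk X d S s == blk X d S s']].

Lemma blk_max A v : inc v A -> blk X d A v <= l %/ d.
Proof.
by move=> vA; apply/leq_div2r/ltnW; apply: leq_trans (idx_max vA) (len_le A).
Qed.

Lemma joinedP A S r : r \in joined A S ->
  E r A /\ exists w, [pick w | rung r w.1 w.2 S] = Some w /\ rung r w.1 w.2 S.
Proof.
rewrite inE => /andP[rA h0]; split => //; case: pickP => [w rw|no]; first by exists w.
move: h0; rewrite /joins big1 // => Q _; apply/eqP; rewrite eqb0; apply/existsP => -[s rs].
by have := no (Q, s); rewrite /= rs.
Qed.

(** Within a class every node except the first is a follower. *)
Lemma card_joined A S : #|joined A S| <= #|followers A S| + (2 * (l %/ d)).+1.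
Proof.
rewrite -(cardsID (followers A S)) leq_add //.
  by apply/subset_leq_card/subsetP => r; rewrite inE => /andP[].
rewrite -[X in _ <= X]card_ord.
apply: (@leq_card_rel _ _ _ _ (fun r (i : 'I__) => class A S r == i)).
  move=> r /setDP[rK _]; have [rA [w [ew /rungP[_ [_ _ wS _]]]]] := joinedP rK.
  suff lt : class A S r < (2 * (l %/ d)).+1 by exists (Ordinal lt).
  rewrite ltnS mul2n -addnn /class ew /= leq_add ?blk_max //; exact: E_inc.
move=> r r' j rK r'K _ /eqP e /eqP e'.
have [/setDP[rJ nf] /setDP[r'J nf']] := (rK, r'K).
have [rA _] := joinedP rJ; have [r'A _] := joinedP r'J.
case: (ltngtP (pos r) (pos r')) => c.
- case/negP: nf'; rewrite inE r'J /=; apply/existsP; exists r.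
  by rewrite rJ c e e' eqxx.
- case/negP: nf; rewrite inE rJ /=; apply/existsP; exists r'.
  by rewrite r'J c e e' eqxx.
- exact: (pos_inj (E_inc rA) (E_inc r'A) c).
Qed.

(** This is what [no_bridge] with two further paths is for: if [s'] did not come after [s], one
    could leave [Q] at [r] along [A], take [Q'] from [r'] to [s'], and return to [Q] at [s] along
    [S]. *)
Lemma rung_mono A r r' Q Q' s s' S : E r A -> E r' A -> pos r < pos r' ->
  rung r Q s S -> rung r' Q' s' S -> pos s < pos s'.
Proof.
move=> rA r'A lt /rungP[[rQ _ _ rs] [rQ' sQ sS _]] /rungP[[_ _ _ r's'] [r'Q' s'Q' s'S _]].
rewrite ltnNge; apply/negP => c.
apply: (@no_bridge _ _ X A Q Q' S r r' s s') => //; try exact: E_inc; last exact: ltnW.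
exact: E_M rA rQ.
Qed.

Lemma followerP A S r' r : r' \in joined A S -> r \in joined A S -> pos r' < pos r ->
  class A S r' = class A S r ->
  exists Q Q', [&& nearE A Q r, M r Q' & nearL S Q Q'].
Proof.
move=> r'J rJ lt; rewrite /class.
have [r'A [w' [-> rw']]] := joinedP r'J; have [rA [w [-> rw]]] := joinedP rJ => /= ec.
have lts := rung_mono r'A rA lt rw' rw.
have [[M1 M2 L1 _] [_ _ sS' _]] := rungP rw'; have [[M3 M4 L2 _] [_ _ sS _]] := rungP rw.
have le1 := blk_le d (E_inc r'A) (E_inc rA) (ltnW lt).
have le2 := blk_le d sS' sS (ltnW lts).
have [e1 e2] : blk X d A r' = blk X d A r /\ blk X d S w'.2 = blk X d S w.2.
  exact: eq_of_sum_leq le1 le2 ec.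
exists w'.1, w.1; rewrite M3 /=; apply/andP; split.
  by apply/existsP; exists r'; rewrite r'A rA M1 lt e1 eqxx.
by apply/existsP; exists w'.2; apply/existsP; exists w.2; rewrite M2 L1 M4 L2 lts e2 eqxx.
Qed.

(** * Moments of the near pairs *)

Definition early_near Q v := #|[set A | nearE A Q v]|.
Definition late_near Q Q' := #|[set S | nearL S Q Q']|.
(** The witnesses [(A, v, Q, Q', S)] supplied by [followerP]. Once [Q], [v] and [Q'] are fixed, the
    conditions on [A] and on [S] are independent, hence the product. *)
Definition near_sum := \sum_Q \sum_v \sum_Q' early_near Q v * M v Q' * late_near Q Q'.

Lemma followers_le : \sum_A \sum_S #|followers A S| <= near_sum.
Proof.
have -> : near_sum = \sum_A \sum_S \sum_v \sum_Q \sum_Q'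
    ([&& nearE A Q v, M v Q' & nearL S Q Q'] : nat).
  rewrite /near_sum.
  transitivity (\sum_Q \sum_v \sum_Q' \sum_A \sum_S ([&& nearE A Q v, M v Q' & nearL S Q Q'] : nat)).
    apply: eq_bigr => Q _; apply: eq_bigr => v _; apply: eq_bigr => Q' _.
    rewrite /early_near /late_near -!sum_bool_card -mulnA mulnCA mulnC big_distrlr /= big_distrl /=.
    apply: eq_bigr => A _; rewrite big_distrl; apply: eq_bigr => S _ /=.
    by case: (nearE A Q v); case: (M v Q'); case: (nearL S Q Q').
  under eq_bigr => Q _ do under eq_bigr => v _ do rewrite exchange_big.
  under eq_bigr => Q _ do rewrite exchange_big.
  rewrite exchange_big; apply: eq_bigr => A _ /=.
  under eq_bigr => Q _ do under eq_bigr => v _ do rewrite exchange_big.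
  under eq_bigr => Q _ do rewrite exchange_big.
  rewrite exchange_big; apply: eq_bigr => S _ /=.
  by rewrite exchange_big.
apply: leq_sum => A _; apply: leq_sum => S _; rewrite -sum1_card big_mkcond /=.
apply: leq_sum => r _; case: ifP => //; rewrite inE => /andP[rJ /existsP[r' /and3P[r'J lt /eqP ec]]].
have [Q [Q' H]] := followerP r'J rJ lt ec.
by rewrite (bigD1 Q) //= (bigD1 Q') //= H.
Qed.

Lemma many_near : d <= l -> 108 * (2 * 1728) * n <= d * m * l ^ 2 -> n * m ^ 3 * l <= (2 * 1728) * near_sum.
Proof.
move=> dl dbig; apply: leq_trans (leq_mul (leqnn (2 * 1728)) followers_le).
have sJ : \sum_A \sum_S #|joined A S| = m * \sum_r \sum_S ((0 < joins r S) : nat).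
  rewrite exchange_big [in RHS]exchange_big big_distrr; apply: eq_bigr => S _ /=.
  under eq_bigr => A _ do rewrite -sum_bool_card.
  rewrite exchange_big big_distrr; apply: eq_bigr => r _ /=.
  rewrite -(sumEv r) big_distrl; apply: eq_bigr => A _ /=.
  by case: (E r A); case: (0 < joins r S).
have low : n * m ^ 3 * l <= 1728 * \sum_A \sum_S #|joined A S|.
  by rewrite sJ; have := leq_mul (leqnn m) many_joined; rewrite expnS; lia.
have up : \sum_A \sum_S #|joined A S| <=
    \sum_A \sum_S #|followers A S| + p * p * (2 * (l %/ d)).+1.
  rewrite -mulnA -[in X in _ + X]sum_nat_const -big_split /=; apply: leq_sum => A _.
  rewrite -sum_nat_const -big_split /=; apply: leq_sum => S _; exact: card_joined.
apply: (half_of_sum low up); have l0 : 0 < l by apply: leq_trans l_ge.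
apply: few_classes l0 d_gt0 paths_le _ dbig.
by have := leq_divM l d; lia.
Qed.

(** Confronted with the lower bound [many_near], this excludes blocks of length 1. *)
Lemma near_sum_block1 : d = 1 -> near_sum = 0.
Proof.
move=> d1; rewrite /near_sum big1 // => Q _; rewrite big1 // => v _; rewrite big1 // => Q' _.
suff -> : early_near Q v = 0 by rewrite !mul0n.
rewrite /early_near -sum_bool_card big1 // => A _; apply/eqP; rewrite eqb0.
apply/negP => /existsP[r /and5P[rA _ lt /eqP e vA]].
rewrite /blk d1 !divn1 in e.
by rewrite (idx_inj (E_inc rA) (E_inc vA) e) ltnn in lt.
Qed.

Lemma sum_E_blk r : \sum_A \sum_v ([&& E r A, inc v A & blk X d A v == blk X d A r] : nat) <= m * d.
Proof.
rewrite -(sumEv r) big_distrl; apply: leq_sum => A _ /=; case rA: (E r A) => /=; last by rewrite big1.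
rewrite mul1n sum_bool_card; exact: card_blk.
Qed.

Lemma nearE_le A Q v : (nearE A Q v : nat) <=
  \sum_r M r Q * [&& E r A, inc v A & blk X d A v == blk X d A r].
Proof.
apply: leq_trans (exists_le_sum _) _; apply: leq_sum => r _.
case rA: (E r A) => //=; case rQ: (M r Q) => //=; rewrite mul1n.
case: (pos r < pos v) => //=; rewrite eq_sym.
case vA: (E v A); last by rewrite andbF.
by rewrite (E_inc vA) andbT.
Qed.

Lemma sum_early_near_at Q : \sum_v early_near Q v <= (\sum_r M r Q) * (m * d).
Proof.
under eq_bigr => v _ do rewrite /early_near -sum_bool_card.
apply: (@leq_trans (\sum_v \sum_A \sum_r M r Q * [&& E r A, inc v A & blk X d A v == blk X d A r])).
  by apply: leq_sum => v _; apply: leq_sum => A _; apply: nearE_le.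
rewrite exchange_big /=; under eq_bigr => A _ do rewrite exchange_big.
rewrite exchange_big /= big_distrl; apply: leq_sum => r _ /=.
under eq_bigr => A _ do rewrite -big_distrr /=.
by rewrite -big_distrr leq_mul2l sum_E_blk orbT.
Qed.

Lemma sum_early_near : \sum_Q \sum_v early_near Q v <= n * m ^ 2 * d.
Proof.
apply: (@leq_trans (\sum_Q (\sum_r M r Q) * (m * d))).
  by apply: leq_sum => Q _; apply: sum_early_near_at.
rewrite -big_distrl exchange_big /=; under eq_bigr => r _ do rewrite sumMv.
by rewrite sum_nat_const -mulnn !mulnA.
Qed.

(** The counterpart of [card_cross] for early paths: [r'] ranges over a single block of [A'] and
    determines [Q], as two middle paths leaving [A] cannot meet at [r']. *)
Lemma card_cross_E v A A' : E v A -> E v A' ->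
  #|[set Q | [exists r, exists r', [&& E r A, M r Q, E r' A', M r' Q, pos r < pos r'
      & blk X d A' r' == blk X d A' v]]]| <= d.
Proof.
move=> vA vA'; apply: leq_trans (card_blk X A' (blk X d A' v) d_gt0).
apply: (@leq_card_rel _ _ _ _ (fun Q r' => [exists r, [&& E r A, M r Q, E r' A', M r' Q & pos r < pos r']])).
  move=> Q; rewrite inE => /existsP[r /existsP[r' /and5P[rA rQ r'A r'Q /andP[lt e]]]].
  exists r'; first by rewrite inE e (E_inc r'A).
  by apply/existsP; exists r; rewrite rA rQ r'A r'Q.
move=> Q Q' w _ _ _ /existsP[r /and5P[rA rQ _ wQ lt]] /existsP[r' /and5P[r'A r'Q _ wQ' lt']].
exact: (hit_uniq (E_M rA rQ) (E_M r'A r'Q) (E_inc rA) (M_inc rQ) (E_inc r'A) (M_inc r'Q)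
  (M_inc wQ) (M_inc wQ') lt lt').
Qed.

Lemma sum_early_near_sq : \sum_Q \sum_v early_near Q v ^ 2 <= 3 * (n * m ^ 2 * d).
Proof.
suff : \sum_Q \sum_v early_near Q v ^ 2 <= \sum_Q \sum_v early_near Q v + n * (m ^ 2 * (2 * d)).
  by have := sum_early_near; set a := \sum_Q _; set b := \sum_Q _; lia.
rewrite exchange_big [X in _ <= X + _]exchange_big /= -sum_nat_const -big_split /=.
apply: leq_sum => v _.
apply: (@leq_trans (\sum_Q \sum_A \sum_A' ((A == A') && nearE A Q v : nat) +
                    \sum_A \sum_A' (E v A && E v A') * (2 * d))); last first.
  rewrite leq_add //; last first.
    under eq_bigr => A _ do rewrite -big_distrl /=.
    by rewrite -big_distrl leq_mul2r -sqr_card_sum card_E leqnn orbT.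
  apply: leq_sum => Q _; rewrite /early_near -sum_bool_card; apply: leq_sum => A _.
  rewrite (bigD1 A) //= eqxx big1 ?addn0 // => A' neq.
  by rewrite eq_sym (negbTE neq).
apply: (@leq_trans (\sum_A \sum_A' \sum_Q (nearE A Q v && nearE A' Q v : nat))).
  under eq_bigr => Q _ do rewrite /early_near sqr_card_sum.
  by rewrite exchange_big leq_sum // => A _; rewrite exchange_big.
rewrite [X in _ <= X + _]exchange_big /= -big_split leq_sum //= => A _.
rewrite [X in _ <= X + _]exchange_big /= -big_split leq_sum //= => A' _.
have [<-|neq] /= := eqVneq A A'.
  by apply: leq_trans (leq_addr _ _); apply: leq_sum => Q _; rewrite andbb.
case/boolP: (E v A && E v A') => [/andP[vA vA']|no]; last first.
  rewrite big1 // => Q _; apply/eqP; rewrite eqb0; apply: contraNN no.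
  by move=> /andP[/existsP[r /and5P[_ _ _ _ ->]] /existsP[r' /and5P[_ _ _ _ ->]]].
rewrite mul1n mul2n -addnn; apply: leq_trans (leq_addl _ _).
apply: leq_trans (leq_add (card_cross_E vA vA') (card_cross_E vA' vA)).
rewrite -!sum_bool_card -big_split /=; apply: leq_sum => Q _.
case/boolP: (nearE A Q v) => //= /existsP[r /and5P[rA rQ lt e _]].
case/boolP: (nearE A' Q v) => //= /existsP[r' /and5P[r'A r'Q lt' e' _]].
case: (ltngtP (pos r) (pos r')) => c.
- rewrite (_ : [exists s0, _] = true) //.
  by apply/existsP; exists r; apply/existsP; exists r'; rewrite rA rQ r'A r'Q c e'.
- rewrite [X in _ + X](_ : _ = true :> nat) ?addn1 //; congr (nat_of_bool _).
  by apply/existsP; exists r'; apply/existsP; exists r; rewrite rA rQ r'A r'Q c e.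
(* Now [A] and [A'] meet both at [r] and at [v], so [r = v], although [r] comes before [v]. *)
- have er := pos_inj (M_inc rQ) (M_inc r'Q) c; rewrite -er in r'A.
  by rewrite (share_one neq (E_inc rA) (E_inc r'A) (E_inc vA) (E_inc vA')) ltnn in lt.
Qed.

(** Everything near the middle path [Q] happens in a small set of nodes, where
    the middle paths meeting it often are long. *)
Definition clusterE Q := [set v | 0 < early_near Q v].
Definition clusterL Q := [set w | [exists S, exists s,
  [&& M s Q, L s S, inc w S & blk X d S w == blk X d S s]]].
Definition cluster Q := clusterE Q :|: clusterL Q.

Lemma card_cluster Q : #|cluster Q| <= 2 * (l * m * d).
Proof.
apply: leq_trans (leq_card_setU _ _) _; rewrite mul2n -addnn leq_add //.
  rewrite -mulnA; apply: leq_trans (_ : (\sum_r M r Q) * (m * d) <= _); last first.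
    by rewrite leq_mul2r sumM orbT.
  apply: leq_trans (sum_early_near_at Q); rewrite -sum_bool_card; apply: leq_sum => v _.
  by case: (early_near Q v).
rewrite -sum_bool_card.
apply: (@leq_trans (\sum_w \sum_S \sum_s ([&& M s Q, L s S, inc w S & blk X d S w == blk X d S s] : nat))).
  apply: leq_sum => w _; apply: leq_trans (exists_le_sum _) _; apply: leq_sum => S _.
  exact: exists_le_sum.
rewrite exchange_big; under eq_bigr => S _ do rewrite exchange_big.
rewrite exchange_big /=; apply: (@leq_trans (\sum_s M s Q * (m * d))).
  apply: leq_sum => s _; rewrite mulnA -(sumLv s) big_distrr big_distrl; apply: leq_sum => S _ /=.
  case: (M s Q) => /=; last by rewrite big1.
  case: (L s S) => /=; last by rewrite big1.
  by rewrite !mul1n sum_bool_card; apply: card_blk.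
by rewrite -big_distrl -mulnA leq_mul2r sumM orbT.
Qed.

Definition shared Q Q' := #|[set w in cluster Q | M w Q']|.

Lemma shared_le Q Q' : shared Q Q' <= l.
Proof.
apply: leq_trans (len_le Q'); apply/subset_leq_card/subsetP => v; rewrite !inE => /andP[_].
exact: M_inc.
Qed.

(** The node [s'] where [S] meets [Q'] lies in [clusterL Q], and by [hit_uniq] it determines [S]. *)
Lemma late_near_shared Q Q' : late_near Q Q' <= shared Q Q'.
Proof.
apply: (@leq_card_rel _ _ _ _ (fun S s' => [exists s,
  [&& M s Q, L s S, M s' Q', L s' S, pos s < pos s' & blk X d S s == blk X d S s']])).
  move=> S; rewrite inE => /existsP[s /existsP[s' H]].
  exists s'; last by apply/existsP; exists s.
  case/and5P: H => sQ sS s'Q' s'S /andP[_ e]; rewrite inE s'Q' andbT !inE; apply/orP; right.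
  by apply/existsP; exists S; apply/existsP; exists s; rewrite sQ sS (L_inc s'S) eq_sym.
move=> S S' w _ _ _ /existsP[s /and5P[sQ sS _ wS /andP[lt _]]] /existsP[t /and5P[tQ tS _ wS' /andP[lt' _]]].
exact: (hit_uniq (M_L sQ sS) (M_L tQ tS) (M_inc sQ) (L_inc sS) (M_inc tQ) (L_inc tS)
  (L_inc wS) (L_inc wS') lt lt').
Qed.

Definition level t Q Q' := t <= shared Q Q' < 2 * t.
Definition population t Q := #|[set Q' | level t Q Q']|.
Definition deg t Q v := (v \in cluster Q) * #|[set Q' | M v Q' && level t Q Q']|.
Definition energy t Q := \sum_v deg t Q v ^ 2.

Lemma sum_deg t Q : \sum_v deg t Q v <= 2 * t * population t Q.
Proof.
apply: (@leq_trans (\sum_v \sum_Q' level t Q Q' * ((v \in cluster Q) && M v Q'))).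
  apply: leq_sum => v _; rewrite /deg -sum_bool_card big_distrr /=; apply: leq_sum => Q' _.
  by case: (v \in _); case: (M v Q'); case: (level _ _ _).
rewrite exchange_big /population -sum_bool_card big_distrr /=; apply: leq_sum => Q' _.
rewrite -big_distrr /= sum_bool_card -/(shared Q Q') mulnC.
by case/boolP: (level t Q Q') => [/andP[_ /ltnW]|]; rewrite ?muln0 // !muln1.
Qed.

Lemma energy_deg t Q : energy t Q <= m * (2 * t * population t Q).
Proof.
apply: (@leq_trans (m * \sum_v deg t Q v)); last by rewrite leq_mul2l sum_deg orbT.
rewrite big_distrr /=; apply: leq_sum => v _; rewrite -mulnn leq_mul2r; apply/orP; right.
rewrite -(card_M v) /deg; case: (v \in _) => //=; rewrite mul1n.
by apply/subset_leq_card/subsetP => Q'; rewrite !inE => /andP[].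
Qed.

(** Two distinct paths share at most one node, so pairs of distinct paths contribute at most the
    square of the population. This bound serves small populations, [energy_deg] large ones. *)
Lemma energy_pairs t Q : energy t Q <= population t Q ^ 2 + 2 * t * population t Q.
Proof.
rewrite addnC; apply: leq_trans (leq_add (sum_deg t Q) (leqnn _)).
rewrite sqr_card_sum.
pose b v B := [&& v \in cluster Q, M v B & level t Q B].
have degE v : deg t Q v = \sum_B (b v B : nat).
  rewrite /deg -sum_bool_card big_distrr; apply: eq_bigr => B _ /=; rewrite /b.
  by case: (v \in _); case: (M v B); case: (level _ _ _).
rewrite /energy; apply: (@leq_trans (\sum_B \sum_B' \sum_v (b v B && b v B' : nat))).
  under eq_bigr => v _ do rewrite degE -mulnn big_distrlr /=.
  rewrite exchange_big leq_sum //= => B _; rewrite exchange_big leq_sum //= => B' _.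
  by apply: leq_sum => v _; case: (b v B); case: (b v B').
under [X in _ <= X + _]eq_bigr => v _ do rewrite degE.
rewrite [X in _ <= X + _]exchange_big -big_split /=; apply: leq_sum => B _.
rewrite (bigD1 B) //= leq_add //; first by apply: leq_sum => v _; rewrite andbb.
rewrite [X in _ <= X](bigD1 B) //=; apply: leq_trans (leq_addl _ _); apply: leq_sum => B' neq.
case/boolP: (level t Q B && level t Q B') => [_|no]; last first.
  rewrite big1 // => v _; apply/eqP; rewrite eqb0; apply: contraNN no.
  by move=> /andP[/and3P[_ _ ->] /and3P[_ _ ->]].
have uniq u v : b u B && b u B' -> b v B && b v B' -> u = v.
  move=> /andP[/and3P[_ uB _] /and3P[_ uB' _]] /andP[/and3P[_ vB _] /and3P[_ vB' _]].
  by rewrite eq_sym in neq; apply: (share_one neq); apply: M_inc.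
by rewrite -(exists_eq_sum uniq) leq_b1.
Qed.

Definition level_sum t :=
  \sum_Q \sum_v \sum_Q' level t Q Q' * (early_near Q v * M v Q' * late_near Q Q').

(** On this level [late_near] is below [2 t]. Cauchy's inequality over the pairs [(Q, v)] then
    separates the squares of [early_near], already bounded, from the energies. *)
Lemma level_sum_sq t :
  level_sum t ^ 2 <= 12 * (n * m ^ 2 * d) * (t ^ 2 * \sum_Q energy t Q).
Proof.
have le : level_sum t <= 2 * t * \sum_(w : P * V) early_near w.1 w.2 * deg t w.1 w.2.
  rewrite -(pair_big predT predT (fun Q v => early_near Q v * deg t Q v)) /= big_distrr.
  apply: leq_sum => Q _; rewrite big_distrr; apply: leq_sum => v _ /=.
  (* A node with positive [early_near] lies in [clusterE Q], so the restriction of [deg] to the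
     cluster loses nothing. *)
  case: (posnP (early_near Q v)) => [->|k0]; first by rewrite big1 // => Q' _; rewrite !mul0n muln0.
  rewrite /deg !inE k0 /= mul1n mulnCA -sum_bool_card !big_distrr; apply: leq_sum => Q' _ /=.
  case/boolP: (level t Q Q') => [/andP[_ lt]|_]; last by rewrite mul0n.
  rewrite mul1n andbT -!mulnA leq_mul2l; apply/orP; right; rewrite mulnC mulnA leq_mul2r.
  by apply/orP; right; apply: leq_trans (late_near_shared Q Q') (ltnW lt).
have cs := leq_cauchy (fun w : P * V => early_near w.1 w.2) (fun w : P * V => deg t w.1 w.2).
rewrite -!(pair_big predT predT (fun Q v => _ Q v ^ 2)) /= in cs.
have e : (2 * t) ^ 2 * (3 * (n * m ^ 2 * d) * \sum_Q energy t Q) =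
  12 * (n * m ^ 2 * d) * (t ^ 2 * \sum_Q energy t Q) by rewrite expnMn; lia.
rewrite -e; have := leq_mul le le; rewrite !mulnn expnMn => /leq_trans; apply.
rewrite leq_mul2l; apply/orP; right; apply: leq_trans cs _.
by rewrite leq_mul2r sum_early_near_sq orbT.
Qed.

(** Pairs with fewer than [2 ^ j0] shared nodes are paid for by the first moment [sum_early_near].
    For all others [shared] is at most [l], so one of the [K] levels contains them. *)
Lemma near_sum_levels j0 K : l < 2 ^ (j0 + K) ->
  near_sum <= n * m ^ 3 * d * 2 ^ j0 + \sum_(j < K) level_sum (2 ^ (j0 + j)).
Proof.
move=> lK.
have low : \sum_Q \sum_v \sum_Q' early_near Q v * M v Q' * 2 ^ j0 <= n * m ^ 3 * d * 2 ^ j0.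
  under eq_bigr => Q _ do under eq_bigr => v _ do rewrite -big_distrl -big_distrr /= sumMv.
  under eq_bigr => Q _ do rewrite -!big_distrl /=.
  rewrite -!big_distrl leq_mul2r; apply/orP; right.
  rewrite (_ : n * m ^ 3 * d = n * m ^ 2 * d * m) ?leq_mul2r ?sum_early_near ?orbT //.
  by rewrite expnSr; lia.
apply: leq_trans (leq_add low (leqnn _)).
rewrite /level_sum [X in _ <= _ + X]exchange_big -big_split /=; apply: leq_sum => Q _.
rewrite [X in _ <= _ + X]exchange_big -big_split /=; apply: leq_sum => v _.
rewrite [X in _ <= _ + X]exchange_big -big_split /=; apply: leq_sum => Q' _.
have [small|large] := ltnP (shared Q Q') (2 ^ j0).
  apply: leq_trans (leq_addr _ _); rewrite leq_mul2l; apply/orP; right.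
  exact: leq_trans (late_near_shared Q Q') (ltnW small).
apply: leq_trans (leq_addl _ _); rewrite -big_distrl /=.
suff [i lev] : exists i : 'I_K, level (2 ^ (j0 + i)) Q Q'.
  by rewrite (bigD1 i) //= lev mulnDl mul1n leq_addr.
have a0 : 0 < shared Q Q' by apply: leq_trans large; rewrite expn_gt0.
have lt2 := trunc_log_bounds (isT : 1 < 2) a0; set t := trunc_log 2 _ in lt2.
have j0t : j0 <= t by rewrite /t -[j0](@trunc_expnK 2) // leq_trunc_log.
have tK : t - j0 < K.
  have : 2 ^ t < 2 ^ (j0 + K).
    by case/andP: lt2 => h1 _; apply: leq_ltn_trans h1 _; apply: leq_ltn_trans (shared_le _ _) lK.
  by rewrite ltn_exp2l //; lia.
by exists (Ordinal tK); rewrite /level /= subnKC // -expnS.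
Qed.

Lemma level_energy j0 K b : 0 < n -> 0 < m -> d <= l -> 108 * (2 * 1728) * n <= d * m * l ^ 2 ->
  4 * (2 * 1728) * (2 ^ j0 * d) <= l -> l < 2 ^ (j0 + K) ->
  (forall (j : 'I_K) Q, (2 ^ (j0 + j)) ^ 2 * energy (2 ^ (j0 + j)) Q <= b) ->
  m ^ 3 * l ^ 3 <= 1152 * (2 * 1728) ^ 2 * (K ^ 2 * d * b).
Proof.
move=> n0 m0 dl dbig j0l lK enb.
have big := many_near dl dbig.
set la := \sum_(j < K) level_sum (2 ^ (j0 + j)).
have split : near_sum <= n * m ^ 3 * d * 2 ^ j0 + la by apply: near_sum_levels.
have sq : la ^ 2 <= K * (K * (12 * (n * m ^ 2 * d) * (p * b))).
  have cs := leq_cauchy (fun _ : 'I_K => 1) (fun j : 'I_K => level_sum (2 ^ (j0 + j))).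
  rewrite sum_nat_const muln1 card_ord in cs.
  have -> : la = \sum_(j < K) 1 * level_sum (2 ^ (j0 + j)).
    by apply: eq_bigr => j _; rewrite mul1n.
  apply: leq_trans cs _; rewrite leq_mul2l; apply/orP; right.
  rewrite -[X in X * (12 * _ * _)]card_ord -sum_nat_const; apply: leq_sum => j _.
  apply: leq_trans (level_sum_sq _) _; rewrite leq_mul2l; apply/orP; right.
  by rewrite big_distrr -sum_nat_const leq_sum //= => Q _; apply: enb.
move: (2 * 1728) big j0l {dbig} => c big j0l.
(* By the condition on [j0] the pairs below [2 ^ j0] make up at most a quarter of the left side. *)
have low : n * m ^ 3 * l <= 4 * c * la.
  have := leq_mul (leqnn (n * m ^ 3)) j0l.
  have := leq_mul (leqnn c) split.
  rewrite mulnDr; move: big; set x := n * m ^ 3 * l; set y := c * near_sum.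
  by lia.
exact: levels_arith n0 m0 low sq paths_le.
Qed.
End Regular.

(** * Subsystems and splitting *)

Section Pullback.
Variables (V P V' P' : finType) (X : psystem V P).
Variables (phi : V' -> V) (psi : P' -> P) (inc' : V' -> P' -> bool).
Hypothesis inc_phi : forall x Q, inc' x Q -> inc X (phi x) (psi Q).
Hypothesis phi_inj : forall Q x y, inc' x Q -> inc' y Q -> phi x = phi y -> x = y.
Hypothesis psi_inj : forall x Q Q', inc' x Q -> inc' x Q' -> psi Q = psi Q' -> Q = Q'.

(** The axioms are universal statements about incidences, so they pass to every relation that maps
    into [inc X]. Nodes need to stay distinct only along one path, and paths only at one node; this
    admits copies of nodes and pieces of paths. *)
Definition pullback : psystem V' P'.
Proof.
exists inc' (fun x => pos X (phi x)) (fun Q => tm X (psi Q)).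
- move=> Q v w vQ wQ e; apply: (phi_inj vQ wQ).
  exact: (pos_inj (inc_phi vQ) (inc_phi wQ) e).
- move=> v Q Q' vQ vQ' e; apply: (psi_inj vQ vQ').
  exact: (tm_inj (inc_phi vQ) (inc_phi vQ') e).
- move=> A Q B S r r' s s' AQ rA rQ r'A rr' sQ rs r'B s'B r's' s'S sS s's.
  exact: (@no_bridge _ _ X (psi A) (psi Q) (psi B) (psi S) (phi r) (phi r') (phi s) (phi s')
    AQ (inc_phi rA) (inc_phi rQ) (inc_phi r'A) rr' (inc_phi sQ) rs (inc_phi r'B) (inc_phi s'B)
    r's' (inc_phi s'S) (inc_phi sS) s's).
Defined.
End Pullback.

(** By cardinality [f] is a bijection of [A] onto the numbers below [#|A|], so no value in the
    interval is missed. *)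
Lemma card_interval (T : finType) (A : {set T}) (f : T -> nat) a m :
  {in A &, injective f} -> {in A, forall x, f x < #|A|} -> a + m <= #|A| ->
  #|[set x in A | a <= f x < a + m]| = m.
Proof.
move=> inj lt am.
have imA : [set i : 'I_#|A|.+1 | [exists x in A, f x == i]] = [set i : 'I__ | i < #|A|].
  apply/eqP; rewrite eqEcard; apply/andP; split.
    by apply/subsetP => i; rewrite !inE => /existsP[x /andP[xA /eqP <-]]; apply: lt.
  apply: (@leq_trans #|A|).
    apply: (@leq_trans #|'I_#|A| |); last by rewrite card_ord.
    apply: (@leq_card_rel _ _ _ _ (fun (i : 'I_#|A|.+1) (j : 'I_#|A|) => i == j :> nat)).
      by move=> i; rewrite inE => lti; exists (Ordinal lti).
    by move=> i i' j _ _ _ /eqP e /eqP e'; apply/val_inj; rewrite /= e e'.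
  apply: (@leq_card_rel _ _ _ _ (fun x (i : 'I__) => f x == i)).
    move=> x xA; have ltx : f x < #|A|.+1 by rewrite ltnS ltnW // lt.
    by exists (Ordinal ltx) => //; rewrite inE; apply/existsP; exists x; rewrite xA /=.
  by move=> x x' j xA x'A _ /eqP e /eqP e'; apply: inj => //; rewrite e e'.
apply/eqP; rewrite eqn_leq; apply/andP; split.
  apply: (@leq_trans #|'I_m|); last by rewrite card_ord.
  apply: (@leq_card_rel _ _ _ _ (fun x (j : 'I_m) => f x == a + j)).
    move=> x; rewrite inE => /and3P[_ h1 h2].
    have ltx : f x - a < m by lia.
    by exists (Ordinal ltx) => //=; apply/eqP; lia.
  move=> x x' j; rewrite !inE => /andP[xA _] /andP[x'A _] _ /eqP e /eqP e'.
  by apply: inj => //; rewrite e e'.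
apply: (@leq_trans #|'I_m|); first by rewrite card_ord.
apply: (@leq_card_rel _ _ _ _ (fun (j : 'I_m) x => f x == a + j)).
  move=> j _; have ltj : a + j < #|A| by apply: leq_trans am; rewrite -addnS leq_add2l.
  have ltj' : a + j < #|A|.+1 by apply: ltnW.
  have : Ordinal ltj' \in [set i : 'I__ | i < #|A|] by rewrite inE.
  rewrite -imA inE => /existsP[x /andP[xA /eqP e]]; exists x; last by apply/eqP.
  by rewrite inE xA e /= leq_addr /=; have := ltn_ord j; lia.
by move=> j j' x _ _ _ /eqP e /eqP e'; apply/val_inj/eqP; rewrite -(eqn_add2l a) -e -e'.
Qed.

Lemma card_blocks K t d : 0 < d -> t <= K -> #|[set i : 'I_K.+1 | i.+1 * d <= t]| = t %/ d.
Proof.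
move=> d0 tK; transitivity #|[set i : 'I_K.+1 | i < t %/ d]|.
  by apply: eq_card => i; rewrite !inE leq_divRL.
have le : t %/ d <= K.+1 by apply: leq_trans (leq_div _ _) _; apply: ltnW.
by rewrite -sum1dep_card (big_ord_narrow le) sum1_card card_ord.
Qed.

Section Rank.
Variables (V P : finType) (X : psystem V P) (v : V).
Notation paths := [set Q | inc X v Q].

Definition rank Q := #|[set Q' | inc X v Q' & tm X Q' < tm X Q]|.

Lemma rank_lt Q Q' : inc X v Q -> tm X Q < tm X Q' -> rank Q < rank Q'.
Proof.
move=> vQ QQ'; apply/proper_card/properP; split.
  by apply/subsetP => u; rewrite !inE => /andP[-> /=] uv; apply: ltn_trans QQ'.
by exists Q; rewrite !inE ?vQ ?QQ' ?ltnn ?andbF.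
Qed.

Lemma rank_inj Q Q' : inc X v Q -> inc X v Q' -> rank Q = rank Q' -> Q = Q'.
Proof.
move=> vQ vQ' e; apply: (tm_inj vQ vQ').
by case: (ltngtP (tm X Q) (tm X Q')) => // c;
  [have := rank_lt vQ c|have := rank_lt vQ' c]; rewrite e ltnn.
Qed.

Lemma rank_tm Q Q' : inc X v Q -> inc X v Q' -> rank Q < rank Q' -> tm X Q < tm X Q'.
Proof.
move=> vQ vQ' lt; case: (ltngtP (tm X Q) (tm X Q')) => // c.
  by have := rank_lt vQ' c; lia.
by move: lt; rewrite (tm_inj vQ vQ' c) ltnn.
Qed.

Lemma rank_max Q : inc X v Q -> rank Q < #|paths|.
Proof.
move=> vQ; apply/proper_card/properP; split.
  by apply/subsetP => u; rewrite !inE => /andP[].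
by exists Q; rewrite !inE ?ltnn ?andbF.
Qed.

Lemma card_rank a m : a + m <= #|paths| -> #|[set Q | inc X v Q & a <= rank Q < a + m]| = m.
Proof.
move=> am; rewrite -[RHS](@card_interval _ paths rank a m) //.
- by apply: eq_card => Q; rewrite !inE.
- by move=> Q Q'; rewrite !inE => vQ vQ'; apply: rank_inj.
- by move=> Q; rewrite inE; apply: rank_max.
Qed.
End Rank.

Lemma block_quot q s i D a b : s < D -> i * D + a <= q * D + s ->
  q * D + s < i * D + b -> b <= D -> q = i.
Proof.
move=> sD h1 h2 bD; case: (ltngtP q i) => // c.
  have : q.+1 * D <= i * D by rewrite leq_mul2r c orbT.
  by rewrite mulSn; move: (q * D) (i * D) h1 h2 => u v; lia.
have : i.+1 * D <= q * D by rewrite leq_mul2r c orbT.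
by rewrite mulSn; move: (q * D) (i * D) h1 h2 => u v; lia.
Qed.

Section Split.
Variables (V P : finType) (X : psystem V P) (m : nat).
Hypothesis m_gt0 : 0 < m.

(** A node becomes one copy for each full group of [3 * m] consecutive paths
    through it. *)
Definition through v := #|[set Q | inc X v Q]|.
Definition full (x : V * 'I_#|P|.+1) := x.2.+1 * (3 * m) <= through x.1.
Definition copies : finType := {x : V * 'I_#|P|.+1 | full x}.
Definition copy_inc (x : copies) Q :=
  inc X (val x).1 Q && (rank X (val x).1 Q %/ (3 * m) == (val x).2).

Definition split_system : psystem copies P.
Proof.
apply: (@pullback V P copies P X (fun x => (val x).1) id copy_inc).
- by move=> x Q /andP[].
- move=> Q x y /andP[xQ /eqP e] /andP[yQ /eqP e'] exy; apply/val_inj.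
  case: (val x) (val y) e e' exy => [v i] [w j] /= e e' ew; rewrite -{}ew in e' *.
  by congr (_, _); apply/val_inj; rewrite /= -e -e'.
- by [].
Defined.

Definition third k (x : copies) Q :=
  copy_inc x Q && (k * m <= rank X (val x).1 Q %% (3 * m) < k.+1 * m).

Lemma third_inc k x Q : third k x Q -> inc split_system x Q.
Proof. by case/andP. Qed.

Lemma third_tm k k' x Q Q' : k < k' -> third k x Q -> third k' x Q' ->
  tm split_system Q < tm split_system Q'.
Proof.
move=> kk' /andP[/andP[xQ /eqP e] /andP[_ lt]] /andP[/andP[xQ' /eqP e'] /andP[lt' _]].
apply: (rank_tm xQ xQ').
rewrite (divn_eq (rank _ _ Q) (3 * m)) (divn_eq (rank _ _ Q') (3 * m)) e e' ltn_add2l.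
by apply: leq_trans lt _; apply: leq_trans lt'; rewrite leq_mul2r kk' orbT.
Qed.

Lemma card_third k x : k < 3 -> #|[set Q | third k x Q]| = m.
Proof.
move=> k3; have M0 : 0 < 3 * m by rewrite muln_gt0 m_gt0.
have fullx := valP x; rewrite /full in fullx.
have le i : i * (3 * m) + k * m + m <= i.+1 * (3 * m).
  by have := leq_mul k3 (leqnn m); lia.
rewrite -[RHS](card_rank (leq_trans (le _) fullx)).
apply: eq_card => Q; rewrite !inE /third /copy_inc -andbA; congr (_ && _).
move: (rank _ _ _) (nat_of_ord _) => r i.
have lt := ltn_pmod r M0; have km : k.+1 * m <= 3 * m by rewrite leq_mul2r k3 orbT.
rewrite {4 5}(divn_eq r (3 * m)).
move: (r %/ _) (r %% _) lt => q s lt; rewrite mulSn in km *.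
have [->|neq] /= := eqVneq q i; first by rewrite -addnA !ltn_add2l leq_add2l [k * m + m]addnC.
apply/esym/negbTE/negP => /andP[h1 h2]; case/eqP: neq.
apply: (block_quot lt h1 _ km); by rewrite -addnA [k * m + m]addnC in h2.
Qed.

Lemma card_copies : #|copies| = \sum_v through v %/ (3 * m).
Proof.
have M0 : 0 < 3 * m by rewrite muln_gt0 m_gt0.
transitivity (\sum_v \sum_(i | full (v, i)) 1).
  by rewrite pair_big_dep card_sig -sum1_card; apply: eq_bigl => -[v i].
apply: eq_bigr => v _; rewrite sum1dep_card.
by rewrite -(@card_blocks #|P|) //; exact: max_card.
Qed.

(** The incomplete group at a node has fewer than [3 m] paths. Altogether at most [3 n m] incidences
    are lost, which is at most half of [p l]. *)
Lemma copies_bounds l : (forall Q, #|[set v | inc X v Q]| = l) ->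
  6 * (#|V| * m) <= #|P| * l ->
  #|P| * l <= 6 * (#|copies| * m) /\ 3 * (#|copies| * m) <= #|P| * l.
Proof.
move=> lens le; have M0 : 0 < 3 * m by rewrite muln_gt0 m_gt0.
have sT : \sum_v through v = #|P| * l.
  rewrite -sum_nat_const; under eq_bigr => v _ do rewrite /through -sum_bool_card.
  rewrite exchange_big; apply: eq_bigr => Q _ /=; by rewrite sum_bool_card lens.
have up : 3 * m * #|copies| <= #|P| * l.
  by rewrite card_copies big_distrr -sT /= leq_sum // => v _; rewrite mulnC leq_divM.
have low : #|P| * l <= 3 * m * #|copies| + #|V| * (3 * m).
  rewrite card_copies big_distrr -sT -sum_nat_const -big_split /= leq_sum // => v _.
  by rewrite mulnC -mulSnr ltnW // ltn_ceil.
split; lia.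
Qed.

Lemma len_split Q : #|[set x | inc split_system x Q]| <= #|[set v | inc X v Q]|.
Proof.
apply: (@leq_card_rel _ _ _ _ (fun x v => (val x).1 == v)).
  by move=> x; rewrite inE => /andP[h _]; exists (val x).1; rewrite ?inE.
move=> x y v; rewrite !inE => xQ yQ _ /eqP e /eqP e'.
by apply: (@pos_inj _ _ split_system Q) => //=; rewrite e e'.
Qed.
End Split.

(** * Arithmetic of the induction step *)

Lemma expn_bounded_exp2 a k : k ^ a <= a ^ a * 2 ^ k.
Proof.
have [->|a0] := posnP a; first by rewrite !expn0 mul1n expn_gt0.
apply: (@leq_trans ((a * 2 ^ (k %/ a)) ^ a)).
  rewrite leq_exp2r //; apply: leq_trans (_ : a * (k %/ a).+1 <= _).
    by rewrite mulnC ltnW // ltn_ceil.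
  by rewrite leq_mul2l ltn_expl ?orbT.
by rewrite expnMn -expnM leq_mul2l leq_exp2l // leq_divM orbT.
Qed.

(** [K^30 = O(2^K)], and the exponent 30 turns [w^15] into a bound linear in [w] for [K^2]. This
    absorbs the loss from the dyadic levels. *)
Lemma few_levels e : 0 < e ->
  exists2 k, 0 < k & forall K w, 2 ^ K <= e * w ^ 15 -> K ^ 2 <= k * w.
Proof.
move=> e0; have [c c0 cP] : exists2 c, 0 < c & forall K, K ^ 30 <= c * 2 ^ K.
  by exists (30 ^ 30); [rewrite expn_gt0 | exact: expn_bounded_exp2].
exists (c * e) => [|K w le]; first by rewrite muln_gt0 c0.
rewrite -(@leq_exp2r _ _ 15) // -expnM.
apply: leq_trans (cP K) _; apply: leq_trans (leq_mul (leqnn c) le) _.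
rewrite mulnA expnMn leq_mul2r; apply/orP; right.
by rewrite -[X in X <= _]expn1 leq_pexp2l // muln_gt0 c0.
Qed.

Lemma cube_root y : 0 < y -> exists2 w, 0 < w & w ^ 3 <= y <= 8 * w ^ 3.
Proof.
move=> y0; have ex : exists w, w ^ 3 <= y by exists 1.
have ub w : w ^ 3 <= y -> w <= y.
  by apply: leq_trans; case: w => // w; rewrite -[X in X <= _]expn1 leq_pexp2l.
case: (ex_maxnP ex ub) => w wy max.
have w0 : 0 < w by apply: max.
exists w => //; rewrite wy /=; rewrite leqNgt; apply/negP => lt.
suff : w.+1 <= w by rewrite ltnn.
apply: max; apply: leq_trans (ltnW lt); rewrite -(expnMn 2 w 3) leq_exp2r //; lia.
Qed.

(** The system induced on a small set [W] by paths with [t] nodes in [W]. *)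
Section Cluster.
Variables (V P : finType) (X : psystem V P) (M : V -> P -> bool).
Variables (W : {set V}) (B : {set P}) (t : nat).
Hypothesis M_inc : forall v Q, M v Q -> inc X v Q.
Hypothesis large : forall Q, Q \in B -> t <= #|[set w in W | M w Q]|.

(** [size_bound] asks for paths of one common length. Any [t] of the nodes may be kept, since
    deleting nodes from a path preserves all axioms. *)
Definition trim Q := [set x in take t (enum [set w in W | M w Q])].

Lemma trimP Q v : v \in trim Q -> v \in W /\ M v Q.
Proof. by rewrite inE => /mem_take; rewrite mem_enum !inE => /andP[]. Qed.

Definition cluster_inc (x : {v | v \in W}) (Q : {Q | Q \in B}) := val x \in trim (val Q).

Definition cluster_system : psystem {v | v \in W} {Q | Q \in B}.
Proof.
apply: (@pullback V P _ _ X val val cluster_inc).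
- by move=> x Q /trimP[_ /M_inc].
- by move=> Q x y _ _ /val_inj.
- by move=> x Q Q' _ _ /val_inj.
Defined.

Lemma cluster_len Q : #|[set x | inc cluster_system x Q]| = t.
Proof.
transitivity #|trim (val Q)|; last first.
  rewrite cardsE (card_uniqP _) ?take_uniq ?enum_uniq // size_take -cardE.
  by case: ltngtP (large (valP Q)).
rewrite -(card_imset _ val_inj); apply: eq_card => v.
apply/imsetP/idP => [[x xQ ->]|vQ]; first by rewrite inE in xQ.
by have [vW _] := trimP vQ; exists (exist _ v vW); rewrite ?inE.
Qed.
End Cluster.

(** A nearly minimal block length is of order [n' / (m l^2)], hence of order [n^2 / (p l^3)]. The
    failure of the desired bound makes this at most a constant times [y^5 / C]. *)
Lemma block_size_bound C c n n' m p l e y :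
  0 < n -> 0 < p * l -> p * l <= 12 * (n * m) -> 3 * (n' * m) <= p * l ->
  e * m * l ^ 2 < 2 * (108 * c * n') -> C * n ^ 2 < p * l ^ 3 * y ^ 5 ->
  C * e <= 144 * 72 * c * y ^ 5.
Proof.
move=> n0 pl0 h1 h4 he contra.
have m0 : 0 < m by case: m h1 pl0 {h4 he} => //; rewrite !muln0 leqn0 => /eqP->.
have a1 : e * m ^ 2 * l ^ 2 <= 72 * c * (p * l).
  have := leq_mul (ltnW he) (leqnn (3 * m)); have := leq_mul (leqnn (216 * c)) h4.
  rewrite -!mulnn; lia.
have a2 : e * (p * l ^ 3) <= 144 * 72 * c * n ^ 2.
  rewrite -(leq_pmul2r pl0).
  have := leq_mul (leqnn (e * l ^ 2)) (leq_mul h1 h1); have := leq_mul (leqnn (144 * n ^ 2)) a1.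
  rewrite (expnS l 2) -!mulnn; lia.
rewrite -(leq_pmul2l (_ : 0 < n ^ 2)) ?expn_gt0 ?n0 //.
have := leq_mul (leqnn e) (ltnW contra); have := leq_mul a2 (leqnn (y ^ 5)).
move: (y ^ 5) (n ^ 2) (l ^ 3) => Y N L; lia.
Qed.

(** From [e m l^2 = O(n)] the cluster has [O(n / l)] nodes, and [l >= C] outweighs the constant. *)
Lemma cluster_smaller C c n n' m p l e :
  0 < n -> 0 < m -> C <= l -> 1728 * c <= C -> p * l <= 12 * (n * m) -> 3 * (n' * m) <= p * l ->
  e * m * l ^ 2 < 2 * (108 * c * n') -> 2 * (l * m * e) < n.
Proof.
move=> n0 m0 Cl cC h1 h4 he.
have n4 : n' <= 4 * n.
  by rewrite -(leq_pmul2r m0); have := leq_trans h4 h1; lia.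
have l0 : 0 < l.
  case: (posnP l) => // l0; have c0 : c = 0 by lia.
  by move: he; rewrite l0 c0 !muln0.
rewrite -(ltn_pmul2r l0).
have := leq_mul (leqnn (432 * c)) n4.
have := leq_mul (leq_trans cC Cl) (leqnn n).
move: he; rewrite -mulnn; lia.
Qed.

Lemma sum_of_small a b c r : 12 * a < r -> 12 * b < r -> 24 * c < r -> 4 * a + 4 * b + 8 * c < r.
Proof. lia. Qed.

Section Contradiction.
Variables (C c5 k1 m l e y w : nat).
Hypotheses (w_gt0 : 0 < w) (wy : w ^ 3 <= y) (yw : y <= 8 * w ^ 3).
Hypothesis m_large : C * y ^ 7 <= 12 * m.
Hypothesis l_large : C * y ^ 14 <= l.
Hypothesis e_small : C * e <= k1 * y ^ 5.
Hypothesis C_large : 1728 * c5 * k1 ^ 3 < C.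
Hypothesis k1_gt0 : 0 < k1.

Let y_gt0 : 0 < y. Proof. by apply: leq_trans wy; rewrite expn_gt0 w_gt0. Qed.
Let C_gt0 : 0 < C. Proof. exact: leq_ltn_trans C_large. Qed.

Lemma Ce_expn k : (C * e) ^ k <= k1 ^ k * y ^ (5 * k).
Proof. by case: k => // k; rewrite expnM -expnMn leq_exp2r. Qed.

Lemma w_expn a b : a <= 3 * b -> w ^ a <= y ^ b.
Proof.
move=> ab; apply: (@leq_trans (w ^ (3 * b))); first by rewrite leq_pexp2l.
by case: b {ab} => // b; rewrite expnM leq_exp2r.
Qed.

(** In powers of [y]: [w^15 <= y^5] and [e^3] gives [y^15], against [y^21] from [m * l]. *)
Lemma term1 : 12 * c5 * C ^ 2 * w ^ 15 * e ^ 3 < m * l.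
Proof.
rewrite -(ltn_pmul2l (_ : 0 < 12 * C ^ 3)) ?muln_gt0 ?expn_gt0 ?C_gt0 //.
apply: leq_trans (_ : C ^ 3 * ((C * y ^ 7) * (C * y ^ 14)) <= _); last first.
  by have := leq_mul (leqnn (C ^ 3)) (leq_mul m_large l_large); lia.
apply: leq_ltn_trans (_ : 144 * c5 * C ^ 2 * (y ^ 5 * (k1 ^ 3 * y ^ 15)) < _).
  have h := leq_mul (leqnn (144 * c5 * C ^ 2)) (leq_mul (w_expn (isT : 15 <= 3 * 5)) (Ce_expn 3)).
  apply: leq_trans h; rewrite expnMn; lia.
have y20 : y ^ 5 * y ^ 15 <= y ^ 7 * y ^ 14 by rewrite -!expnD leq_pexp2l.
have h : 144 * c5 * k1 ^ 3 < C ^ 3.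
  apply: (@leq_trans C); last by rewrite -[X in X <= _]expn1 leq_pexp2l.
  by apply: leq_ltn_trans C_large; rewrite leq_mul // leq_mul.
have pos : 0 < C ^ 2 * (y ^ 7 * y ^ 14) by rewrite !(expn_gt0, muln_gt0) C_gt0 y_gt0.
have := leq_mul (leqnn (144 * c5 * k1 ^ 3 * C ^ 2)) y20.
by move: h; rewrite -(ltn_pmul2r pos); lia.
Qed.

(** With [w^8 <= y^4] both sides have [y^14], so the size of [C] decides. *)
Lemma term2 : 12 * c5 * C * w ^ 8 * e ^ 2 < m ^ 2.
Proof.
rewrite -(ltn_pmul2l (_ : 0 < 144 * C ^ 2)) ?muln_gt0 ?expn_gt0 ?C_gt0 //.
apply: leq_trans (_ : C ^ 2 * ((C * y ^ 7) * (C * y ^ 7)) <= _); last first.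
  by have := leq_mul (leqnn (C ^ 2)) (leq_mul m_large m_large); rewrite -(mulnn m); lia.
apply: leq_ltn_trans (_ : 1728 * c5 * C * (y ^ 4 * (k1 ^ 2 * y ^ 10)) < _).
  have h := leq_mul (leqnn (1728 * c5 * C)) (leq_mul (w_expn (isT : 8 <= 3 * 4)) (Ce_expn 2)).
  apply: leq_trans h; rewrite expnMn; lia.
have y14 : y ^ 4 * y ^ 10 = y ^ 7 * y ^ 7 by rewrite -!expnD.
have h : 1728 * c5 * k1 ^ 2 < C ^ 3.
  apply: (@leq_trans C); last by rewrite -[X in X <= _]expn1 leq_pexp2l.
  by apply: leq_ltn_trans C_large; rewrite leq_mul // leq_pexp2l.
have pos : 0 < C * (y ^ 7 * y ^ 7) by rewrite !(expn_gt0, muln_gt0) C_gt0 y_gt0.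
have -> : 1728 * c5 * C * (y ^ 4 * (k1 ^ 2 * y ^ 10)) = 1728 * c5 * k1 ^ 2 * (C * (y ^ 7 * y ^ 7)).
  by rewrite -y14; lia.
by move: h; rewrite -(ltn_pmul2r pos) (expnS C 2); lia.
Qed.

(** Here [w] must not be too small: [e^3] gives [y^15], [l] only [y^14], and [y <= 8 w^3 <= 8 w^4]
    supplies the missing factor. *)
Lemma term3 : 24 * c5 * C * e ^ 3 < l * w ^ 4.
Proof.
rewrite -(ltn_pmul2l (_ : 0 < C ^ 3)) ?expn_gt0 ?C_gt0 //.
apply: leq_trans (_ : C ^ 3 * ((C * y ^ 14) * w ^ 4) <= _); last first.
  by rewrite leq_mul2l leq_mul2r l_large !orbT.
apply: leq_ltn_trans (_ : 24 * c5 * C * (k1 ^ 3 * y ^ 15) < _).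
  have h := leq_mul (leqnn (24 * c5 * C)) (Ce_expn 3).
  apply: leq_trans h; rewrite expnMn; lia.
have y15 : y ^ 15 <= 8 * (y ^ 14 * w ^ 4).
  rewrite expnSr mulnCA leq_mul2l; apply/orP; right; apply: leq_trans yw _.
  by rewrite leq_mul2l leq_pexp2l.
have h : 192 * c5 * k1 ^ 3 < C ^ 3.
  apply: (@leq_trans C); last by rewrite -[X in X <= _]expn1 leq_pexp2l.
  by apply: leq_ltn_trans C_large; rewrite leq_mul // leq_mul.
have pos : 0 < C * (y ^ 14 * w ^ 4) by rewrite !(expn_gt0, muln_gt0) C_gt0 y_gt0 w_gt0.
have := leq_mul (leqnn (24 * c5 * k1 ^ 3 * C)) y15.
by move: h; rewrite -(ltn_pmul2r pos); lia.
Qed.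

(** Inserting the bound on [b] into the lower bound leaves three products, coming from [Y^2],
    [l^2 Y] and [n1^2]. By [term1], [term2] and [term3] each is less than a third of
    [m^3 l^3 w^4]. *)
Lemma terms_contradiction b (n1 := 2 * (l * m * e)) (Y := C * w ^ 7 * n1) :
  b * w ^ 5 <= (Y ^ 2 + 2 * l ^ 2 * Y) * w ^ 5 + 2 * m * C * n1 ^ 2 ->
  m ^ 3 * l ^ 3 <= c5 * w * e * b -> False.
Proof.
move=> hb main.
have m0 : 0 < m.
  by case: m m_large => //; rewrite muln0 leqn0 muln_eq0 expn_eq0 !gtn_eqF.
have l0 : 0 < l by apply: leq_trans l_large; rewrite muln_gt0 C_gt0 expn_gt0 y_gt0.
have t1 := term1; have t2 := term2; have t3 := term3.
rewrite -(ltn_pmul2l (_ : 0 < m ^ 2 * l ^ 2 * w ^ 4)) ?muln_gt0 ?expn_gt0 ?m0 ?l0 ?w_gt0 // in t1.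
rewrite -(ltn_pmul2l (_ : 0 < m * l ^ 3 * w ^ 4)) ?muln_gt0 ?expn_gt0 ?m0 ?l0 ?w_gt0 // in t2.
rewrite -(ltn_pmul2l (_ : 0 < m ^ 3 * l ^ 2)) ?muln_gt0 ?expn_gt0 ?m0 ?l0 ?w_gt0 // in t3.
have h := leq_mul (leqnn (c5 * e)) hb.
have : m ^ 3 * l ^ 3 * w ^ 4 <= c5 * e * (b * w ^ 5).
  by have := leq_mul main (leqnn (w ^ 4)); rewrite (expnS w 4); lia.
move=> /leq_trans/(_ h).
have ew15 : w ^ 4 * w ^ 15 = w ^ 14 * w ^ 5 by rewrite -!expnD.
have ew8 : w ^ 4 * w ^ 8 = w ^ 7 * w ^ 5 by rewrite -!expnD.
have ew14 : (w ^ 7) ^ 2 = w ^ 14 by rewrite -expnM.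
rewrite leqNgt => /negP; apply.
rewrite /Y /n1; move: (w ^ 7) ew8 ew14 => w7 ew8 ew14.
have -> : (C * w7 * (2 * (l * m * e))) ^ 2 = 4 * (C ^ 2 * w ^ 14 * l ^ 2 * m ^ 2 * e ^ 2).
  by rewrite -ew14 -!mulnn; lia.
set r := m ^ 3 * l ^ 3 * w ^ 4.
have {}t1 : 12 * (c5 * C ^ 2 * m ^ 2 * l ^ 2 * (w ^ 14 * w ^ 5) * e ^ 3) < r.
  by rewrite -ew15; move: t1; rewrite /r (expnS m 2) (expnS l 2) -!mulnn; lia.
have {}t2 : 12 * (c5 * C * m * l ^ 3 * (w7 * w ^ 5) * e ^ 2) < r.
  by rewrite -ew8; move: t2; rewrite /r (expnS m 2) -!mulnn; lia.
have {}t3 : 24 * (c5 * C * m ^ 3 * l ^ 2 * e ^ 3) < r.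
  by move: t3; rewrite /r (expnS l 2) -!mulnn; lia.
have -> : c5 * e * ((4 * (C ^ 2 * w ^ 14 * l ^ 2 * m ^ 2 * e ^ 2) +
    2 * l ^ 2 * (C * w7 * (2 * (l * m * e)))) * w ^ 5 + 2 * m * C * (2 * (l * m * e)) ^ 2) =
  4 * (c5 * C ^ 2 * m ^ 2 * l ^ 2 * (w ^ 14 * w ^ 5) * e ^ 3) +
  4 * (c5 * C * m * l ^ 3 * (w7 * w ^ 5) * e ^ 2) + 8 * (c5 * C * m ^ 3 * l ^ 2 * e ^ 3).
  by rewrite !(expnS _ 2) -!mulnn; lia.
exact: sum_of_small t1 t2 t3.
Qed.
End Contradiction.

(** * The induction on the number of nodes *)

Definition size_bound C (V P : finType) (X : psystem V P) := forall l y,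
  (forall Q, #|[set v | inc X v Q]| = l) ->
  C * y ^ 7 * #|V| <= #|P| * l -> C * y ^ 14 <= l ->
  #|P| * l ^ 3 * y ^ 5 <= C * #|V| ^ 2.

Lemma square_cases t N x l : N * t <= x -> t <= l ->
  t ^ 2 * (N ^ 2 + 2 * t * N) <= x ^ 2 + 2 * l ^ 2 * x.
Proof.
move=> Nt tl; have h1 := leq_mul Nt Nt; have h2 := leq_mul (leq_mul tl tl) Nt.
by rewrite -!mulnn; lia.
Qed.

Section Step.
Variables (c k2 c5 k1 C e8 : nat).
Hypotheses (cE : c = 2 * 1728) (e8E : e8 = 8 ^ 5).
Hypothesis k2P : forall K w, 2 ^ K <= e8 * w ^ 15 -> K ^ 2 <= k2 * w.
Hypotheses (c5E : c5 = 1152 * c ^ 2 * k2) (k1E : k1 = 144 * 72 * c).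
Hypotheses (C1 : 1728 * c5 * k1 ^ 3 < C) (C2 : 16 * c * k1 <= C) (C3 : 1728 * c <= C) (C4 : 12 <= C).

Let c0 : 0 < c. Proof. by rewrite cE. Qed.
Let k10 : 0 < k1. Proof. by rewrite k1E muln_gt0 c0. Qed.
Let C0 : 0 < C. Proof. exact: leq_trans C4. Qed.

Variables (V P : finType) (X : psystem V P) (l y : nat).
Hypothesis IH : forall (V' P' : finType) (X' : psystem V' P'), #|V'| < #|V| -> size_bound C X'.
Hypothesis lens : forall Q, #|[set v | inc X v Q]| = l.
Hypotheses (hy1 : C * y ^ 7 * #|V| <= #|P| * l) (hy2 : C * y ^ 14 <= l).
Hypothesis contra : C * #|V| ^ 2 < #|P| * l ^ 3 * y ^ 5.
Notation n := #|V|.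
Notation p := #|P|.

Let y0 : 0 < y.
Proof. by case: y contra => //; rewrite exp0n // muln0. Qed.
Let l_C : C <= l.
Proof. by apply: leq_trans hy2; rewrite leq_pmulr // expn_gt0 y0. Qed.
Let l0 : 0 < l. Proof. exact: leq_trans l_C. Qed.
Let p0 : 0 < p. Proof. by case: (posnP p) contra => // ->; rewrite !mul0n. Qed.
Let n0 : 0 < n.
Proof.
have /card_gt0P [Q _] := p0; apply: leq_trans l0 _; rewrite -(lens Q); exact: max_card.
Qed.

(** The largest group size that [copies_bounds] admits. *)
Let m := (p * l) %/ (6 * n).

Let m_low : 6 * (n * m) <= p * l.
Proof. by rewrite mulnA mulnC leq_divM. Qed.

Let m0 : 0 < m.
Proof.
rewrite divn_gt0 ?muln_gt0 ?n0 //; apply: leq_trans hy1; rewrite leq_mul2r; apply/orP; right.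
by apply: (@leq_trans C); [apply: leq_trans C4 | rewrite leq_pmulr // expn_gt0 y0].
Qed.

Let m_high : p * l <= 12 * (n * m).
Proof.
have h : p * l < m.+1 * (6 * n) by rewrite ltn_ceil // muln_gt0 n0.
have h' : n * 1 <= n * m by rewrite leq_mul2l m0 orbT.
by move: h h'; rewrite mulSn; lia.
Qed.

Let n' := #|copies X m|.
Let Y := split_system X m.
Let E := @third V P X m 0.
Let M := @third V P X m 1.
Let L := @third V P X m 2.

Let bounds : p * l <= 6 * (n' * m) /\ 3 * (n' * m) <= p * l.
Proof. exact: copies_bounds. Qed.

Let n'0 : 0 < n'.
Proof.
by case: (posnP n') => // e; have := bounds.1; rewrite e mul0n muln0 leqn0 muln_eq0 !gtn_eqF.
Qed.

Let D := m * l ^ 2.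
Let D0 : 0 < D. Proof. by rewrite muln_gt0 m0 expn_gt0 l0. Qed.
(** The least block length that [many_near] admits: [108 c n' / D] rounded up. *)
Let e := ((108 * c * n').-1 %/ D).+1.

Let B0 : 0 < 108 * c * n'. Proof. by rewrite !muln_gt0 c0 n'0. Qed.

Let e_big : 108 * c * n' <= e * m * l ^ 2.
Proof. by rewrite -(mulnA e m) -[X in X <= _](prednK B0) ltn_ceil. Qed.

Let e_small : 1 < e -> e * m * l ^ 2 < 2 * (108 * c * n').
Proof.
move=> e1; rewrite -(mulnA e m) -/D.
have h : e.-1 * D < 108 * c * n' by rewrite -[X in _ < X](prednK B0) ltnS leq_divM.
apply: leq_ltn_trans (_ : 2 * (e.-1 * D) < _); last by rewrite ltn_pmul2l.
by rewrite mulnA leq_mul2r; apply/orP; right; lia.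
Qed.

Let Mi : forall v Q, M v Q -> inc Y v Q. Proof. by move=> v Q /third_inc. Qed.
Let Ei : forall v Q, E v Q -> inc Y v Q. Proof. by move=> v Q /third_inc. Qed.
Let Li : forall v Q, L v Q -> inc Y v Q. Proof. by move=> v Q /third_inc. Qed.
Let EM : forall v A Q, E v A -> M v Q -> tm Y A < tm Y Q.
Proof. by move=> v A Q; apply: third_tm. Qed.
Let ML : forall v Q S, M v Q -> L v S -> tm Y Q < tm Y S.
Proof. by move=> v Q S; apply: third_tm. Qed.
Let Ec : forall v, #|[set Q | E v Q]| = m. Proof. by move=> v; apply: card_third. Qed.
Let Mc : forall v, #|[set Q | M v Q]| = m. Proof. by move=> v; apply: card_third. Qed.
Let Lc : forall v, #|[set Q | L v Q]| = m. Proof. by move=> v; apply: card_third. Qed.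
Let lenY Q : #|[set v | inc Y v Q]| <= l.
Proof. by rewrite -(lens Q); apply: len_split. Qed.

Let e_gt1 : 1 < e.
Proof.
case: (ltngtP 1 e) => // e1.
have := many_near Ei Mi Li EM ML Ec Mc Lc lenY bounds.1 (leq_trans C4 l_C) (isT : 0 < 1).
have := e_big; rewrite -e1 -cE -/n' => eb /(_ l0 eb).
rewrite (near_sum_block1 M L Ei) //.
rewrite muln0 leqn0 => /eqP z.
have : 0 < n' * m ^ 3 * l by rewrite !(expn_gt0, muln_gt0) n'0 m0 l0.
by rewrite z.
Qed.

Let Ce : C * e <= k1 * y ^ 5.
Proof.
rewrite k1E; apply: (@block_size_bound C c n n' m p l) => //; rewrite ?muln_gt0 ?p0 ?l0 //.
  exact: bounds.2.
exact: e_small.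
Qed.

Let e16 : 16 * c * e <= y ^ 5.
Proof.
rewrite -(leq_pmul2l C0); apply: leq_trans (leq_mul C2 (leqnn _)).
by have := leq_mul (leqnn (16 * c)) Ce; lia.
Qed.

Let y5l : y ^ 5 <= l.
Proof.
apply: leq_trans hy2; apply: (@leq_trans (y ^ 14)); first by rewrite leq_pexp2l.
by rewrite leq_pmull.
Qed.

Let e_l : e <= l.
Proof. by apply: leq_trans y5l; apply: leq_trans e16; rewrite leq_pmull // muln_gt0 c0. Qed.

Let n1 := 2 * (l * m * e).

Let n1_n : n1 < n.
Proof.
apply: (@cluster_smaller C c n n' m p l e) => //; first exact: bounds.2.
exact: e_small.
Qed.

(** The cluster of a middle path has at most [n1] nodes, fewer than [n].  The
    middle paths with [t] nodes in it are therefore few, by the induction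
    hypothesis with [w], about the cube root of [y], in place of [y]. *)
Lemma step_contradiction : False.
Proof.
have [w w0 /andP[wy yw]] := cube_root y0.
have ce0 : 0 < 4 * c * e by rewrite !muln_gt0 c0.
have ce_l : 4 * c * e <= l by apply: leq_trans y5l; apply: leq_trans e16; rewrite !leq_mul2r orbT.
(* The largest exponent for which the levels below [2 ^ j0] are negligible in [level_energy]. *)
pose j0 := trunc_log 2 (l %/ (4 * c * e)).
have q0 : 0 < l %/ (4 * c * e) by rewrite divn_gt0.
have /andP[j0l lj0] := trunc_log_bounds (isT : 1 < 2) q0; rewrite -/j0 in j0l lj0.
have {}j0l : 4 * c * (2 ^ j0 * e) <= l.
  by move: j0l; rewrite leq_divRL //; move: (2 ^ j0) => t; lia.
have {}lj0 : l < 2 ^ j0 * (8 * c * e).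
  by move: lj0; rewrite ltn_divLR // expnS; move: (2 ^ j0) => t; lia.
have ce8 : 0 < 8 * c * e by rewrite !muln_gt0 c0.
have /andP[Kl Kh] := trunc_log_bounds (isT : 1 < 2) ce8.
(* As [l < 2 ^ j0 * 8 c e], these [K] levels reach beyond [l]; their number depends on [e] only. *)
set K := (trunc_log 2 (8 * c * e)).+1 in Kh.
have K2 : K ^ 2 <= k2 * w.
  (* [2 ^ K <= 16 c e <= y^5 <= (8 w^3)^5]. *)
  apply: k2P; rewrite e8E [X in X <= _]expnS; apply: (@leq_trans (y ^ 5)).
    apply: leq_trans e16; apply: leq_trans (leq_mul (leqnn 2) Kl) _.
    by rewrite !mulnA.
  by rewrite (_ : 15 = 3 * 5) // expnM -expnMn leq_exp2r.
have lK : l < 2 ^ (j0 + K).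
  apply: leq_trans lj0 _; rewrite expnD leq_mul2l; apply/orP; right; exact: ltnW.
(* Above this threshold for [N * t], the induction hypothesis with [w] applies to the [N] paths of a
   level. In [b] the first two summands cover populations below the threshold, the last one those
   above it. *)
pose Yb := C * w ^ 7 * n1.
pose b := Yb ^ 2 + 2 * l ^ 2 * Yb + (2 * m * C * n1 ^ 2) %/ w ^ 5.
have w5 : 0 < w ^ 5 by rewrite expn_gt0 w0.
have j0w : C * w ^ 14 <= 2 ^ j0.
  have y5 : 0 < y ^ 5 by rewrite expn_gt0 y0.
  rewrite -(leq_pmul2r y5); apply: (@leq_trans (2 ^ j0 * (8 * c * e))); last first.
    by rewrite leq_mul2l; apply/orP; right; apply: leq_trans e16; rewrite !leq_mul2r orbT.
  apply: leq_trans (ltnW lj0); apply: leq_trans hy2; rewrite -mulnA leq_mul2l; apply/orP; right.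
  rewrite (_ : 14 = 9 + 5) // [in X in _ <= X]expnD leq_mul2r; apply/orP; right.
  by apply: (w_expn w0 wy) .
have enb (j : 'I_K) Q : (2 ^ (j0 + j)) ^ 2 * energy Y E M L e (2 ^ (j0 + j)) Q <= b.
  have t0 : C * w ^ 14 <= 2 ^ (j0 + j) by apply: leq_trans j0w _; rewrite leq_pexp2l // leq_addr.
  move: (2 ^ (j0 + j)) t0 => t tw.
  have W_le : #|cluster Y E M L e Q| <= n1.
    exact: (card_cluster Ei Mi Ec Lc lenY).
  set N := population Y E M L e t Q.
  have [N0|N0] := posnP N.
    have := energy_pairs E L e Mi t Q.
    by rewrite -/N N0 !muln0 leqn0 => /eqP->; rewrite muln0.
  have tl : t <= l.
    have /card_gt0P[Q'] := N0; rewrite inE => /andP[h _]; apply: leq_trans h _.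
    exact: (shared_le E L e Mi lenY).
  have [small|large] := leqP (N * t) Yb.
    apply: leq_trans (leq_addr _ _); apply: leq_trans (square_cases small tl).
    by rewrite leq_mul2l (energy_pairs E L e Mi t Q) orbT.
  apply: leq_trans (leq_addl _ _); rewrite leq_divRL //.
  have big Q' : Q' \in [set Q' | level Y E M L e t Q Q'] -> t <= #|[set v in cluster Y E M L e Q | M v Q']|.
    by rewrite inE => /andP[].
  have := @IH _ _ (cluster_system (cluster Y E M L e Q) [set Q' | level Y E M L e t Q Q'] t Mi).
  rewrite !card_sig.
  have -> : #|[pred x in cluster Y E M L e Q]| = #|cluster Y E M L e Q| by apply: eq_card => x; rewrite !inE.
  move=> /(_ (leq_ltn_trans W_le n1_n) t w (cluster_len Mi big)).
  rewrite !card_sig.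
  have -> : #|[pred x in cluster Y E M L e Q]| = #|cluster Y E M L e Q| by apply: eq_card => x; rewrite !inE.
  have -> : #|[pred x in [set Q' | level Y E M L e t Q Q']]| = N by apply: eq_card => x; rewrite !inE.
  move=> /(_ _ tw) H.
  have {}H : N * t ^ 3 * w ^ 5 <= C * n1 ^ 2.
    apply: leq_trans (H _) _; last by rewrite leq_mul2l leq_exp2r // W_le orbT.
    by apply: leq_trans (ltnW large); rewrite leq_mul2l W_le orbT.
  have en : energy Y E M L e t Q <= m * (2 * t * N).
    exact: (energy_deg Y E L e Mc t Q).
  have h1 := leq_mul (leq_mul (leqnn (t ^ 2)) en) (leqnn (w ^ 5)).
  have h2 := leq_mul (leqnn (2 * m)) H.
  apply: leq_trans h1 _; rewrite -[X in _ <= X]mulnA; apply: leq_trans h2.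
  by rewrite (expnS t 2); move: (t ^ 2) (w ^ 5) => a d; lia.
have main : m ^ 3 * l ^ 3 <= c5 * w * e * b.
  have e_big' := e_big; have j0l' := j0l; rewrite cE in e_big' j0l'.
  have h := level_energy Ei Mi Li EM ML Ec Mc Lc lenY bounds.1 (leq_trans C4 l_C) (ltnW e_gt1)
    n'0 m0 e_l e_big' j0l' lK enb.
  rewrite -cE in h; apply: leq_trans h _.
  have := leq_mul (leqnn (1152 * c ^ 2 * e * b)) K2.
  by rewrite c5E; move: (c ^ 2) (K ^ 2) => a d; lia.
have m_large : C * y ^ 7 <= 12 * m.
  by rewrite -(leq_pmul2r n0); apply: leq_trans hy1 _; apply: leq_trans m_high _; rewrite mulnA mulnAC.
have b_le : b * w ^ 5 <= (Yb ^ 2 + 2 * l ^ 2 * Yb) * w ^ 5 + 2 * m * C * n1 ^ 2.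
  by rewrite /b mulnDl leq_add2l leq_divM.
exact: (terms_contradiction w0 wy yw m_large hy2 Ce C1 k10 b_le main).
Qed.
End Step.

Theorem uniform_size_bound : exists2 C, 0 < C &
  forall (V P : finType) (X : psystem V P), size_bound C X.
Proof.
have [e8 e8E] : exists e, e = 8 ^ 5 by exists (8 ^ 5).
have e80 : 0 < e8 by rewrite e8E expn_gt0.
have [k2 k20 k2P] := few_levels e80.
move: {1}(2 * 1728) (erefl (2 * 1728)) => c cE.
move: {1}(1152 * c ^ 2 * k2) (erefl (1152 * c ^ 2 * k2)) => c5 c5E.
move: {1}(144 * 72 * c) (erefl (144 * 72 * c)) => k1 k1E.
pose C := (1728 * c5 * k1 ^ 3).+1 + 16 * c * k1 + 1728 * c + 12.
have C1 : 1728 * c5 * k1 ^ 3 < C by rewrite /C; move: (_ * _ ^ 3) => a; lia.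
have C2 : 16 * c * k1 <= C by rewrite /C; move: (_ * _ ^ 3) => a; lia.
have C3 : 1728 * c <= C by rewrite /C; move: (_ * _ ^ 3) => a; lia.
have C4 : 12 <= C by rewrite /C; move: (_ * _ ^ 3) => a; lia.
exists C; first exact: leq_trans C4.
move: C C1 C2 C3 C4 => C C1 C2 C3 C4 V P X.
have [N] := ubnP #|V|; elim: N V P X => // N IHN V P X leN l y lens h1 h2.
rewrite leqNgt; apply/negP => contra.
have IH (V' P' : finType) (X' : psystem V' P') : #|V'| < #|V| -> size_bound C X'.
  by move=> lt; apply: IHN; apply: leq_trans lt _.
exact: (step_contradiction cE e8E k2P c5E k1E C1 C2 C3 C4 IH lens h1 h2 contra).
Qed.

(** The paths are cut into pieces of exactly [l] nodes. *)
Section Pieces.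
Variables (V P : finType) (X : psystem V P) (l : nat).
Hypothesis l_gt0 : 0 < l.

Definition len Q := #|[set v | inc X v Q]|.
Definition pieces : finType := {x : P * 'I_#|V|.+1 | x.2.+1 * l <= len x.1}.
Definition piece_inc v (x : pieces) := inc X v (val x).1 && (idx X (val x).1 v %/ l == (val x).2).

(** The pieces of a path keep its arrival time. This is allowed because they are disjoint and
    [tm_inj] compares only paths through a common node. *)
Definition piece_system : psystem V pieces.
Proof.
apply: (@pullback V P V pieces X id (fun x => (val x).1) piece_inc).
- by move=> v x /andP[].
- by [].
- move=> v x y /andP[_ /eqP ex] /andP[_ /eqP ey] e; apply/val_inj.
  case: (val x) (val y) e ex ey => [Q i] [Q' j] /= <- ei ej.
  by congr (_, _); apply/val_inj; rewrite /= -ei -ej.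
Defined.

Lemma piece_len x : #|[set v | inc piece_system v x]| = l.
Proof.
set Q := (val x).1; set i : nat := (val x).2.
have full : i * l + l <= len Q by have := valP x; rewrite /= mulSn addnC.
rewrite -[RHS](@card_interval _ [set v | inc X v Q] (idx X Q) (i * l) l) //.
- apply: eq_card => v; rewrite !inE /= /piece_inc -/Q -/i; congr (_ && _).
  by rewrite eqn_leq -ltnS leq_divRL // ltn_divLR // andbC mulSn addnC.
- by move=> v w; rewrite !inE; apply: idx_inj.
- by move=> v; rewrite inE; apply: idx_max.
Qed.

Lemma card_pieces : #|pieces| = \sum_Q len Q %/ l.
Proof.
rewrite card_sig; transitivity (\sum_Q \sum_(i : 'I_#|V|.+1 | i.+1 * l <= len Q) 1).
  by rewrite pair_big_dep -sum1_card; apply: eq_bigl => -[v i].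
apply: eq_bigr => Q _; rewrite sum1dep_card card_blocks //; exact: max_card.
Qed.
End Pieces.

(** Cutting loses fewer than [l] nodes on each path, in all at most half of the total size. *)
Theorem total_size_bound : exists2 C, 0 < C &
  forall (V P : finType) (X : psystem V P) l y, 0 < l ->
  2 * (#|P| * l) <= \sum_Q len X Q -> 2 * (C * y ^ 7 * #|V|) <= \sum_Q len X Q -> C * y ^ 14 <= l ->
  (\sum_Q len X Q) * l ^ 2 * y ^ 5 <= 2 * (C * #|V| ^ 2).
Proof.
have [C C0 bound] := uniform_size_bound; exists C => // V P X l y l0 h1 h2 h3.
have half : \sum_Q len X Q <= 2 * (#|pieces X l| * l).
  have : \sum_Q len X Q <= #|pieces X l| * l + #|P| * l.
    rewrite card_pieces // big_distrl -sum_nat_const -big_split /=; apply: leq_sum => Q _.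
    by rewrite -mulSnr ltnW // ltn_ceil.
  by move: h1; move: (\sum_Q _) => T; lia.
have := bound _ _ (piece_system X l) l y (piece_len l0).
have h2' : C * y ^ 7 * #|V| <= #|pieces X l| * l by move: h2 half; move: (\sum_Q _) (y ^ 7) => T z; lia.
move=> /(_ h2' h3) H; apply: leq_trans (_ : 2 * (#|pieces X l| * l) * l ^ 2 * y ^ 5 <= _).
  by rewrite !leq_mul2r half !orbT.
apply: leq_trans (leq_mul (leqnn 2) H); rewrite (expnS l 2); move: (l ^ 2) (y ^ 5) => a b; lia.
Qed.

(** * Elimination of the parameter [y] *)

Section Bounds.
Variables (C T n p l y : nat).
Hypothesis l_low : T <= 4 * (p * l).
Hypothesis main : T * l ^ 2 * y ^ 5 <= 2 * (C * n ^ 2).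

Lemma cube_bound : T ^ 3 * y ^ 5 <= 32 * C * (n ^ 2 * p ^ 2).
Proof.
have h1 := leq_mul (leqnn (T * y ^ 5)) (leq_mul l_low l_low).
have h2 := leq_mul (leqnn (16 * p ^ 2)) main.
move: h1 h2; rewrite (expnS T 2) -!mulnn; move: (y ^ 5) => z; lia.
Qed.

(** The seventh power of [cube_bound] and the fifth power of the hypothesis both contain [y^35]. It
    cancels and leaves [26 = 21 + 5] and [19 = 14 + 5]. *)
Lemma bound_by_nodes k : T <= k * (y ^ 7 * n) -> T ^ 26 <= k ^ 5 * (32 * C) ^ 7 * (n ^ 19 * p ^ 14).
Proof.
move=> Tk; have c7 : (T ^ 3 * y ^ 5) ^ 7 <= (32 * C * (n ^ 2 * p ^ 2)) ^ 7.
  by rewrite leq_exp2r // cube_bound.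
have T5 : T ^ 5 <= (k * (y ^ 7 * n)) ^ 5 by rewrite leq_exp2r.
have eL : (T ^ 3 * y ^ 5) ^ 7 = T ^ 21 * y ^ 35 by rewrite expnMn -!expnM.
have eR : (32 * C * (n ^ 2 * p ^ 2)) ^ 7 = (32 * C) ^ 7 * (n ^ 14 * p ^ 14).
  by rewrite (expnMn (32 * C)) (expnMn (n ^ 2)) -(expnM n) -(expnM p).
have e5 : (k * (y ^ 7 * n)) ^ 5 = k ^ 5 * (y ^ 35 * n ^ 5).
  by rewrite (expnMn k) (expnMn (y ^ 7)) -(expnM y).
rewrite eL eR in c7; rewrite e5 in T5.
have h1 := leq_mul (leqnn (T ^ 21)) T5; have h2 := leq_mul (leqnn (k ^ 5 * n ^ 5)) c7.
rewrite (_ : 26 = 21 + 5) // expnD; apply: leq_trans h1 _.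
rewrite (_ : 19 = 5 + 14) // [n ^ (5 + 14)]expnD; move: h2.
move: (T ^ _) (y ^ _) (k ^ _) (n ^ 5) (n ^ 14) (p ^ _) ((32 * C) ^ _) => a b c d e f g; lia.
Qed.

(** Likewise with [y^70], from the fourteenth power of [cube_bound] and the fifth power of
    [T <= 4 k p y^14]: [47 = 42 + 5] and [33 = 28 + 5]. *)
Lemma bound_by_length k : l <= k * y ^ 14 -> T ^ 47 <= (4 * k) ^ 5 * (32 * C) ^ 14 * (n ^ 28 * p ^ 33).
Proof.
move=> lk; have c14 : (T ^ 3 * y ^ 5) ^ 14 <= (32 * C * (n ^ 2 * p ^ 2)) ^ 14.
  by rewrite leq_exp2r // cube_bound.
have T5 : T ^ 5 <= (4 * k * (p * y ^ 14)) ^ 5.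
  rewrite leq_exp2r //; apply: leq_trans l_low _.
  by have := leq_mul (leqnn (4 * p)) lk; move: (y ^ 14) => z; lia.
have eL : (T ^ 3 * y ^ 5) ^ 14 = T ^ 42 * y ^ 70 by rewrite expnMn -!expnM.
have eR : (32 * C * (n ^ 2 * p ^ 2)) ^ 14 = (32 * C) ^ 14 * (n ^ 28 * p ^ 28).
  by rewrite (expnMn (32 * C)) (expnMn (n ^ 2)) -(expnM n) -(expnM p).
have e5 : (4 * k * (p * y ^ 14)) ^ 5 = (4 * k) ^ 5 * (p ^ 5 * y ^ 70).
  by rewrite (expnMn (4 * k)) (expnMn p) -(expnM y).
rewrite eL eR in c14; rewrite e5 in T5.
have h1 := leq_mul (leqnn (T ^ 42)) T5; have h2 := leq_mul (leqnn ((4 * k) ^ 5 * p ^ 5)) c14.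
rewrite (_ : 47 = 42 + 5) // expnD; apply: leq_trans h1 _.
rewrite (_ : 33 = 5 + 28) // [p ^ (5 + 28)]expnD; move: h2.
move: (T ^ _) (y ^ _) ((4 * k) ^ _) (n ^ _) (p ^ 5) (p ^ 28) ((32 * C) ^ _) => a b c d e f g; lia.
Qed.
End Bounds.

(** The largest admissible [y] fails, increased by one, either the bound on the
    number of nodes or the bound on [l]; these are the last two cases. *)
Theorem size_trichotomy : exists2 K, 0 < K & forall (V P : finType) (X : psystem V P),
  let T := \sum_Q len X Q in
  [\/ T <= K * (#|V| + #|P|), T ^ 26 <= K * (#|V| ^ 19 * #|P| ^ 14)
    | T ^ 47 <= K * (#|V| ^ 28 * #|P| ^ 33)].
Proof.
have [C C0 bound] := total_size_bound.
have [k1 k1E] : exists k, k = 2 * C * 2 ^ 7 by eexists.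
have [k2 k2E] : exists k, k = C * 2 ^ 14 by eexists.
have [c1 c1E] : exists c, c = k1 ^ 5 * (32 * C) ^ 7 by eexists.
have [c2 c2E] : exists c, c = (4 * k2) ^ 5 * (32 * C) ^ 14 by eexists.
exists (4 * C + c1 + c2) => [|V P X T]; first by rewrite !addn_gt0 C0.
have [small|large] := leqP T (4 * C * (#|V| + #|P|)).
  by constructor 1; apply: leq_trans small _; rewrite leq_mul2r -addnA leq_addr orbT.
have p0 : 0 < #|P|.
  case: (posnP #|P|) => // e; move: large; rewrite /T big1 // => Q _.
  by have := card0_eq e Q; rewrite inE.
set n := #|V| in large *; set p := #|P| in large p0 *.
(* Half the average length, so that cutting into pieces keeps at least half of [T]. *)
pose l := T %/ (2 * p).
have pl : 2 * (p * l) <= T by rewrite mulnA mulnC leq_divM.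
have lC : C <= l by rewrite leq_divRL ?muln_gt0 //; move: large; clear; rewrite mulnDr; lia.
have l0 : 0 < l by apply: leq_trans lC.
have lp : T <= 4 * (p * l).
  have : T < l.+1 * (2 * p) by rewrite ltn_ceil // muln_gt0.
  have : p * 1 <= p * l by rewrite leq_mul2l l0 orbT.
  by clear -pl; rewrite mulSn; lia.
pose ok y := (2 * (C * y ^ 7 * n) <= T) && (C * y ^ 14 <= l).
have ok1 : ok 1 by rewrite /ok !exp1n !muln1 lC andbT; move: large; clear; rewrite mulnDr; lia.
have ub y : ok y -> y <= l.
  move=> /andP[_ h]; apply: leq_trans h; rewrite mulnC.
  apply: leq_trans (leq_pmulr _ C0); case: y => // y.
  by rewrite -[X in X <= _]expn1 leq_pexp2l.
case: (ex_maxnP (ex_intro _ 1 ok1) ub) => y /andP[y1 y2] maxy.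
have y0 : 0 < y by apply: maxy ok1.
have main := bound V P X l y l0 pl y1 y2; rewrite -/T -/n in main.
have : ~~ ok y.+1 by apply/negP => /maxy; rewrite ltnn.
have yS a : y.+1 ^ a <= 2 ^ a * y ^ a.
  by case: a => // a; rewrite -expnMn leq_exp2r // mul2n -addnn -addn1 leq_add2l.
rewrite /ok negb_and -!ltnNge => /orP[h|h].
  constructor 2; apply: leq_trans (_ : c1 * _ <= _).
    rewrite c1E; refine (@bound_by_nodes C T n p l y lp main k1 _).
    apply: leq_trans (ltnW h) _; have := leq_mul (leqnn (2 * C * n)) (yS 7).
    by rewrite k1E; clear; move: (y.+1 ^ 7) (y ^ 7) (2 ^ 7) => a b c; lia.
  by rewrite leq_mul2r addnAC leq_addl orbT.
constructor 3; apply: leq_trans (_ : c2 * _ <= _).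
  rewrite c2E; refine (@bound_by_length C T n p l y lp main k2 _).
  apply: leq_trans (ltnW h) _; have := leq_mul (leqnn C) (yS 14).
  by rewrite k2E; clear; move: (y.+1 ^ 14) (y ^ 14) (2 ^ 14) => a b c; lia.
by rewrite leq_mul2r leq_addl orbT.
Qed.

(** * Serving a demand *)

Section Reach.
Variable n : nat.
Implicit Types (G H M : digraph n) (e f : 'I_n * 'I_n) (s t u v w : 'I_n).

Lemma reach0 G u : reachable G u u. Proof. exact: connect0. Qed.

Lemma reach_trans G u v w : reachable G u v -> reachable G v w -> reachable G u w.
Proof. exact: connect_trans. Qed.

Lemma reach1 G u v : (u, v) \in G -> reachable G u v.
Proof. exact: connect1. Qed.

Lemma reach_arc G e s t : e \in G -> reachable G s e.1 -> reachable G e.2 t -> reachable G s t.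
Proof.
move=> eG h1 h2; apply: reach_trans h1 _; apply: reach_trans h2; apply: reach1.
by rewrite -surjective_pairing.
Qed.

Lemma reach_sub G H s t : G \subset H -> reachable G s t -> reachable H s t.
Proof.
move=> GH; apply: connect_sub => u v uv; apply: reach1; exact: (subsetP GH).
Qed.

Lemma reach_ind G t (Q : 'I_n -> Prop) : Q t ->
  (forall u v, (u, v) \in G -> reachable G v t -> Q v -> Q u) ->
  forall s, reachable G s t -> Q s.
Proof.
move=> Q0 QS s /connectP[p]; elim: p s => [|x p IH] s /= => [_ <- //|/andP[sx px] lt].
by apply: QS sx _ (IH _ px lt); apply/connectP; exists p.
Qed.

Lemma reach_cut M e s t : reachable M s t -> ~~ reachable (M :\ e) s t ->
  reachable (M :\ e) s e.1 /\ reachable (M :\ e) e.2 t.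
Proof.
move=> st nst; suff: reachable (M :\ e) s t \/
    (reachable (M :\ e) s e.1 /\ reachable (M :\ e) e.2 t) by case => // h; case/negP: nst.
elim/reach_ind: s / st {nst} => [|u v uv _ IH]; first by left; apply: reach0.
have [eq|neq] := eqVneq (u, v) e.
  right; rewrite -eq /=; split; first exact: reach0.
  by case: IH => [//|[_]]; rewrite -eq.
have h : reachable (M :\ e) u v by apply: reach1; rewrite !inE neq.
by case: IH => [h'|[h' h'']]; [left | right; split => //]; apply: reach_trans h _.
Qed.

Definition desc G u := #|[set w | reachable G u w]|.

Lemma desc_gt0 G u : 0 < desc G u.
Proof. by apply/card_gt0P; exists u; rewrite inE reach0. Qed.

Lemma desc_le_n G u : desc G u <= n.
Proof. by rewrite -[X in _ <= X]card_ord max_card. Qed.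

Lemma desc_le G u v : reachable G u v -> desc G v <= desc G u.
Proof.
move=> uv; apply/subset_leq_card/subsetP => w; rewrite !inE; exact: reach_trans.
Qed.

Lemma desc_lt G u v : reachable G u v -> ~~ reachable G v u -> desc G v < desc G u.
Proof.
move=> uv nvu; apply/proper_card/properP; split.
  by apply/subsetP => w; rewrite !inE; apply: reach_trans.
by exists u; rewrite !inE ?reach0.
Qed.

Definition del H s t M e :=
  if (e \notin H) && reachable (M :\ e) s t then M :\ e else M.

Lemma del_sub H s t M e : del H s t M e \subset M.
Proof. by rewrite /del; case: ifP => // _; apply: subD1set. Qed.

Lemma del_fold_sub H s t M l : foldl (del H s t) M l \subset M.
Proof.
elim: l M => //= e l IH M; exact: subset_trans (IH _) (del_sub _ _ _ _ _).
Qed.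

Lemma del_fold_keep H s t M l f : f \in M -> (f \in H) || (f \notin l) ->
  f \in foldl (del H s t) M l.
Proof.
elim: l M => //= e l IH M fM; rewrite inE negb_or => h; apply: IH; last first.
  by case/orP: h => [->//|/andP[_ ->]]; rewrite orbT.
rewrite /del; case: ifP => // /andP[eH _]; rewrite !inE fM andbT.
by case/orP: h => [fH|/andP[-> //]]; apply: contraNneq eH => <-.
Qed.

Lemma del_fold_reach H s t M l : reachable M s t -> reachable (foldl (del H s t) M l) s t.
Proof.
by elim: l M => //= e l IH M st; apply: IH; rewrite /del; case: ifP => // /andP[].
Qed.

Lemma del_fold_essential H s t M l1 e l2 :
  e \in foldl (del H s t) M (l1 ++ e :: l2) -> e \notin H ->
  ~~ reachable (foldl (del H s t) M l1 :\ e) s t.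
Proof.
rewrite foldl_cat /= => h eH; apply/negP => r.
by have := subsetP (del_fold_sub _ _ _ _ _) _ h; rewrite /del eH r /= !inE eqxx.
Qed.

(** Arcs leaving vertices with many descendants come first. *)
Definition del_order G := flatten [seq
  flatten [seq [seq (u, v) | v <- enum 'I_n] | u <- enum 'I_n & desc G u + i == n]
  | i : 'I_n <- enum 'I_n].

(** Pruning starts from all of [G]; [H] survives because [del] never removes its arcs. Hence, while
    an arc is tried, all arcs later in the order are still available. *)
Definition serve G H s t :=
  if reachable G s t then foldl (del H s t) G (del_order G) else H.

Lemma mem_del_order G e : e \in del_order G.
Proof.
have lt : n - desc G e.1 < n.
  by have := desc_gt0 G e.1; have := desc_le_n G e.1; lia.
apply/flatten_mapP; exists (Ordinal lt); first by rewrite mem_enum.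
apply/flatten_mapP; exists e.1.
  by rewrite mem_filter mem_enum andbT /= subnKC ?eqxx ?desc_le_n.
by apply/mapP; exists e.2; rewrite ?mem_enum // -surjective_pairing.
Qed.
End Reach.

Lemma pairwise_flatten (I T : eqType) (r : I -> I -> bool) (q : T -> T -> bool) (F : I -> seq T) s :
  pairwise r s -> (forall i, i \in s -> pairwise q (F i)) ->
  (forall i j x y, r i j -> x \in F i -> y \in F j -> q x y) ->
  pairwise q (flatten [seq F i | i <- s]).
Proof.
elim: s => //= i s IH /andP[ri rs] pF cross; rewrite pairwise_cat; apply/and3P; split.
- apply/allrelP => x y xF /flatten_mapP[j js yF]; apply: (cross i j) => //.
  exact: (allP ri).
- by apply: pF; rewrite inE eqxx.
- by apply: IH => // j js; apply: pF; rewrite inE js orbT.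
Qed.

Lemma pairwise_in (T : eqType) (q : T -> T -> bool) s : {in s &, forall x y, q x y} -> pairwise q s.
Proof.
elim: s => //= x s IH h; apply/andP; split.
  by apply/allP => y ys; apply: h; rewrite inE ?eqxx ?ys ?orbT.
by apply: IH => y z ys zs; apply: h; rewrite inE ?ys ?zs orbT.
Qed.

Lemma pairwise_enum_ord n : pairwise (fun i j : 'I_n => i < j) (enum 'I_n).
Proof.
have : pairwise ltn [seq val i | i <- enum 'I_n].
  by rewrite val_enum_ord -sorted_pairwise ?iota_ltn_sorted //; apply: ltn_trans.
by rewrite pairwise_map.
Qed.

Section Serve.
Variable n : nat.
Implicit Types (G H M : digraph n) (e f : 'I_n * 'I_n) (s t u v w : 'I_n).

Lemma del_order_prefix G l1 e l2 f : del_order G = l1 ++ e :: l2 -> f \in l1 ->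
  desc G e.1 <= desc G f.1.
Proof.
have : pairwise (fun f e => desc G e.1 <= desc G f.1) (del_order G).
  have mem (i : 'I_n) x : x \in flatten [seq [seq (u, v) | v <- enum 'I_n]
      | u <- enum 'I_n & desc G u + i == n] -> desc G x.1 + i = n.
    case/flatten_mapP => u; rewrite mem_filter => /andP[/eqP h _] /mapP[v _ ->] //.
  apply: (pairwise_flatten (pairwise_enum_ord n)) => [i _|i j x y ij /mem h1 /mem h2].
    apply: pairwise_in => x y /mem h1 /mem h2 /=.
    by move: h1 h2; move: (desc G x.1) (desc G y.1) => a b h1 h2; lia.
  move: h1 h2 => /=; move: (desc G x.1) (desc G y.1) => a b h1 h2; lia.
move=> pw ee fl; move: pw; rewrite ee pairwise_cat => /and3P[/allrelP h _ _].
by apply: h => //; rewrite inE eqxx.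
Qed.

Lemma serve_sub G H s t : H \subset G -> H \subset serve G H s t /\ serve G H s t \subset G.
Proof.
move=> HG; rewrite /serve; case: ifP => // _; split; last exact: del_fold_sub.
by apply/subsetP => e eH; apply: del_fold_keep; rewrite ?eH // (subsetP HG).
Qed.

Lemma serve_reach G H s t : reachable G s t -> reachable (serve G H s t) s t.
Proof. by move=> st; rewrite /serve st; apply: del_fold_reach. Qed.

(** A new arc [e] is needed even when all arcs of [G] leaving vertices with fewer
    descendants are free. *)
Definition below G k : digraph n := [set f in G | desc G f.1 < k].

(** When [e] was tried, every arc of the final graph and every arc of [G] leaving a vertex with
    fewer descendants was still present, and yet [e] could not be spared. *)
Lemma serve_new G H s t e : e \in serve G H s t -> e \notin H ->
  reachable G s t /\ ~~ reachable ((serve G H s t :|: below G (desc G e.1)) :\ e) s t.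
Proof.
rewrite /serve; case: ifP => [st|_ -> //]; move=> eS eH; split => //.
have /splitPr := mem_del_order G e; move eo: (del_order G) => o splito.
case: splito eo => l1 l2 eo; rewrite eo in eS.
apply: contra (del_fold_essential eS eH); apply: reach_sub.
apply: setSD; rewrite subUset; apply/andP; split.
  by rewrite foldl_cat; apply: del_fold_sub.
apply/subsetP => f; rewrite inE => /andP[fG lt]; apply: del_fold_keep => //.
by apply/orP; right; apply/negP => /(del_order_prefix eo); rewrite leqNgt lt.
Qed.

Section NewArcs.
Variables (G H : digraph n) (s t : 'I_n).
Hypothesis HG : H \subset G.
Notation S := (serve G H s t).
Notation F := (S :\: H).

Lemma HS : H \subset S. Proof. exact: (serve_sub _ _ HG).1. Qed.
Lemma SG : S \subset G. Proof. exact: (serve_sub _ _ HG).2. Qed.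

Lemma new_needed e : e \in F -> ~~ reachable (S :\ e) s t.
Proof.
move=> /setDP[eS eH]; have [_] := serve_new eS eH; apply: contra; apply: reach_sub.
exact/setSD/subsetUl.
Qed.

Lemma new_st e : e \in F -> reachable S s t.
Proof. by move=> /setDP[eS eH]; apply: serve_reach; have [] := serve_new eS eH. Qed.

Lemma new_cut e : e \in F -> reachable (S :\ e) s e.1 /\ reachable (S :\ e) e.2 t.
Proof. by move=> eF; apply: reach_cut (new_st eF) (new_needed eF). Qed.

Lemma H_sub_del e : e \in F -> H \subset S :\ e.
Proof.
move=> /setDP[_ eH]; apply/subsetP => f fH; rewrite !inE (subsetP HS) // andbT.
by apply: contraNneq eH => <-.
Qed.

Lemma new_in e : e \in F -> e \in S. Proof. by move=> /setDP[]. Qed.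

Lemma new_in_del e f : e \in F -> f \in F -> e != f -> e \in S :\ f.
Proof. by move=> eF fF neq; rewrite !inE neq new_in. Qed.

(** Every [s]-[t] path of [S] uses both arcs, so one of them comes first. *)
Lemma new_order e f : e \in F -> f \in F -> e != f ->
  reachable (S :\ e :\ f) e.2 f.1 \/ reachable (S :\ f :\ e) f.2 e.1.
Proof.
move=> eF fF neq; have [se et] := new_cut eF.
have swap : S :\ f :\ e = S :\ e :\ f by rewrite !setDDl setUC.
case/boolP: (reachable (S :\ e :\ f) s e.1) => [se'|nse]; last first.
  by right; rewrite swap; have [] := reach_cut se nse.
case/boolP: (reachable (S :\ e :\ f) e.2 t) => [et'|net]; last first.
  by left; have [] := reach_cut et net.
case/negP: (new_needed fF); apply: (@reach_arc _ _ e); first exact: new_in_del.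
  by apply: reach_sub se'; rewrite -swap subD1set.
by apply: reach_sub et'; rewrite -swap subD1set.
Qed.

(** If [e.1] can be reached from [s] without [f], then [e] replaces [f] at their common head.
    Otherwise [f.1] is reached without [e], and [f] replaces [e]. *)
Lemma new_heads_inj e f : e \in F -> f \in F -> e.2 = f.2 -> e = f.
Proof.
move=> eF fF ee; apply/eqP; apply: contraT => neq.
have [se et] := new_cut eF; have [sf ft] := new_cut fF.
have swap : S :\ f :\ e = S :\ e :\ f by rewrite !setDDl setUC.
case/boolP: (reachable (S :\ e :\ f) s e.1) => [se'|nse].
  case/negP: (new_needed fF); apply: (@reach_arc _ _ e); first exact: new_in_del.
    by apply: reach_sub se'; rewrite -swap subD1set.
  by rewrite ee.
have [sf' _] := reach_cut se nse; case/negP: (new_needed eF).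
apply: (@reach_arc _ _ f); first by rewrite eq_sym in neq; apply: new_in_del.
  exact: reach_sub (subD1set _ _) sf'.
by rewrite -ee.
Qed.

Lemma new_tails_inj e f : e \in F -> f \in F -> e.1 = f.1 -> e = f.
Proof.
move=> eF fF ee; apply/eqP; apply: contraT => neq.
have [se et] := new_cut eF; have [sf ft] := new_cut fF.
have swap : S :\ f :\ e = S :\ e :\ f by rewrite !setDDl setUC.
case/boolP: (reachable (S :\ e :\ f) e.2 t) => [et'|net].
  case/negP: (new_needed fF); apply: (@reach_arc _ _ e); first exact: new_in_del.
    by rewrite ee.
  by apply: reach_sub et'; rewrite -swap subD1set.
have [_ ft'] := reach_cut et net; case/negP: (new_needed eF).
apply: (@reach_arc _ _ f); first by rewrite eq_sym in neq; apply: new_in_del.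
  by rewrite -ee.
exact: reach_sub (subD1set _ _) ft'.
Qed.

Lemma new_head_unreached e : e \in F -> ~~ reachable H s e.2.
Proof.
move=> eF; apply/negP => h; case/negP: (new_needed eF); have [_ et] := new_cut eF.
by apply: reach_trans et; apply: reach_sub h; apply: H_sub_del.
Qed.

Lemma new_tail_unreached e : e \in F -> ~~ reachable H e.1 t.
Proof.
move=> eF; apply/negP => h; case/negP: (new_needed eF); have [se _] := new_cut eF.
by apply: reach_trans se _; apply: reach_sub h; apply: H_sub_del.
Qed.

Lemma new_bypass e : e \in F -> ~~ reachable H e.1 e.2.
Proof.
move=> eF; apply/negP => h; case/negP: (new_needed eF); have [se et] := new_cut eF.
apply: reach_trans se _; apply: reach_trans et.
by apply: reach_sub h; apply: H_sub_del.
Qed.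

Lemma new_none : reachable H s t -> F = set0.
Proof.
move=> st; apply/setP => e; rewrite !in_set0; apply/negP => eF.
by case/negP: (new_needed eF); apply: reach_sub st; apply: H_sub_del.
Qed.
End NewArcs.
End Serve.

(** * The algorithm *)

Section Algorithm.
Variable n : nat.
Implicit Types (G H : digraph n) (e f : 'I_n * 'I_n) (s t u v w : 'I_n).

Definition mutual G u v := reachable G u v && reachable G v u.

Definition scc_pairs G :=
  flatten [seq [seq (u, v) | v <- enum 'I_n & mutual G u v] | u <- enum 'I_n].

Definition run G H q := foldl (fun H d => serve G H d.1 d.2) H q.

Definition start G := run G set0 (scc_pairs G).

(** The preserver must be empty before the first demand, so [start G] enters only together with
    it. *)
Definition alg G q := if q is [::] then set0 else run G (start G) q.

Lemma run_sub G H q : H \subset G -> H \subset run G H q /\ run G H q \subset G.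
Proof.
elim: q H => //= d q IH H HG; have [h1 h2] := serve_sub d.1 d.2 HG.
by have [h3 h4] := IH _ h2; split => //; apply: subset_trans h3.
Qed.

Lemma run_reach G H q d : H \subset G -> d \in q -> reachable G d.1 d.2 ->
  reachable (run G H q) d.1 d.2.
Proof.
elim: q H => //= x q IH H HG; have [h1 h2] := serve_sub x.1 x.2 HG.
rewrite inE => /orP[/eqP->|dq] r; last exact: IH.
by apply: reach_sub (serve_reach H r); apply: (run_sub q h2).1.
Qed.

Lemma start_sub G : start G \subset G.
Proof. exact: (run_sub _ (sub0set _)).2. Qed.

Lemma mutual_refl G u : mutual G u u.
Proof. by rewrite /mutual reach0. Qed.

Lemma mutual_sym G u v : mutual G u v = mutual G v u.
Proof. exact: andbC. Qed.

Lemma mutual_trans G u v w : mutual G u v -> mutual G v w -> mutual G u w.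
Proof.
by move=> /andP[a b] /andP[c d]; rewrite /mutual (reach_trans a c) (reach_trans d b).
Qed.

Definition rep G u : 'I_n := [arg min_(w < u | mutual G u w) w].

Lemma repP G u : mutual G u (rep G u) /\ forall w, mutual G u w -> rep G u <= w.
Proof. by rewrite /rep; case: arg_minnP => [|w ? ?]; first exact: mutual_refl. Qed.

Lemma rep_eq G u v : mutual G u v -> rep G u = rep G v.
Proof.
move=> uv; have [mu minu] := repP G u; have [mv minv] := repP G v.
have uv' : mutual G u (rep G v) by apply: mutual_trans mv.
have vu' : mutual G v (rep G u) by apply: mutual_trans mu; rewrite mutual_sym.
by apply/val_inj/eqP; rewrite eqn_leq /= minu // minv.
Qed.

Lemma eq_rep G u v : rep G u = rep G v -> mutual G u v.
Proof.
move=> e; have [mu _] := repP G u; have [mv _] := repP G v.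
by apply: mutual_trans mu _; rewrite e mutual_sym.
Qed.

Lemma rep_rep G u : rep G (rep G u) = rep G u.
Proof. by apply/esym/rep_eq; have [] := repP G u. Qed.

Lemma mutual_desc G u v : mutual G u v -> desc G u = desc G v.
Proof. by move=> /andP[a b]; apply/eqP; rewrite eqn_leq !desc_le. Qed.

Lemma rep_desc G u : desc G (rep G u) = desc G u.
Proof. by apply/esym/mutual_desc; have [] := repP G u. Qed.

Lemma mem_scc_pairs G d : (d \in scc_pairs G) = mutual G d.1 d.2.
Proof.
apply/flatten_mapP/idP => [[u _ /mapP[v]]|m].
  by rewrite mem_filter => /andP[m _] ->.
exists d.1; rewrite ?mem_enum //; apply/mapP; exists d.2; last exact: surjective_pairing.
by rewrite mem_filter m mem_enum.
Qed.

Definition lexi (d e : 'I_n * 'I_n) := (d.1 < e.1) || (d.1 == e.1) && (d.2 < e.2).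

Lemma scc_pairs_lexi G : pairwise lexi (scc_pairs G).
Proof.
apply: (pairwise_flatten (pairwise_enum_ord n)) => [u _|u v x y uv].
  rewrite pairwise_map; apply: pairwise_filter.
  by apply: sub_pairwise (pairwise_enum_ord n) => v w vw; rewrite /lexi /= eqxx vw orbT.
by move=> /mapP[? _ ->] /mapP[? _ ->]; rewrite /lexi /= uv.
Qed.

Lemma scc_pairs_prefix G l1 d l2 e : scc_pairs G = l1 ++ d :: l2 ->
  mutual G e.1 e.2 -> lexi e d -> e \in l1.
Proof.
move=> split me lt; have : e \in scc_pairs G by rewrite mem_scc_pairs.
rewrite split mem_cat => /orP[//|]; have := scc_pairs_lexi G.
rewrite split pairwise_cat => /and3P[_ _ /= /andP[/allP h _]].
rewrite inE => /orP[/eqP e_d|/h]; move: lt; rewrite /lexi -!val_eqE /=; first by rewrite e_d; lia.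
lia.
Qed.

Lemma start_mutual G u v : mutual G u v -> reachable (start G) u v.
Proof.
move=> m; apply: (run_reach (d := (u, v)) (sub0set _)); first by rewrite mem_scc_pairs.
by case/andP: m.
Qed.

(** A potential, at most [2 n], which pays for the arcs added while the strong components are
    served. *)
Definition spanned G H :=
  #|[set w | reachable H (rep G w) w]| + #|[set w | reachable H w (rep G w)]|.

Lemma card_serve G H s t : H \subset G -> #|serve G H s t| = #|H| + #|serve G H s t :\: H|.
Proof.
move=> HG; rewrite -(cardsID H (serve G H s t)); congr (_ + _); congr #|pred_of_set _|.
by apply/setIidPr; apply: HS.
Qed.

(** If [u] is the least vertex of its component, the heads of the new arcs are distinct and become
    newly reachable from [u]; if [v] is, the same holds for their tails and reaching [v]. In the
    last case no arc is added. *)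
Lemma spanned_step G H u v : H \subset G -> mutual G u v ->
  [\/ u = rep G u, v = rep G v | reachable H u v] ->
  #|serve G H u v| + spanned G H <= #|H| + spanned G (serve G H u v).
Proof.
move=> HG m; rewrite card_serve // -addnA leq_add2l.
set S := serve G H u v; set F := S :\: H.
have [uv vu] := andP m.
have mono1 : [set w | reachable H (rep G w) w] \subset [set w | reachable S (rep G w) w].
  by apply/subsetP => w; rewrite !inE; apply: reach_sub; apply: HS.
have mono2 : [set w | reachable H w (rep G w)] \subset [set w | reachable S w (rep G w)].
  by apply/subsetP => w; rewrite !inE; apply: reach_sub; apply: HS.
have SG := SG u v HG; case => [ur|vr|r].
- rewrite /spanned !addnA leq_add ?subset_leq_card // addnC -(cardsID [set w | reachable H (rep G w) w] [set w | reachable S (rep G w) w]).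
  rewrite (setIidPr mono1) leq_add2l.
  rewrite -(@card_in_imset _ _ (fun e => e.2) F); last by move=> e f; apply: new_heads_inj.
  apply/subset_leq_card/subsetP => _ /imsetP[e eF ->]; rewrite !inE.
  have [se et] := new_cut eF; have eS := new_in eF.
  have re : reachable S u e.2.
    by apply: (reach_arc eS _ (reach0 _ _)); apply: reach_sub se; apply: subD1set.
  have ere : rep G e.2 = u.
    rewrite ur; apply/rep_eq/andP; split; last exact: reach_sub re.
    by apply: reach_trans vu; apply: reach_sub et; apply: subset_trans SG; apply: subD1set.
  by rewrite ere (new_head_unreached HG eF).
- rewrite /spanned addnCA leq_add ?subset_leq_card // addnC -(cardsID [set w | reachable H w (rep G w)] [set w | reachable S w (rep G w)]).
  rewrite (setIidPr mono2) leq_add2l.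
  rewrite -(@card_in_imset _ _ (fun e => e.1) F); last by move=> e f; apply: new_tails_inj.
  apply/subset_leq_card/subsetP => _ /imsetP[e eF ->]; rewrite !inE.
  have [se et] := new_cut eF; have eS := new_in eF.
  have re : reachable S e.1 v.
    by apply: (reach_arc eS (reach0 _ _)); apply: reach_sub et; apply: subD1set.
  have ere : rep G e.1 = v.
    rewrite vr; apply/rep_eq/andP; split; first exact: reach_sub re.
    by apply: reach_trans vu _; apply: reach_sub se; apply: subset_trans SG; apply: subD1set.
  by rewrite ere (new_tail_unreached HG eF).
- by rewrite /F (new_none HG r) cards0 add0n /spanned leq_add ?subset_leq_card.
Qed.

(** The first served pairs join the least vertex of every strong component to and
    from the others; each arc added for them makes a new vertex reachable from
    the least one, or lets a new vertex reach it. *)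
Lemma card_start G : #|start G| <= 2 * n.
Proof.
have inv l1 l2 : scc_pairs G = l1 ++ l2 -> #|run G set0 l1| <= spanned G (run G set0 l1).
  elim/last_ind: l1 l2 => [|l1 [u v] IH] l2 sp; first by rewrite cards0.
  rewrite cat_rcons in sp; have {}IH := IH _ sp.
  rewrite /run foldl_rcons -/(run G set0 l1) /=; set H := run G set0 l1 in IH *.
  have HG : H \subset G by apply: (run_sub _ (sub0set _)).2.
  have m : mutual G u v by rewrite -(mem_scc_pairs G (u, v)) sp mem_cat mem_head orbT.
  have cases : [\/ u = rep G u, v = rep G v | reachable H u v].
    have [->|nu] := eqVneq u (rep G u); first by constructor 1; rewrite rep_rep.
    have [->|nv] := eqVneq v (rep G v); first by constructor 2; rewrite rep_rep.
    (* If neither end is least, both [(u, rep G u)] and [(rep G u, v)] precede [(u, v)]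
       lexicographically and are already served. *)
    constructor 3; have [mu minu] := repP G u; have [mv minv] := repP G v.
    have e := rep_eq m; have ltu : rep G u < u by rewrite ltn_neqAle eq_sym nu minu ?mutual_refl.
    have ltv : rep G u < v by rewrite e ltn_neqAle eq_sym nv minv ?mutual_refl.
    apply: (@reach_trans _ _ _ (rep G u)).
      apply: (run_reach (d := (u, rep G u)) (sub0set _)); last by case/andP: mu.
      by apply: (scc_pairs_prefix sp) => //; rewrite /lexi /= eqxx ltv orbT.
    apply: (run_reach (d := (rep G u, v)) (sub0set _)); last by rewrite e; case/andP: mv.
    by apply: (scc_pairs_prefix sp) => /=; rewrite ?e 1?mutual_sym // /lexi /= -e ltu.
  have := spanned_step HG m cases; move: IH.
  by move: #|H| #|serve _ _ _ _| (spanned G H) (spanned _ _) => a b c d; lia.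
apply: leq_trans (inv (scc_pairs G) [::] _) _; first by rewrite cats0.
by rewrite mul2n -addnn leq_add // -[X in _ <= X]card_ord max_card.
Qed.
End Algorithm.

Lemma alg_preserver : online_reachability_preserver alg.
Proof.
move=> n G; split => // [[|d q]|[|d q] e|q s t st] //=.
- exact: sub0set.
- by have [] := run_sub (d :: q) (start_sub G).
- exact: sub0set.
- rewrite /run /= foldl_rcons; apply: (serve_sub _ _ _).1.
  exact: (run_sub (d :: q) (start_sub G)).2.
- have -> : alg G (rcons q (s, t)) = run G (start G) (rcons q (s, t)) by case: q.
  by apply: (run_reach (d := (s, t)) (start_sub G)); rewrite ?mem_rcons ?mem_head.
Qed.

(** * The path system of a run *)

Section Reduction.
Variables (n : nat) (G : digraph n) (q : seq ('I_n * 'I_n)).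
Notation P := 'I_(size q).

Definition state k := run G (start G) (take k q).
Definition demand (j : P) := tnth (in_tuple q) j.
Definition fresh (j : P) := state j.+1 :\: state j.

Lemma state_G k : state k \subset G.
Proof. exact: (run_sub _ (start_sub G)).2. Qed.

Lemma start_state k : start G \subset state k.
Proof. exact: (run_sub _ (start_sub G)).1. Qed.

Lemma stateS (j : P) : state j.+1 = serve G (state j) (demand j).1 (demand j).2.
Proof.
rewrite /state /demand (tnth_nth (demand j)) /= (take_nth (demand j)) ?ltn_ord //.
by rewrite /run foldl_rcons.
Qed.

Lemma state_mono i j : i <= j -> state i \subset state j.
Proof.
move=> ij; rewrite -(subnKC ij) /state takeD /run foldl_cat.
exact: (run_sub _ (state_G i)).1.
Qed.

Lemma freshE j : fresh j = serve G (state j) (demand j).1 (demand j).2 :\: state j.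
Proof. by rewrite /fresh stateS. Qed.

Lemma fresh_S j e : e \in fresh j -> e \in state j.+1.
Proof. by case/setDP. Qed.

Lemma fresh_G j e : e \in fresh j -> reachable G e.1 e.2.
Proof.
move=> /fresh_S eS; apply: reach1; rewrite -surjective_pairing.
exact: (subsetP (state_G j.+1)).
Qed.

(** Otherwise the ends of [e] would be strongly connected, and [start G] would already bypass
    [e]. *)
Lemma fresh_desc j e : e \in fresh j -> desc G e.2 < desc G e.1.
Proof.
move=> eF; apply: desc_lt (fresh_G eF) _; apply/negP => r; rewrite freshE in eF.
case/negP: (new_bypass (state_G j) eF); apply: reach_sub (start_state j) _.
apply: start_mutual; rewrite /mutual r andbT; apply: fresh_G; rewrite freshE; exact: eF.
Qed.

Lemma fresh_order j e f : e \in fresh j -> f \in fresh j -> e != f ->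
  desc G f.1 < desc G e.1 /\ reachable (state j.+1 :\ e :\ f) e.2 f.1 \/
  desc G e.1 < desc G f.1 /\ reachable (state j.+1 :\ f :\ e) f.2 e.1.
Proof.
move=> eF fF neq.
have sub M x y : reachable (state j.+1 :\ x :\ y) M.1 M.2 -> reachable G M.1 M.2.
  by apply: reach_sub; do 2!apply: subset_trans (subD1set _ _) _; apply: state_G.
have eF' := eF; have fF' := fF; rewrite freshE in eF' fF'.
have [r|r] := new_order eF' fF' neq; [left|right]; rewrite -stateS in r; split=> //.
  apply: leq_ltn_trans (fresh_desc eF); apply: desc_le; exact: (sub (_, _) _ _ r).
apply: leq_ltn_trans (fresh_desc fF); apply: desc_le; exact: (sub (_, _) _ _ r).
Qed.

Lemma fresh_inj j e f : e \in fresh j -> f \in fresh j -> desc G e.1 = desc G f.1 -> e = f.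
Proof.
move=> eF fF ed; apply/eqP; apply: contraT => neq.
by have [[]|[]] := fresh_order eF fF neq; rewrite ed ltnn.
Qed.

Lemma fresh_reach j e f : e \in fresh j -> f \in fresh j -> desc G f.1 <= desc G e.1 ->
  reachable (state j.+1) e.1 f.1.
Proof.
move=> eF fF; rewrite leq_eqVlt => /orP[/eqP ed|lt].
  by rewrite (fresh_inj eF fF (esym ed)) reach0.
have neq : e != f by apply: contraTneq lt => ->; rewrite ltnn.
have [[_ r]|[c _]] := fresh_order eF fF neq; last by have := ltn_trans c lt; rewrite ltnn.
apply: (reach_arc (fresh_S eF) (reach0 _ _)).
by apply: reach_sub r; do 2!apply: subset_trans (subD1set _ _) _.
Qed.

(** Tails are replaced by representatives, so that two paths passing through one strong component
    meet in a node. *)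
Definition path_inc v j := [exists e in fresh j, rep G e.1 == v].

Lemma path_incP v j : reflect (exists2 e, e \in fresh j & rep G e.1 = v) (path_inc v j).
Proof.
apply: (iffP existsP) => [[e /andP[eF /eqP ev]]|[e eF ev]]; first by exists e.
by exists e; rewrite eF ev /=.
Qed.

Lemma sub_desc v w : n - desc G v < n - desc G w -> desc G w < desc G v.
Proof. by have := desc_le_n G v; have := desc_le_n G w; move: (desc G v) (desc G w) => a b; lia. Qed.

Lemma sub_desc_le v w : n - desc G v <= n - desc G w -> desc G w <= desc G v.
Proof. by have := desc_le_n G v; have := desc_le_n G w; move: (desc G v) (desc G w) => a b; lia. Qed.

Lemma path_reach j v w : path_inc v j -> path_inc w j ->
  n - desc G v <= n - desc G w -> reachable G v w.
Proof.
move=> /path_incP[e eF <-] /path_incP[f fF <-] /sub_desc_le; rewrite !rep_desc => le.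
have [/andP[_ r1] _] := repP G e.1; have [/andP[r2 _] _] := repP G f.1.
apply: reach_trans r1 _; apply: reach_trans r2.
exact: reach_sub (state_G _) (fresh_reach eF fF le).
Qed.

(** The route up to [e], then inside the strong component to [c], along the
    earlier path to [c'], and on to the target avoids [e]. *)
Lemma no_detour (i j : P) e c c' : i < j -> e \in fresh j -> c \in fresh i -> c' \in fresh i ->
  mutual G e.1 c.1 -> desc G c'.1 < desc G c.1 -> ~~ reachable G c'.1 (demand j).2.
Proof.
move=> ij eF cF c'F m lt; apply/negP => r; rewrite freshE in eF.
have [eS eH] := setDP eF; have [_ /negP] := serve_new eS eH; apply.
set S := serve _ _ _ _; set D := (S :|: _) :\ e.
have [se _] := new_cut eF.
have HD : state j \subset D.
  apply: subset_trans (H_sub_del (state_G j) eF) _; exact/setSD/subsetUl.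
have low : below G (desc G e.1) :\ e = below G (desc G e.1).
  apply/setP => f; rewrite !inE; case: eqP => // ->; by rewrite ltnn andbF.
have LD : below G (desc G e.1) \subset D by rewrite -low; apply/setSD/subsetUr.
apply: reach_trans (_ : reachable D _ e.1) _.
  by apply: reach_sub se; apply/setSD/subsetUl.
apply: reach_trans (_ : reachable D _ c.1) _.
  by apply: reach_sub HD _; apply: reach_sub (start_state j) _; apply: start_mutual.
apply: reach_trans (_ : reachable D _ c'.1) _.
  apply: reach_sub HD _; apply: reach_sub (state_mono ij) _.
  by apply: fresh_reach cF c'F (ltnW lt).
(* Descendant counts do not increase along arcs, so all arcs on a route of [G] from [c'] leave
   vertices with fewer descendants than [e.1]. *)
apply: reach_sub LD _; move: r lt; rewrite -(mutual_desc m); move: c'.1 => u r lt {c'F}.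
elim/reach_ind: u / r lt => [|u v uv vt IH] lt; first exact: reach0.
have le : desc G v <= desc G u by apply/desc_le/reach1.
apply: reach_trans (IH (leq_ltn_trans le lt)); apply: reach1.
by rewrite inE uv.
Qed.

Definition path_system : psystem 'I_n P.
Proof.
exists path_inc (fun v => n - desc G v) (fun j => val j).
- move=> j v w vj wj e; move: vj wj e => /path_incP[a aF <-] /path_incP[b bF <-].
  rewrite !rep_desc => e; congr (rep G _.1); apply: (fresh_inj aF bF).
  have := desc_le_n G a.1; have := desc_le_n G b.1.
  by move: (desc _ _) (desc _ _) e => x y e; lia.
- by move=> v i j _ _ /val_inj.
- move=> i j B B' r r' s s' ij ri rj r'i rr' sj rs r'B s'B r's' s'B' sB' s's.
  (* The bridging paths enter only through reachability in [G], which is why their times are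
     arbitrary. *)
  have r's : reachable G r' s.
    exact: reach_trans (path_reach r'B s'B r's') (path_reach s'B' sB' s's).
  case/path_incP: ri => c cF cr; case/path_incP: rj => e eF er.
  case/path_incP: r'i => c' c'F c'r'; case/path_incP: sj => f fF fs.
  have m : mutual G e.1 c.1 by apply: eq_rep; rewrite cr er.
  have lt : desc G c'.1 < desc G c.1.
    by move/sub_desc: rr'; rewrite -cr -c'r' !rep_desc.
  case/negP: (no_detour ij eF cF c'F m lt).
  have [/andP[h1 _] _] := repP G c'.1; have [/andP[_ h2] _] := repP G f.1.
  rewrite c'r' in h1; rewrite fs in h2.
  apply: reach_trans h1 _; apply: reach_trans r's _; apply: reach_trans h2 _.
  have fF' := fF; rewrite freshE in fF'; have [_ ft] := new_cut fF'.
  apply: reach_trans (fresh_G fF) _; apply: reach_sub ft.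
  by apply: subset_trans (subD1set _ _) _; rewrite -stateS; apply: state_G.
Defined.

Lemma path_len j : len path_system j = #|fresh j|.
Proof.
rewrite /len -(@card_in_imset _ _ (fun e => rep G e.1) (fresh j)).
  apply: eq_card => v; rewrite inE /=; apply/path_incP/imsetP => -[e eF ev]; exists e => //.
move=> e f eF fF /eq_rep/mutual_desc ed; exact: (fresh_inj eF fF ed).
Qed.

Lemma card_state k : k <= size q ->
  #|state k| = #|start G| + \sum_(j < size q | j < k) #|fresh j|.
Proof.
elim: k => [|k IH] kq; first by rewrite big_pred0 ?addn0 // /state take0.
rewrite (stateS (Ordinal kq)) card_serve ?state_G // IH ?(ltnW kq) // -addnA; congr (_ + _).
rewrite [RHS](bigD1 (Ordinal kq)) //= addnC; congr (_ + _); first by rewrite freshE.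
by apply: eq_bigl => j; rewrite ltnS -val_eqE /= ltn_neqAle andbC.
Qed.

Lemma alg_size : q != [::] -> #|alg G q| <= 2 * n + \sum_j len path_system j.
Proof.
move=> q0; have -> : alg G q = state (size q) by rewrite /state take_size; case: q q0.
rewrite card_state // leq_add ?card_start //.
apply: eq_leq; apply: eq_big => [j|j _]; last by rewrite path_len.
exact: ltn_ord.
Qed.
End Reduction.

(** * Programs *)

Definition upd T (f : nat -> T) i v : nat -> T := fun j => if j == i then v else f j.

Record store n := Store { gr : nat -> digraph n; cnt : nat }.

Definition set_gr n (g : store n) k M := Store (upd (gr g) k M) (cnt g).
Definition set_cnt n (g : store n) c := Store (gr g) c.

(** Only the arrays of [live] are in use; every cell outside them still holds the
    value given by [frame]. *)
Record ctx := Ctx { live : seq nat; base : nat -> nat; frame : nat -> nat; ptr : nat }.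

Local Notation rN := 0 (only parsing).
Local Notation rP := 1 (only parsing).
Local Notation rF := 2 (only parsing).
Local Notation rA := 3 (only parsing).
Local Notation rT := 4 (only parsing).
Local Notation rD := 5 (only parsing).
Local Notation rJ := 6 (only parsing).
Local Notation node i := (i.*2 + 10).
Local Notation rB k := (k.*2 + 11).

(** Only the node variables below [d] are in scope, so that loops may clobber the
    registers above. *)
Record sim n (C : ctx) (d : nat) (e : nat -> 'I_n) (g : store n) (m : machine_state) : Prop := Sim {
  sim_n : regs m rN = n;
  sim_ptr : regs m rJ = ptr C;
  sim_cnt : regs m rD = cnt g;
  sim_base : forall k, k \in live C -> regs m (rB k) = base C k;
  sim_node : forall i, i < d -> regs m (node i) = e i;
  sim_apart : forall k k', k \in live C -> k' \in live C -> k != k' ->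
    base C k + n * n <= base C k' \/ base C k' + n * n <= base C k;
  sim_gr : forall k (u v : 'I_n), k \in live C ->
    (mem m (base C k + (u * n + v)) != 0) = ((u, v) \in gr g k);
  sim_frame : forall a, (forall k, k \in live C -> ~~ (base C k <= a < base C k + n * n)) ->
    mem m a = frame C a }.

Lemma cell_lt n (u v : 'I_n) : u * n + v < n * n.
Proof.
apply: leq_trans (_ : u * n + n <= _); first by rewrite ltn_add2l.
by rewrite addnC -mulSn leq_mul2r ltn_ord orbT.
Qed.

Lemma cell_inj n (u v u' v' : 'I_n) : u * n + v = u' * n + v' -> (u, v) = (u', v').
Proof.
move=> e; have n0 : 0 < n by apply: leq_trans (ltn_ord u).
congr pair; apply: val_inj => /=.
  by have := congr1 (divn^~ n) e; rewrite /= !divnMDl // !divn_small // !addn0.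
by have := congr1 (modn^~ n) e; rewrite /= !modnMDl !modn_small.
Qed.

Lemma sim_scratch n C d e (g : store n) m x k : x \in [:: rF; rA; rT] ->
  sim C d e g m -> sim C d e g (set_reg m x k).
Proof.
move=> xs [h1 h2 h3 h4 h5 h6 h7 h8].
have neq y : y \notin [:: rF; rA; rT] -> regs (set_reg m x k) y = regs m y.
  by move=> ys; rewrite /= /update; case: eqP => // e'; rewrite e' xs in ys.
split => //.
- by rewrite neq.
- by rewrite neq.
- by rewrite neq.
- by move=> j jL; rewrite neq ?h4 // !inE; lia.
- by move=> i id; rewrite neq ?h5 // !inE; lia.
Qed.

Lemma sim_weaken n C d e e' (g : store n) m : (forall i, i < d -> e' i = e i) ->
  sim C d.+1 e' g m -> sim C d e g m.
Proof.
move=> ee [h1 h2 h3 h4 h5 h6 h7 h8]; split => // i id; rewrite h5 ?ee //; lia.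
Qed.

Lemma sim_bind n C d e (g : store n) m (v : 'I_n) : regs m (node d) = v ->
  sim C d e g m -> sim C d.+1 (upd e d v) g m.
Proof.
move=> ev [h1 h2 h3 h4 h5 h6 h7 h8]; split => // i; rewrite ltnS leq_eqVlt /upd.
by case: eqP => [->//|_ /=]; apply: h5.
Qed.

Lemma sim_set_node n C d e (g : store n) m v :
  sim C d e g m -> sim C d e g (set_reg m (node d) v).
Proof.
move=> [h1 h2 h3 h4 h5 h6 h7 h8]; split => //= [|||j jL|i id]; rewrite /update.
- by case: eqP; lia.
- by case: eqP; lia.
- by case: eqP; lia.
- by case: eqP => [|_]; [lia | apply: h4].
- by case: eqP => [|_]; [lia | apply: h5].
Qed.

Lemma sim_set_cnt n C d e (g : store n) m c :
  sim C d e g m -> sim C d e (set_cnt g c) (set_reg m rD c).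
Proof.
move=> [h1 h2 h3 h4 h5 h6 h7 h8]; split => //= [j jL|i id]; rewrite /update.
- by case: eqP => [|_]; [lia | apply: h4].
- by case: eqP => [|_]; [lia | apply: h5].
Qed.

Lemma sim_write n C d e (g : store n) m k (u v : 'I_n) (b : bool) : k \in live C ->
  sim C d e g m ->
  sim C d e (set_gr g k (if b then (u, v) |: gr g k else gr g k :\ (u, v)))
    (set_mem m (base C k + (u * n + v)) b).
Proof.
move=> kL [h1 h2 h3 h4 h5 h6 h7 h8]; split => //=.
- move=> k' u' v' k'L; rewrite /update /upd; have [->|kk] := eqVneq k' k.
    rewrite eqn_add2l; case: (u' * n + v' =P u * n + v) => [/cell_inj[-> ->]|ne].
      by case: b; rewrite !inE eqxx.
    rewrite h7 //; have ne' : (u', v') != (u, v).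
      by apply: contra_notN ne => /eqP[-> ->].
    by case: b; rewrite !inE (negbTE ne').
  rewrite ifN ?h7 //; have := cell_lt u v; have := cell_lt u' v'.
  by have := h6 _ _ k'L kL kk; move: (u * n + v) (u' * n + v') => a b'; lia.
- move=> a aL; rewrite /update ifN ?h8 //; apply: contraNneq (aL _ kL) => ->.
  by have := cell_lt u v; move: (u * n + v) => ?; lia.
Qed.

Definition semantics := forall n, (nat -> 'I_n) -> store n -> store n.

Definition impl (L : seq nat) (d : nat) (P : program) (f : semantics) :=
  exists c k, forall n C e (g : store n) m, live C = L -> sim C d e g m ->
  exists t m', [/\ runs P m t m', t <= c * n.+1 ^ k & sim C d e (f n e g) m'].

Lemma impl_ext L d P (f f' : semantics) : (forall n e (g : store n), f n e g = f' n e g) ->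
  impl L d P f -> impl L d P f'.
Proof.
move=> ff [c [k h]]; exists c, k => n C e g m CL s; have [t [m' [r tc s']]] := h _ _ _ _ _ CL s.
by exists t, m'; rewrite -ff.
Qed.

Lemma poly_add S c1 k1 c2 k2 c3 : 0 < S ->
  c1 * S ^ k1 + c2 * S ^ k2 + c3 <= (c1 + c2 + c3) * S ^ (k1 + k2).
Proof.
move=> S0; rewrite expnD !mulnDl.
have h1 : 0 < S ^ k1 by rewrite expn_gt0 S0. have h2 : 0 < S ^ k2 by rewrite expn_gt0 S0.
rewrite !leq_add //; first by rewrite leq_mul2l leq_pmulr ?orbT.
  by rewrite leq_mul2l leq_pmull ?orbT.
by rewrite leq_pmulr // muln_gt0 h1.
Qed.

Lemma poly_mul S n c k c' : n < S -> n * (c * S ^ k + c') + c' <= (c + c') * S ^ k.+1.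
Proof.
move=> nS; have S0 : 0 < S ^ k by rewrite expn_gt0; lia.
rewrite expnS mulnCA; apply: leq_trans (leq_mul nS (leqnn _)).
rewrite mulSn addnC; apply: leq_add; first by rewrite mulnDl -[X in X <= _]add0n leq_add // leq_pmulr.
by rewrite leq_mul2l mulnDl leq_add2l leq_pmulr ?orbT.
Qed.

Definition skip := Const rF 0.

Lemma impl_skip L d : impl L d skip (fun n e g => g).
Proof.
exists 1, 0 => n C e g m _ s; exists 1, (set_reg m rF 0); split => //; first by constructor.
exact: sim_scratch.
Qed.

Lemma impl_seq L d P1 f1 P2 f2 : impl L d P1 f1 -> impl L d P2 f2 ->
  impl L d (Seq P1 P2) (fun n e g => f2 n e (f1 n e g)).
Proof.
move=> [c1 [k1 h1]] [c2 [k2 h2]]; exists (c1 + c2 + 0), (k1 + k2) => n C e g m CL s.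
have [t1 [m1 [r1 b1 s1]]] := h1 _ _ _ _ _ CL s; have [t2 [m2 [r2 b2 s2]]] := h2 _ _ _ _ _ CL s1.
exists (t1 + t2), m2; split => //; first exact: RunSeq r1 r2.
by apply: leq_trans (poly_add _ _ _ _ _ (ltn0Sn n)); rewrite addn0 leq_add.
Qed.

(** [rA := base k + x n + y] *)
Definition address k x y :=
  Seq (Const rF 0) (Seq (Add rT rN rF) (Seq (Add rA (rB k) rF) (Seq
    (While rT (Seq (Add rA rA (node x)) (Seq (Const rF 1) (Sub rT rT rF))))
    (Add rA rA (node y))))).

Lemma runs_address n C d e (g : store n) m k x y : k \in live C -> x < d -> y < d ->
  sim C d e g m -> exists t m',
  [/\ runs (address k x y) m t m', t <= 9 * n.+1, sim C d e g m' &
      regs m' rA = base C k + (e x * n + e y)].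
Proof.
move=> kL xd yd s.
have loop i : forall m a, sim C d e g m -> regs m rT = i -> regs m rA = a -> exists m',
  [/\ runs (While rT (Seq (Add rA rA (node x)) (Seq (Const rF 1) (Sub rT rT rF)))) m (4 * i).+1 m',
      sim C d e g m' & regs m' rA = a + e x * i].
  elim: i => [|i IH] {}m a {}s eT eA.
    by exists m; split; [apply: RunWhileFalse; rewrite eT | | rewrite muln0 addn0].
  pose m1 := set_reg m rA (regs m rA + regs m (node x)).
  pose m2 := set_reg m1 rF 1; pose m3 := set_reg m2 rT (regs m2 rT - regs m2 rF).
  have s3 : sim C d e g m3 by do 3 !apply: sim_scratch => //.
  have [||m' [r' s' a']] := IH m3 (a + e x) s3.
  - by rewrite /m3 /= /update /= eT subn1.
  - by rewrite /m3 /= /update /= eA (sim_node s).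
  exists m'; split => //; last by rewrite a' mulnS addnA.
  have -> : (4 * i.+1).+1 = ((1 + (1 + 1)) + (4 * i).+1).+1 by lia.
  apply: RunWhileTrue r'; first by rewrite eT.
  apply: RunSeq (RunAdd _ _ _ _) _; apply: RunSeq (RunConst _ _ _) _; exact: RunSub.
pose m1 := set_reg m rF 0; pose m2 := set_reg m1 rT (regs m1 rN + regs m1 rF).
pose m3 := set_reg m2 rA (regs m2 (rB k) + regs m2 rF).
have s2 : sim C d e g m2 by do 2 !apply: sim_scratch => //.
have s3 : sim C d e g m3 by apply: sim_scratch.
have [||m4 [r4 s4 a4]] := loop n m3 (base C k) s3.
- by rewrite /m3 /= /update /= addn0 (sim_n s).
- by rewrite -(sim_base s2 kL) -[RHS]addn0.
exists (1 + (1 + (1 + ((4 * n).+1 + 1)))), (set_reg m4 rA (regs m4 rA + regs m4 (node y))).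
split; last by rewrite /= /update /= a4 (sim_node s4) // -addnA.
- apply: RunSeq (RunConst _ _ _) _; apply: RunSeq (RunAdd _ _ _ _) _.
  by apply: RunSeq (RunAdd _ _ _ _) _; apply: RunSeq r4 _; apply: RunAdd.
- by lia.
- exact: sim_scratch.
Qed.

Definition put k x y (b : bool) := Seq (address k x y) (Seq (Const rF b) (Write rA rF)).

Lemma impl_put L d k x y b : k \in L -> x < d -> y < d -> impl L d (put k x y b)
  (fun n e g => set_gr g k (if b then (e x, e y) |: gr g k else gr g k :\ (e x, e y))).
Proof.
move=> kL xd yd; exists 11, 1 => n C e g m CL s; rewrite -CL in kL.
have [t [m' [r tb s' a']]] := runs_address kL xd yd s.
exists (t + (1 + 1)), (set_mem (set_reg m' rF b) (regs m' rA) b); split.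
- apply: RunSeq r _; apply: RunSeq (RunConst _ _ _) _.
  exact: (RunWrite (set_reg m' rF b) rA rF).
- by rewrite expn1; lia.
- by rewrite a'; apply: sim_write => //; apply: sim_scratch.
Qed.

Definition if_arc k x y P Q := Seq (address k x y) (Seq (Read rF rA) (If rF P Q)).

Lemma impl_if_arc L d k x y P Q f f' : k \in L -> x < d -> y < d ->
  impl L d P f -> impl L d Q f' -> impl L d (if_arc k x y P Q)
  (fun n e g => if (e x, e y) \in gr g k then f n e g else f' n e g).
Proof.
move=> kL xd yd [c1 [k1 h1]] [c2 [k2 h2]]; exists (9 * 1 + (c1 + c2 + 0) + 2), (1 + (k1 + k2)).
move=> n C e g m CL s; rewrite -CL in kL.
have [t [m1 [r tb s1 a1]]] := runs_address kL xd yd s.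
pose m2 := set_reg m1 rF (mem m1 (regs m1 rA)).
have s2 : sim C d e g m2 by apply: sim_scratch.
have test : (regs m2 rF != 0) = ((e x, e y) \in gr g k).
  by rewrite /m2 /= /update /= a1 (sim_gr s1).
have bound t' : t' <= c1 * n.+1 ^ k1 + c2 * n.+1 ^ k2 ->
    t + (1 + t'.+1) <= (9 * 1 + (c1 + c2 + 0) + 2) * n.+1 ^ (1 + (k1 + k2)).
  move=> t'b; apply: leq_trans (poly_add _ _ _ _ _ (ltn0Sn n)).
  have := poly_add c1 k1 c2 k2 0 (ltn0Sn n); rewrite expn1; move: (n.+1 ^ k1) (n.+1 ^ k2) t'b (n.+1 ^ (k1 + k2)) => *.
  by lia.
case: ifP test => _ test.
  have [t' [m' [r' t'b s']]] := h1 _ _ _ _ _ CL s2; exists (t + (1 + t'.+1)), m'; split => //.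
    by apply: RunSeq r _; apply: RunSeq (RunRead _ _ _) _; apply: RunIfTrue r'.
  by apply/bound/(leq_trans t'b)/leq_addr.
have [t' [m' [r' t'b s']]] := h2 _ _ _ _ _ CL s2; exists (t + (1 + t'.+1)), m'; split => //.
  apply: RunSeq r _; apply: RunSeq (RunRead _ _ _) _; apply: RunIfFalse r'.
  by apply: negbFE.
by apply/bound/(leq_trans t'b)/leq_addl.
Qed.

Definition for_node d P := Seq (Const (node d) 0) (Seq (Sub rT rN (node d))
  (While rT (Seq P (Seq (Const rT 1) (Seq (Add (node d) (node d) rT) (Sub rT rN (node d))))))).

Lemma impl_for_node L d P f : impl L d.+1 P f -> impl L d (for_node d P)
  (fun n e g => foldl (fun g v => f n (upd e d v) g) g (enum 'I_n)).
Proof.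
move=> [c [k h]]; exists (c + 4), k.+1 => n C e g m CL s.
set B := c * n.+1 ^ k.
have loop l : forall i g m, [seq val v | v <- l] = iota i (size l) -> i + size l = n ->
  sim C d e g m -> regs m (node d) = i -> regs m rT = n - i -> exists t m',
  [/\ runs (While rT (Seq P (Seq (Const rT 1) (Seq (Add (node d) (node d) rT) (Sub rT rN (node d))))))
        m t m', t <= size l * (B + 4) + 1
    & sim C d e (foldl (fun g v => f n (upd e d v) g) g l) m'].
  elim: l => [|v l IH] i {}g {}m vl il {}s eN eT.
    exists 1, m; split => //; apply: RunWhileFalse; rewrite eT; move: il => /=; lia.
  case: vl => vi vl; move: il => /= il.
  have [t1 [m1 [r1 b1 s1]]] := h _ _ _ _ _ CL (sim_bind (etrans eN (esym vi)) s).
  have n1 := sim_node s1 (ltnSn d); rewrite /upd eqxx in n1.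
  pose m2 := set_reg m1 rT 1.
  pose m3 := set_reg m2 (node d) (regs m2 (node d) + regs m2 rT).
  pose m4 := set_reg m3 rT (regs m3 rN - regs m3 (node d)).
  have s2 : sim C d e (f n (upd e d v) g) m1.
    apply: sim_weaken s1 => j jd; rewrite /upd; case: eqP => // jd'; lia.
  have s4 : sim C d e (f n (upd e d v) g) m4.
    by apply: sim_scratch => //; apply: sim_set_node; apply: sim_scratch.
  have e3 : regs m3 (node d) = i.+1.
    rewrite /m3 /m2 /= /update eqxx /=; case: eqP; first lia.
    by rewrite n1 vi addn1.
  have [||||t [m' [r' b' s']]] := IH i.+1 (f n (upd e d v) g) m4 _ _ s4; rewrite ?addSnnS //.
  - rewrite -e3 /m4 /= /update; case: eqP => //; lia.
  - rewrite /m4 /= /update /= -[in RHS]e3 -[in RHS](sim_n s2); congr (_ - _).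
    by rewrite /m3 /m2 /= /update /=; case: eqP => //; lia.
  exists ((t1 + (1 + (1 + 1))) + t).+1, m'; split => //.
    apply: RunWhileTrue r'; first by rewrite eT; lia.
    by apply: RunSeq r1 _; apply: RunSeq (RunConst _ _ _) _; apply: RunSeq (RunAdd _ _ _ _) _; apply: RunSub.
  by rewrite mulSn; move: b1 b'; rewrite -/B; move: (size l * _) => b; clearbody B; clear; lia.
pose m1 := set_reg m (node d) 0; pose m2 := set_reg m1 rT (regs m1 rN - regs m1 (node d)).
have s2 : sim C d e g m2 by apply: sim_scratch => //; apply: sim_set_node.
have e1 : regs m1 (node d) = 0 by rewrite /m1 /= /update eqxx.
have [||||t [m' [r' b' s']]] := loop (enum 'I_n) 0 g m2 _ _ s2.
- by rewrite val_enum_ord size_enum_ord.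
- by rewrite size_enum_ord.
- by rewrite /m2 /= /update eqxx; case: eqP; lia.
- have -> : regs m2 rT = regs m1 rN - regs m1 (node d) by [].
  by rewrite e1 !subn0 -(sim_n (sim_set_node 0 s)).
exists (1 + (1 + t)), m'; split => //.
  by apply: RunSeq (RunConst _ _ _) _; apply: RunSeq (RunSub _ _ _ _) _.
apply: leq_trans (poly_mul _ _ _ (ltnSn n)); move: b'; rewrite size_enum_ord -/B; lia.
Qed.

Definition cnt_node x := Seq (Const rF 0) (Add rD (node x) rF).

Lemma impl_cnt_node L d x : x < d -> impl L d (cnt_node x) (fun n e g => set_cnt g (e x)).
Proof.
move=> xd; exists 2, 0 => n C e g m CL s.
exists (1 + 1), (set_reg (set_reg m rF 0) rD (e x)); split => //.
  apply: RunSeq (RunConst _ _ _) _; rewrite -(sim_node s xd).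
  rewrite (_ : regs m (node x) = regs (set_reg m rF 0) (node x) + regs (set_reg m rF 0) rF); first exact: RunAdd.
  by rewrite /= /update /= addn0; case: eqP; lia.
by apply: sim_set_cnt; apply: sim_scratch.
Qed.

Definition cnt_incr := Seq (Const rF 1) (Add rD rD rF).

Lemma impl_cnt_incr L d : impl L d cnt_incr (fun n e g => set_cnt g (cnt g).+1).
Proof.
exists 2, 0 => n C e g m CL s.
exists (1 + 1), (set_reg (set_reg m rF 1) rD (regs m rD + 1)); split => //.
  by apply: RunSeq (RunConst _ _ _) _; apply: (RunAdd (set_reg m rF 1) rD rD rF).
by rewrite (sim_cnt s) addn1; apply: sim_set_cnt; apply: sim_scratch.
Qed.

(** The two truncated differences vanish together exactly when the counter equals [n]; hence the
    exchanged branches. *)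
Definition if_cnt P Q :=
  Seq (Sub rF rN rD) (Seq (Sub rT rD rN) (Seq (Add rF rF rT) (If rF Q P))).

Lemma impl_if_cnt L d P Q f f' : impl L d P f -> impl L d Q f' ->
  impl L d (if_cnt P Q) (fun n e g => if cnt g == n then f n e g else f' n e g).
Proof.
move=> [c1 [k1 h1]] [c2 [k2 h2]]; exists (c1 + c2 + 4), (k1 + k2) => n C e g m CL s.
pose m1 := set_reg m rF (regs m rN - regs m rD).
pose m2 := set_reg m1 rT (regs m1 rD - regs m1 rN).
pose m3 := set_reg m2 rF (regs m2 rF + regs m2 rT).
have s3 : sim C d e g m3 by do 3 !apply: sim_scratch => //.
have test : (regs m3 rF == 0) = (cnt g == n).
  by rewrite /m3 /m2 /m1 /= /update /= (sim_n s) (sim_cnt s); lia.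
have run t m' : runs (If rF Q P) m3 t m' -> runs (if_cnt P Q) m (1 + (1 + (1 + t))) m'.
  move=> r; apply: RunSeq (RunSub _ _ _ _) _; apply: RunSeq (RunSub _ _ _ _) _.
  exact: RunSeq (RunAdd _ _ _ _) r.
have bound t' : t' <= c1 * n.+1 ^ k1 + c2 * n.+1 ^ k2 ->
    1 + (1 + (1 + t'.+1)) <= (c1 + c2 + 4) * n.+1 ^ (k1 + k2).
  move=> t'b; apply: leq_trans (poly_add _ _ _ _ _ (ltn0Sn n)).
  by move: t'b; move: (_ + _ * _) => a; lia.
case: ifP test => _ test.
  have [t' [m' [r' t'b s']]] := h1 _ _ _ _ _ CL s3; exists (1 + (1 + (1 + t'.+1))), m'; split => //.
    by apply/run/RunIfFalse.
  by apply/bound/(leq_trans t'b)/leq_addr.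
have [t' [m' [r' t'b s']]] := h2 _ _ _ _ _ CL s3; exists (1 + (1 + (1 + t'.+1))), m'; split => //.
  by apply/run/RunIfTrue => //; rewrite test.
by apply/bound/(leq_trans t'b)/leq_addl.
Qed.

Lemma foldl_flatten A B (h : A -> B -> A) a ss : foldl h a (flatten ss) = foldl (foldl h) a ss.
Proof. by elim: ss a => //= s ss IH a; rewrite foldl_cat IH. Qed.

Lemma foldl_map A B B' (h : A -> B -> A) (F : B' -> B) a s :
  foldl h a [seq F x | x <- s] = foldl (fun a x => h a (F x)) a s.
Proof. by elim: s a => //= x s IH a. Qed.

Lemma foldl_filter A B (h : A -> B -> A) (b : pred B) a s :
  foldl h a [seq x <- s | b x] = foldl (fun a x => if b x then h a x else a) a s.
Proof. by elim: s a => //= x s IH a; case: (b x); rewrite /= IH. Qed.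

Lemma foldl_morph A A' B (F : A -> A') (h : A -> B -> A) (h' : A' -> B -> A') a s :
  (forall a x, h' (F a) x = F (h a x)) -> foldl h' (F a) s = F (foldl h a s).
Proof. by move=> hF; elim: s a => //= x s IH a; rewrite hF. Qed.

Lemma set_gr_id n (g : store n) k : set_gr g k (gr g k) = g.
Proof.
case: g => gr c; rewrite /set_gr /=; congr Store; apply: functional_extensionality => j.
by rewrite /upd; case: eqP => [->|].
Qed.

Lemma set_gr_set n (g : store n) k M M' : set_gr (set_gr g k M) k M' = set_gr g k M'.
Proof.
congr Store; apply: functional_extensionality => j; rewrite /= /upd; by case: eqP.
Qed.

Lemma gr_set n (g : store n) k M : gr (set_gr g k M) k = M.
Proof. by rewrite /= /upd eqxx. Qed.

Lemma gr_set_neq n (g : store n) k k' M : k' != k -> gr (set_gr g k M) k' = gr g k'.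
Proof. by rewrite /= /upd => /negbTE->. Qed.

Lemma foldl_set_gr T n (g : store n) k (h : digraph n -> T -> digraph n) F M s :
  (forall M x, F (set_gr g k M) x = set_gr g k (h M x)) ->
  foldl F (set_gr g k M) s = set_gr g k (foldl h M s).
Proof. exact: foldl_morph. Qed.

Lemma upd_same T (f : nat -> T) i v : upd f i v i = v.
Proof. by rewrite /upd eqxx. Qed.

Lemma upd_lt T (f : nat -> T) i v j : j < i -> upd f i v j = f j.
Proof. by rewrite /upd; case: eqP => // ->; rewrite ltnn. Qed.

Definition copy d k k' := for_node d (for_node d.+1
  (if_arc k d d.+1 (put k' d d.+1 true) (put k' d d.+1 false))).

Lemma impl_copy L d k k' : k \in L -> k' \in L -> k != k' ->
  impl L d (copy d k k') (fun n e g => set_gr g k' (gr g k)).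
Proof.
move=> kL k'L kk; apply: impl_ext; last first.
  by apply: impl_for_node; apply: impl_for_node; apply: impl_if_arc => //; apply: impl_put => //; lia.
move=> n e g; rewrite -{1}(set_gr_id g k').
pose h M (x : 'I_n * 'I_n) := if x \in gr g k then x |: M else M :\ x.
rewrite (@foldl_set_gr _ _ g k' (fun M x => foldl h M [seq (x, y) | y <- enum 'I_n])) => [|M x].
  congr set_gr; rewrite -(foldl_map (foldl h) (fun x => [seq (x, y) | y <- enum 'I_n])) -foldl_flatten.
  apply/setP => f; set l := flatten _.
  have : f \in l by apply/flatten_mapP; exists f.1; rewrite ?mem_enum //;
    apply/mapP; exists f.2; rewrite ?mem_enum // -surjective_pairing.
  elim/last_ind: l => // l x IH; rewrite mem_rcons inE foldl_rcons /h.
  have [-> _|fx /= /IH <-] := eqVneq f x; first by case: ifP; rewrite !inE eqxx.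
  by case: ifP; rewrite !inE (negbTE fx).
rewrite [in RHS]foldl_map; apply: foldl_set_gr => {}M y; lazy beta.
rewrite upd_same upd_lt // upd_same gr_set gr_set_neq // /h.
by case: ifP; rewrite set_gr_set.
Qed.

(** * Transitive closure *)

Definition closure n (M : digraph n) : digraph n := [set e | reachable M e.1 e.2].

Definition grow n (M T : digraph n) (e : 'I_n * 'I_n * 'I_n) : digraph n :=
  if ((e.1.1, e.1.2) \in T) && ((e.1.2, e.2) \in M) then (e.1.1, e.2) |: T else T.

Definition triples n := [seq (xy, z) | xy <- [seq (x, y) | x <- enum 'I_n, y <- enum 'I_n], z <- enum 'I_n].

Lemma mem_triples n e : e \in triples n.
Proof.
case: e => [[x y] z]; apply/allpairsP; exists ((x, y), z); rewrite mem_enum; split=> //.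
by apply/allpairsP; exists (x, y); rewrite !mem_enum.
Qed.

(** Each round extends every walk found so far by at least one arc. A simple path has fewer than [n]
    arcs, so [n] rounds are enough. *)
Lemma grow_closure n (M : digraph n) :
  foldl (fun T (_ : 'I_n) => foldl (grow M) T (triples n)) (M :|: [set (x, x) | x : 'I_n]) (enum 'I_n)
  = closure M.
Proof.
have up l : forall T : digraph n, T \subset foldl (grow M) T l.
  elim: l => //= e l IH T; apply: subset_trans (IH _); rewrite /grow; case: ifP => // _.
  exact: subsetUr.
have sound l : forall T : digraph n, T \subset closure M -> foldl (grow M) T l \subset closure M.
  elim: l => //= e l IH T sT; apply: IH; rewrite /grow; case: ifP => // /andP[/(subsetP sT) xy yz].
  rewrite subUset sT sub1set andbT !inE /= in xy *.
  by apply: reach_trans xy _; apply: reach1.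
have step l (T : digraph n) x y z : (x, y) \in T -> (y, z) \in M -> (x, y, z) \in l -> (x, z) \in foldl (grow M) T l.
  move=> + yz; elim: l T => //= e l IH T xy; rewrite inE => /orP[/eqP<-|el].
    by apply: (subsetP (up l _)); rewrite /grow /= xy yz !inE eqxx.
  by apply: IH => //; rewrite /grow; case: ifP => // _; rewrite inE xy orbT.
set T0 := _ :|: _; apply/eqP; rewrite eqEsubset; apply/andP; split.
  have : T0 \subset closure M.
    apply/subsetP => -[x y]; rewrite !inE => /orP[xy|/imsetP[z _ [-> ->]]]; last exact: reach0.
    exact: reach1.
  by elim: (enum 'I_n) T0 => //= _ l IH T sT; apply/IH/sound.
have long (l : seq 'I_n) x p : path (has_arc M) x p -> size p <= size l ->
    (x, last x p) \in foldl (fun T (_ : 'I_n) => foldl (grow M) T (triples n)) T0 l.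
  elim/last_ind: l p => [|l i IH] p; first by case: p => // _ _; rewrite !inE imset_f ?orbT.
  rewrite foldl_rcons size_rcons; case/lastP: p => [|p y] pp; rewrite ?size_rcons ?ltnS => sp.
    by apply: (subsetP (up _ _)); apply: (IH [::]).
  move: pp; rewrite rcons_path last_rcons => /andP[pp py].
  by apply: (step _ _ _ (last x p)); rewrite ?mem_triples ?IH.
apply/subsetP => -[x y]; rewrite inE => /connectP[p pp /= ->].
case/shortenP: pp => p' pp' up' _; apply: long => //.
rewrite size_enum_ord; apply: leq_trans (_ : size (x :: p') <= _) => //.
by rewrite -(card_uniqP up') -[X in _ <= X]card_ord max_card.
Qed.

Definition close d k k' := Seq (copy d k k') (Seq (for_node d (put k' d d true))
  (for_node d (for_node d.+1 (for_node d.+2 (for_node d.+3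
    (if_arc k' d.+1 d.+2 (if_arc k d.+2 d.+3 (put k' d.+1 d.+3 true) skip) skip)))))).

Lemma impl_close L d k k' : k \in L -> k' \in L -> k != k' ->
  impl L d (close d k k') (fun n e g => set_gr g k' (closure (gr g k))).
Proof.
move=> kL k'L kk; apply: impl_ext; last first.
  apply: impl_seq (impl_copy _ kL k'L kk) _; apply: impl_seq.
    by apply: impl_for_node; apply: impl_put.
  do 4 apply: impl_for_node; apply: impl_if_arc; [done | lia | lia | | exact: impl_skip].
  by apply: impl_if_arc; [done | lia | lia | apply: impl_put => //; lia | exact: impl_skip].
move=> n e g; lazy beta; set M := gr g k; rewrite -grow_closure.
rewrite (@foldl_set_gr _ _ g k' (fun M x => (x, x) |: M)) => [|T x]; last first.
  by rewrite upd_same gr_set set_gr_set.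
set T0 := foldl _ M _; have -> : M :|: [set (x, x) | x : 'I_n] = T0.
  apply/setP => f; rewrite /T0 !inE.
  transitivity ((f \in M) || has (fun x => f == (x, x)) (enum 'I_n)).
    congr orb; apply/imsetP/hasP => [[x _ ->]|[x _ /eqP->]]; exists x; rewrite ?mem_enum //.
  elim/last_ind: (enum 'I_n) => [|l x IH]; first by rewrite orbF.
  by rewrite foldl_rcons has_rcons !inE -IH orbCA.
apply: foldl_set_gr => {T0}T r; rewrite /triples foldl_flatten [in RHS]foldl_map foldl_flatten [in RHS]foldl_map.
apply: foldl_set_gr => {}T x; rewrite [in RHS]foldl_map.
apply: foldl_set_gr => {}T y; rewrite [in RHS]foldl_map.
apply: foldl_set_gr => {}T z; lazy beta.
have ne : ((d.+1 == d.+3) = false) * ((d.+1 == d.+2) = false) * ((d.+2 == d.+3) = false).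
  by do !split; lia.
rewrite /upd !ne !eqxx /grow.
rewrite gr_set gr_set_neq // set_gr_set.
by case: (_ \in T) => //=; case: ifP.
Qed.

Lemma impl_cnt_zero L d : impl L d (Const rD 0) (fun n e g => set_cnt g 0).
Proof.
exists 1, 0 => n C e g m CL s; exists 1, (set_reg m rD 0); split => //; first exact: RunConst.
exact: sim_set_cnt.
Qed.

(** Graph 0 is the input, 1 the preserver, 2 the candidate being pruned; 3 and 4
    hold the reachability relations of 2 and 0. *)
Definition stage n (G H M : digraph n) c := Store (fun k =>
  match k with 0 => G | 1 => H | 2 => M | 3 => closure M | _ => closure G end) c.

Lemma set_st1 n (G H M : digraph n) c H' : set_gr (stage G H M c) 1 H' = stage G H' M c.
Proof. by congr Store; apply: functional_extensionality => -[|[|]]. Qed.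

Lemma set_st23 n (G H M : digraph n) c M' :
  set_gr (set_gr (stage G H M c) 2 M') 3 (closure M') = stage G H M' c.
Proof. by congr Store; apply: functional_extensionality => -[|[|[|[|]]]]. Qed.

Lemma set_st_cnt n (G H M : digraph n) c c' : set_cnt (stage G H M c) c' = stage G H M c'.
Proof. by []. Qed.

Lemma set_st3 n (G H M : digraph n) c : set_gr (stage G H M c) 3 (closure M) = stage G H M c.
Proof. by congr Store; apply: functional_extensionality => -[|[|[|[|]]]]. Qed.

Local Notation arrays := [:: 0; 1; 2; 3; 4] (only parsing).

(** The arc is deleted tentatively, the closure recomputed, and the arc put back if [t] got lost.
    The last [close] makes array 3 match array 2 again. *)
Definition prune := Seq
  (if_arc 1 3 4 skip (if_arc 2 3 4
    (Seq (put 2 3 4 false) (Seq (close 5 2 3) (if_arc 3 0 1 skip (put 2 3 4 true)))) skip))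
  (close 5 2 3).

Lemma impl_prune : exists2 f, impl arrays 5 prune f & forall n e (G H M : digraph n) c,
  f n e (stage G H M c) = stage G H (del H (e 0) (e 1) M (e 3, e 4)) c.
Proof.
eexists.
  apply: impl_seq; last by apply: impl_close.
  apply: impl_if_arc => //; first exact: impl_skip.
  apply: impl_if_arc => //; last exact: impl_skip.
  apply: impl_seq; first by apply: impl_put.
  apply: impl_seq; first by apply: impl_close.
  by apply: impl_if_arc => //; [exact: impl_skip | exact: impl_put].
move=> n e G H M c; lazy beta; set x := (e 3, e 4).
rewrite [gr (stage _ _ _ _) 1]/= [gr (stage _ _ _ _) 2]/= /del -/x.
case: (x \in H); first exact: set_st3.
rewrite [~~ false && _]/=; case: (boolP (x \in M)) => xM; last first.
  have -> : M :\ x = M by apply/setP => y; rewrite !inE; case: eqP => // ->; rewrite (negbTE xM).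
  by rewrite if_same set_st3.
rewrite !gr_set set_st23 inE [(_, _).1]/= [(_, _).2]/=.
case: (reachable _ _ _); first exact: set_st3.
by rewrite setD1K // set_st23.
Qed.

(** The counter starts at the outer loop variable and adds the descendants of the inner one, which
    is the test of [del_order]. The end restores the candidate to [G] for the next demand. *)
Definition serve_prog := Seq
  (if_arc 4 0 1
    (Seq (for_node 2 (for_node 3 (Seq (Seq (Seq (cnt_node 2) (for_node 4 (if_arc 4 3 4 cnt_incr skip)))
      (if_cnt (for_node 4 prune) skip)) (Const rD 0)))) (copy 2 2 1))
    skip)
  (Seq (copy 2 0 2) (close 2 2 3)).

Lemma impl_serve : exists2 f, impl arrays 2 serve_prog f & forall n e (G H : digraph n),
  f n e (stage G H G 0) = stage G (serve G H (e 0) (e 1)) G 0.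
Proof.
have [f fP fE] := impl_prune; eexists.
  apply: impl_seq; last by apply: impl_seq; [exact: impl_copy | exact: impl_close].
  apply: impl_if_arc => //; last exact: impl_skip.
  apply: impl_seq; last by apply: impl_copy.
  apply: impl_for_node; apply: impl_for_node; apply: impl_seq; last exact: impl_cnt_zero.
  apply: impl_seq; first apply: impl_seq.
  - exact: impl_cnt_node.
  - apply: impl_for_node; apply: impl_if_arc => //; [exact: impl_cnt_incr | exact: impl_skip].
  - by apply: impl_if_cnt; [apply: impl_for_node fP | exact: impl_skip].
move=> n e G H; lazy beta; rewrite [gr (stage _ _ _ _) 4]/= inE /serve [(_, _).1]/= [(_, _).2]/=.
case: (reachable G (e 0) (e 1)); last by rewrite set_st23.
set loops := foldl _ (stage G H G 0) _.
suff -> : loops = stage G H (foldl (del H (e 0) (e 1)) G (del_order G)) 0.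
  by rewrite set_st1 [gr _ 0]/= set_st23.
rewrite /loops /del_order foldl_flatten [in RHS]foldl_map.
apply: (foldl_morph (F := fun M => stage G H M 0)) => M i; rewrite foldl_flatten [in RHS]foldl_map.
rewrite foldl_filter.
apply: (foldl_morph (F := fun M => stage G H M 0)) => {}M u; lazy beta.
rewrite set_st_cnt; set c0 := nat_of_ord _.
rewrite (foldl_morph (F := fun c => stage G H M c) (h := fun c v => if (u, v) \in closure G then c.+1 else c)); last first.
  by move=> c v; lazy beta; rewrite [gr _ 4]/= [upd _ _ _ _]/= [upd _ _ _ 4]/=; case: ifP.
have -> : foldl (fun c v => if (u, v) \in closure G then c.+1 else c) c0 (enum 'I_n) = desc G u + i.
  rewrite addnC -[nat_of_ord i]/c0 /desc cardE.
  rewrite (_ : enum [set w | reachable G u w] = [seq v <- enum 'I_n | (u, v) \in closure G]); last first.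
    by rewrite {1}/enum_mem -enumT; apply: eq_filter => v; rewrite !inE.
  elim: (enum 'I_n) c0 => [|v l IH] c0 /=; first by rewrite addn0.
  by rewrite IH; case: ifP => //= _; rewrite addnS addSn.
rewrite [cnt _]/=; case: ifP => _; last by rewrite set_st_cnt.
rewrite [in RHS]foldl_map (foldl_morph (F := fun M => stage G H M (desc G u + i)) (h := fun M v => del H (e 0) (e 1) M (u, v))); last first.
  by move=> M' v; rewrite fE.
by rewrite set_st_cnt.
Qed.

Definition serve_mutual := for_node 0 (for_node 1
  (if_arc 4 0 1 (if_arc 4 1 0 serve_prog skip) skip)).

Lemma impl_serve_mutual : exists2 f, impl arrays 0 serve_mutual f & forall n e (G H : digraph n),
  f n e (stage G H G 0) = stage G (run G H (scc_pairs G)) G 0.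
Proof.
have [f fP fE] := impl_serve; eexists.
  apply: impl_for_node; apply: impl_for_node; apply: impl_if_arc => //; last exact: impl_skip.
  by apply: impl_if_arc => //; [exact: fP | exact: impl_skip].
move=> n e G H; lazy beta; rewrite /run /scc_pairs foldl_flatten [in RHS]foldl_map.
apply: (foldl_morph (F := fun H => stage G H G 0)) => {}H u; rewrite [in RHS]foldl_map foldl_filter.
apply: (foldl_morph (F := fun H => stage G H G 0)) => {}H v; lazy beta.
rewrite fE /= !inE /= /mutual /upd /=.
by case: (reachable G u v) => //=; case: ifP.
Qed.

Lemma leq_expl a b k : a <= b -> a ^ k <= b ^ k.
Proof. by case: k => // k ab; rewrite leq_exp2r. Qed.

Lemma sim_eq n C d e (g g' : store n) m : (forall k, k \in live C -> gr g k = gr g' k) ->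
  cnt g = cnt g' -> sim C d e g m -> sim C d e g' m.
Proof. by move=> gg cc [h1 h2 h3 h4 h5 h6 h7 h8]; split => //; rewrite -?cc // => *; rewrite h7 ?gg. Qed.

Lemma nth_flatten_blocks (T : Type) (x : T) b ss i j : all (fun s => size s == b) ss ->
  j < b -> nth x (flatten ss) (i * b + j) = nth x (nth [::] ss i) j.
Proof.
elim: ss i => [|s ss IH] i /=; first by rewrite !nth_nil.
move=> /andP[/eqP sb all] jb; rewrite nth_cat sb; case: i => [|i] /=; first by rewrite add0n jb.
by rewrite mulSn -addnA ltnNge leq_addr /= addKn IH.
Qed.

Lemma size_flatten_blocks (T : Type) b (ss : seq (seq T)) : all (fun s => size s == b) ss ->
  size (flatten ss) = size ss * b.
Proof. by elim: ss => //= s ss IH /andP[/eqP sb /IH e]; rewrite size_cat sb e. Qed.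

(** * Memory layout and the whole program *)

Section Encoding.
Variables (n : nat) (G : digraph n) (q : seq ('I_n * 'I_n)).

Lemma graph_blocks : all (fun s => size s == n)
  [seq [seq nat_of_bool (has_arc G u v) | v <- enum 'I_n] | u <- enum 'I_n].
Proof. by apply/allP => _ /mapP[u _ ->]; rewrite size_map size_enum_ord. Qed.

Lemma size_encode_graph : size (encode_graph G) = n * n.
Proof. by rewrite (size_flatten_blocks graph_blocks) size_map size_enum_ord. Qed.

Lemma size_encode_demands : size (encode_demands q) = 2 * size q.
Proof. by rewrite (@size_flatten_blocks _ 2) ?size_map 1?mulnC //; apply/allP => _ /mapP[u _ ->]. Qed.

Lemma nth_encode_graph (u v : 'I_n) : nth 0 (encode_graph G) (u * n + v) = ((u, v) \in G).
Proof.
rewrite (nth_flatten_blocks _ _ graph_blocks) // (nth_map u) ?size_enum_ord //.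
by rewrite (nth_map v) ?size_enum_ord // !nth_ord_enum.
Qed.

Lemma nth_input_graph a : a < n * n -> nth 0 (encode_input G q) (2 + a) = nth 0 (encode_graph G) a.
Proof. by move=> a_n; rewrite /= nth_cat size_encode_graph a_n. Qed.

Lemma nth_input_demands a : nth 0 (encode_input G q) (2 + n * n + a) = nth 0 (encode_demands q) a.
Proof. by rewrite -addnA [LHS]/= nth_cat size_encode_graph add0n ltnNge leq_addr addKn. Qed.

Lemma nth_input_default a : 2 + n * n + 2 * size q <= a -> nth 0 (encode_input G q) a = 0.
Proof.
move=> le; rewrite nth_default //= size_cat size_encode_graph size_encode_demands; lia.
Qed.
End Encoding.

(** [rD] is still zero, so [rT] receives [n]. The loop moves [rJ] to [2 + n * n], where the demands
    begin, and [rF] then holds [n * n], the distance between consecutive arrays. *)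
Definition init := Seq (Const rA 1) (Seq (Read rP rA) (Seq (Const (rB 0) 2) (Seq (Const rJ 2)
  (Seq (Add rT rN rD) (Seq (While rT (Seq (Add rJ rJ rN) (Seq (Const rF 1) (Sub rT rT rF))))
  (Seq (Sub rF rJ (rB 0)) (Seq (Add (rB 1) rJ rP) (Seq (Add (rB 1) (rB 1) rP)
  (Seq (Add (rB 2) (rB 1) rF) (Seq (Add (rB 3) (rB 2) rF) (Add (rB 4) (rB 3) rF))))))))))).

(** Array 0 is the adjacency matrix in the input; the others lie beyond the
    demands. *)
Definition layout n p k := 2 + k * (n * n) + (0 < k) * (2 * p).

Definition context n p w j := Ctx arrays (layout n p) (nth 0 w) j.

Lemma runs_init n (e : nat -> 'I_n) (G : digraph n) (q : seq ('I_n * 'I_n)) :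
  let w := encode_input G q in
  exists t m, [/\ runs init (set_reg (initial_state w) rN n) t m, t <= 16 * n.+1,
    sim (context n (size q) w (2 + n * n)) 0 e (Store (fun k => if k is 0 then G else set0) 0) m
    & regs m rP = size q].
Proof.
move=> w; pose W := While rT (Seq (Add rJ rJ rN) (Seq (Const rF 1) (Sub rT rT rF))).
have loop i : forall m, regs m rT = i -> exists m', [/\ runs W m (4 * i).+1 m', mem m' = mem m,
    regs m' rJ = regs m rJ + regs m rN * i &
    forall x, x \notin [:: rJ; rT; rF] -> regs m' x = regs m x].
  elim: i => [|i IH] m eT; first by exists m; split => //; [apply: RunWhileFalse; rewrite eT | rewrite muln0 addn0].
  pose m1 := set_reg m rJ (regs m rJ + regs m rN); pose m2 := set_reg m1 rF 1.
  pose m3 := set_reg m2 rT (regs m2 rT - regs m2 rF).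
  have [|m' [r' mem' J' other]] := IH m3; first by rewrite /m3 /= /update /= eT subn1.
  exists m'; split => //.
  - have -> : (4 * i.+1).+1 = ((1 + (1 + 1)) + (4 * i).+1).+1 by lia.
    apply: RunWhileTrue r'; first by rewrite eT.
    apply: RunSeq (RunAdd _ _ _ _) _; apply: RunSeq (RunConst _ _ _) _; exact: RunSub.
  - by rewrite J' /= /update /= mulnS addnA.
  - move=> x xs; rewrite other //= /update; move: xs; rewrite !inE !negb_or => /and3P[].
    by do 3 move=> /negbTE->.
pose m0 := set_reg (initial_state w) rN n.
pose m1 := set_reg m0 rA 1; pose m2 := set_reg m1 rP (mem m1 (regs m1 rA)).
pose m3 := set_reg m2 (rB 0) 2; pose m4 := set_reg m3 rJ 2.
pose m5 := set_reg m4 rT (regs m4 rN + regs m4 rD).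
have [|m6 [r6 mem6 J6 other]] := loop n m5; first by rewrite /m5 /= /update /= addn0.
pose m7 := set_reg m6 rF (regs m6 rJ - regs m6 (rB 0)).
pose m8 := set_reg m7 (rB 1) (regs m7 rJ + regs m7 rP).
pose m9 := set_reg m8 (rB 1) (regs m8 (rB 1) + regs m8 rP).
pose m10 := set_reg m9 (rB 2) (regs m9 (rB 1) + regs m9 rF).
pose m11 := set_reg m10 (rB 3) (regs m10 (rB 2) + regs m10 rF).
pose m12 := set_reg m11 (rB 4) (regs m11 (rB 3) + regs m11 rF).
have eJ : regs m6 rJ = 2 + n * n by rewrite J6.
have eN : regs m6 rN = n by rewrite other.
have eP : regs m6 rP = size q by rewrite other.
have eD : regs m6 rD = 0 by rewrite other.
have eB : regs m6 (rB 0) = 2 by rewrite other.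
exists (1 + (1 + (1 + (1 + (1 + ((4 * n).+1 + (1 + (1 + (1 + (1 + (1 + 1))))))))))), m12; split => //; last first.
- split => //=; rewrite ?mem6 /=.
  + move=> k; rewrite !inE /layout => /or4P[/eqP->|/eqP->|/eqP->|/orP[]/eqP->];
      rewrite /= /update /= ?eJ ?eP ?eB; lia.
  + move=> k k' _ _ kk; rewrite /layout; case: (ltngtP k k') kk => // kk _; [left|right].
      by have := leq_mul kk (leqnn (n * n)); rewrite mulSn; move: (k * _) (k' * _) => a b; lia.
    by have := leq_mul kk (leqnn (n * n)); rewrite mulSn; move: (k * _) (k' * _) => a b; lia.
  + move=> k u v _.
    rewrite -[nth _ _ _]/(nth 0 (encode_input G q) (layout n (size q) k + (u * n + v))).
    case: k => [|k].
      by rewrite [layout _ _ _](addn0 2) nth_input_graph ?cell_lt // nth_encode_graph; case: (_ \in _).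
    rewrite /layout nth_input_default ?inE // (mulSn k); move: (k * _) (u * n + v) => a b; lia.
  + by [].
- lia.
- do 5 (apply: RunSeq; first by constructor).
  apply: RunSeq r6 _; do 5 (apply: RunSeq; first by constructor).
  by constructor.
Qed.

(** Array 1 starts right behind the demands, so [rB 1 - rJ] is the number of demand cells still
    unread. *)
Definition serve_remaining := While rT
  (Seq (Read (node 0) rJ) (Seq (Const rF 1) (Seq (Add rJ rJ rF)
  (Seq (Read (node 1) rJ) (Seq (Const rF 1) (Seq (Add rJ rJ rF)
  (Seq serve_prog (Sub rT (rB 1) rJ)))))))).

Definition serve_all := Seq (Sub rT (rB 1) rJ) serve_remaining.

Lemma sim_ptr_incr n C d e (g : store n) m j : sim C d e g m ->
  sim (Ctx (live C) (base C) (frame C) j) d e g (set_reg m rJ j).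
Proof.
move=> [h1 h2 h3 h4 h5 h6 h7 h8]; split => //= [k kL|i id]; rewrite /update.
- by case: eqP => [|_]; [lia | apply: h4].
- by case: eqP => [|_]; [lia | apply: h5].
Qed.

Lemma runs_serve_all : exists c k, forall n e (G H : digraph n) (q : seq ('I_n * 'I_n)) m,
  let w := encode_input G q in
  sim (context n (size q) w (2 + n * n)) 0 e (stage G H G 0) m -> exists t m' j,
  [/\ runs serve_all m t m', t <= c * (n + size q).+1 ^ k
    & sim (context n (size q) w j) 0 e (stage G (run G H q) G 0) m'].
Proof.
have [f [c [k h]] fE] := impl_serve; exists (c + 10), k.+1 => n e G H q m w s.
have loop l : forall j H m, j + 2 * size l = layout n (size q) 1 -> 2 + n * n <= j ->
    (forall a, nth 0 w (j + a) = nth 0 (encode_demands l) a) ->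
    regs m rT = 2 * size l -> sim (context n (size q) w j) 0 e (stage G H G 0) m ->
    exists t m' j', [/\ runs serve_remaining m t m', t <= size l * (c * n.+1 ^ k + 8) + 1
      & sim (context n (size q) w j') 0 e (stage G (run G H l) G 0) m'].
  elim: l => [|d l IH] j {}H {}m jl jn dem eT {}s.
    by exists 1, m, j; split => //; apply: RunWhileFalse; rewrite eT.
  have read i m' : i < 2 -> sim (context n (size q) w (j + i)) 0 e (stage G H G 0) m' ->
      mem m' (regs m' rJ) = nth 0 (encode_demands (d :: l)) i.
    move=> i2 s'; rewrite (sim_ptr s') (sim_frame s') -?dem // => k'.
    rewrite /context /= !inE => k'L; move: jl; rewrite /layout mul1n /=.
    case: k' k'L => [_|k' _] //=; rewrite ?mulSn; [lia | move: (k' * _) => a; lia].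
  pose m1 := set_reg m (node 0) (mem m (regs m rJ)).
  have s1 : sim (context n (size q) w (j + 0)) 0 e (stage G H G 0) m1.
    by rewrite addn0; apply: sim_set_node.
  have v1 : regs m1 (node 0) = d.1.
    have -> : regs m1 (node 0) = mem m (regs m rJ) by [].
    by rewrite (read 0) // addn0.
  pose m2 := set_reg m1 rF 1; pose m3 := set_reg m2 rJ (regs m2 rJ + regs m2 rF).
  have s3 : sim (context n (size q) w (j + 1)) 1 (upd e 0 d.1) (stage G H G 0) m3.
    have -> : m3 = set_reg m2 rJ (j + 1) by rewrite -{1}(addn0 j) -[j + 0](sim_ptr s1).
    apply: (@sim_ptr_incr _ (context n (size q) w (j + 0))); apply: sim_scratch => //.
    exact: sim_bind.
  have s3' : sim (context n (size q) w (j + 1)) 0 e (stage G H G 0) m3 by apply: sim_weaken s3.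
  pose m4 := set_reg m3 (node 1) (mem m3 (regs m3 rJ)).
  have v4 : regs m4 (node 1) = d.2.
    by have -> : regs m4 (node 1) = mem m3 (regs m3 rJ) by []; rewrite (read 1).
  pose m5 := set_reg m4 rF 1; pose m6 := set_reg m5 rJ (regs m5 rJ + regs m5 rF).
  have s6 : sim (context n (size q) w (j + 2)) 2 (upd (upd e 0 d.1) 1 d.2) (stage G H G 0) m6.
    have -> : m6 = set_reg m5 rJ (j + 2) by rewrite (addnA j 1 1 : j + 2 = _) -[j + 1](sim_ptr s3).
    apply: (@sim_ptr_incr _ (context n (size q) w (j + 1))); apply: sim_scratch => //.
    by apply: sim_bind => //; apply: sim_set_node.
  have [t7 [m7 [r7 b7 s7]]] := h _ (context n (size q) w (j + 2)) _ _ _ erefl s6; rewrite fE /= in s7.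
  pose m8 := set_reg m7 rT (regs m7 (rB 1) - regs m7 rJ).
  have s8 : sim (context n (size q) w (j + 2)) 0 e (stage G (serve G H d.1 d.2) G 0) m8.
    apply: sim_scratch => //; apply: (@sim_weaken _ _ 0 e (upd e 0 d.1)) => //.
    by apply: sim_weaken s7 => -[|].
  have [||||t [m' [j' [r' b' s']]]] := IH (j + 2) _ m8 _ _ _ _ s8.
  - by move: jl => /=; lia.
  - by lia.
  - by move=> a; rewrite -addnA dem.
  - have -> : regs m8 rT = regs m7 (rB 1) - regs m7 rJ by [].
    by rewrite (sim_ptr s7) (sim_base s7) //= -jl /=; lia.
  exists ((1 + (1 + (1 + (1 + (1 + (1 + (t7 + 1))))))) + t).+1, m', j'; split => //.
    apply: RunWhileTrue r'; first by rewrite eT.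
    do 6 (apply: RunSeq; first by constructor).
    by apply: RunSeq r7 _; constructor.
  by move: b' b7; rewrite /= mulSn; move: (c * n.+1 ^ k) => a; move: (size l * (a + 8)) => b; lia.
pose m1 := set_reg m rT (regs m (rB 1) - regs m rJ).
have s1 : sim (context n (size q) w (2 + n * n)) 0 e (stage G H G 0) m1 by apply: sim_scratch.
have [||||t [m' [j' [r' b' s']]]] := loop q (2 + n * n) H m1 _ _ _ _ s1.
- by rewrite /layout !mul1n.
- by [].
- exact: nth_input_demands.
- have -> : regs m1 rT = regs m (rB 1) - regs m rJ by [].
  by rewrite (sim_ptr s) (sim_base s) //= /layout; lia.
exists (1 + t), m', j'; split => //; first by apply: RunSeq r'; constructor.
have le : c * n.+1 ^ k <= c * (n + size q).+1 ^ k by rewrite leq_mul2l leq_expl ?orbT //; lia.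
have := @poly_mul (n + size q).+1 (size q) c k 10.
have lt : size q < (n + size q).+1 by lia.
move=> /(_ lt); apply: leq_trans; rewrite add1n.
by apply: leq_ltn_trans b' _; rewrite -addnS leq_add // leq_mul // leq_add.
Qed.

(** Array 5 is the output area, which overlaps the input. *)
Definition output_prog := copy 0 1 5.

(** [rA] is zero at the start, so the first instruction loads [n]. Without demands array 1 is still
    empty, as [alg] wants it. *)
Definition main_prog := Seq (Read rN rA) (If rN (Seq init (Seq
  (If rP (Seq (Seq (close 0 0 4) (Seq (copy 0 0 2) (close 0 2 3))) (Seq serve_mutual serve_all)) skip)
  (Seq (Const (rB 5) 0) output_prog))) skip).

Lemma runs_output : exists c k, forall n e (g : store n) p w j m,
  sim (context n p w j) 0 e g m -> exists t m',
  [/\ runs (Seq (Const (rB 5) 0) output_prog) m t m', t <= c * n.+1 ^ k & outputs m' (gr g 1)].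
Proof.
have [] := @impl_copy [:: 1; 5] 0 1 5 _ _ _ => // c [k h].
exists c.+1, k => n e g p w j m s; pose m1 := set_reg m (rB 5) 0.
pose b i := if i == 1 then layout n p 1 else 0.
(* Whatever the output cells contain is read as a graph, so that array 5 satisfies [sim] before it
   is overwritten. *)
pose g5 := Store (fun i => if i == 1 then gr g 1
  else [set x : 'I_n * 'I_n | mem m (x.1 * n + x.2) != 0]) (cnt g).
have s1 : sim (Ctx [:: 1; 5] b (mem m) j) 0 e g5 m1.
  case: s => h1 h2 h3 h4 h5 h6 h7 h8; split => //=.
  - by move=> i; rewrite !inE => /orP[] /eqP->; rewrite /update /= ?(h4 1).
  - move=> i i'; rewrite !inE /b /layout => /orP[] /eqP-> /orP[] /eqP-> //= _; lia.
  - move=> i u v; rewrite !inE => /orP[] /eqP-> /=; first by rewrite h7.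
    by rewrite inE add0n.
have [t [m' [r tb s']]] := h _ (Ctx [:: 1; 5] b (mem m) j) _ _ _ erefl s1.
exists (1 + t), m'; split; first by apply: RunSeq r; constructor.
  by rewrite mulSn leq_add // expn_gt0.
by move=> u v; have := sim_gr (k := 5) s' u v isT; rewrite add0n /has_arc => ->.
Qed.

Lemma algE n (G : digraph n) q : q != [::] -> alg G q = run G (start G) q.
Proof. by case: q. Qed.

Lemma alg_polynomial : polynomial_time alg.
Proof.
have [f [c0 [k0 h0]] fE] := impl_serve_mutual.
have := impl_seq (@impl_close arrays 0 0 4 isT isT isT) (impl_seq (@impl_copy arrays 0 0 2 isT isT isT)
  (@impl_close arrays 0 2 3 isT isT isT)).
case=> c1 [k1 h1]; have [c2 [k2 h2]] := runs_serve_all; have [c3 [k3 h3]] := runs_output.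
exists main_prog, (16 + c0 + c1 + c2 + c3 + 4), (1 + k0 + k1 + k2 + k3) => n G q.
set w := encode_input G q; set B := (n + size q).+1.
have B0 : 0 < B by [].
case: n G q @w @B B0 => [|n] G q w B B0.
  exists (1 + 1.+1), (set_reg (set_reg (initial_state w) rN 0) rF 0); split; last by case.
    apply: RunSeq; first by constructor.
    by apply: RunIfFalse => //; constructor.
  by rewrite -[1 + 2]muln1 leq_mul ?expn_gt0 //; lia.
pose e : nat -> 'I_n.+1 := fun=> ord0.
have [t0 [m0 [r0 b0 s0 eP]]] := runs_init e G q.
have [t1 [m1 [g [j [r1 b1 s1 g1]]]]] : exists t m g j,
  [/\ runs (If rP (Seq (Seq (close 0 0 4) (Seq (copy 0 0 2) (close 0 2 3)))
        (Seq serve_mutual serve_all)) skip) m0 t m, t <= c0 * n.+2 ^ k0 + c1 * n.+2 ^ k1 + c2 * B ^ k2 + 2,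
      sim (context n.+1 (size q) w j) 0 e g m & gr g 1 = alg G q].
  case: (posnP (size q)) => q0.
    exists (1.+1), (set_reg m0 rF 0), (Store (fun k => if k is 0 then G else set0) 0), (2 + n.+1 * n.+1).
    split; [by apply: RunIfFalse; [rewrite eP q0|constructor] | lia | exact: sim_scratch|].
    by rewrite (size0nil q0).
  have [t [m [r b s]]] := h1 _ (context n.+1 (size q) w (2 + n.+1 * n.+1)) _ _ _ erefl s0.
  have {}s : sim (context n.+1 (size q) w (2 + n.+1 * n.+1)) 0 e (stage G set0 G 0) m.
    by apply: sim_eq s => // k; rewrite !inE => /or4P[/eqP->|/eqP->|/eqP->|/orP[]/eqP->].
  have [t' [m' [r' b' s']]] := h0 _ (context n.+1 (size q) w (2 + n.+1 * n.+1)) _ _ _ erefl s.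
  rewrite fE in s'; have [t'' [m'' [j [r'' b'' s'']]]] := h2 _ _ _ _ _ _ s'.
  exists (t + (t' + t'')).+1, m'', (stage G (run G (start G) q) G 0), j; split => //.
  - by apply: RunIfTrue; [rewrite eP; case: (size q) q0 | apply: RunSeq r (RunSeq r' r'')].
  - by move: b b' b''; rewrite -/B; lia.
  - by rewrite /= algE // -size_eq0 -lt0n.
have [t2 [m2 [r2 b2 o2]]] := h3 _ _ _ _ _ _ _ s1.
exists (1 + (t0 + (t1 + t2)).+1), m2; split; last by rewrite -g1.
  apply: RunSeq; first by constructor.
  by apply: RunIfTrue => //; apply: RunSeq r0 _; apply: RunSeq r1 r2.
set K := 1 + k0 + k1 + k2 + k3; have nB : n.+2 <= B by rewrite /B; lia.
have pow c a k : a <= B -> k <= K -> c * a ^ k <= c * B ^ K.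
  by move=> aB kK; rewrite leq_mul2l (leq_trans (leq_expl k aB)) ?orbT // leq_pexp2l.
have p0 : c0 * n.+2 ^ k0 <= c0 * B ^ K by apply: pow => //; rewrite /K; lia.
have p1 : c1 * n.+2 ^ k1 <= c1 * B ^ K by apply: pow => //; rewrite /K; lia.
have p2 : c2 * B ^ k2 <= c2 * B ^ K by apply: pow => //; rewrite /K; lia.
have p3 : c3 * n.+2 ^ k3 <= c3 * B ^ K by apply: pow => //; rewrite /K; lia.
have p4 : 16 * n.+2 ^ 1 <= 16 * B ^ K by apply: pow => //; rewrite /K; lia.
have p5 : 4 * B ^ 0 <= 4 * B ^ K by apply: pow.
by rewrite !mulnDl; move: b0 b1 b2 p4 p5; rewrite expn1 expn0; clear -p0 p1 p2 p3; lia.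
Qed.

From mathcomp Require Import all_order all_algebra.
From mathcomp Require Import all_classical all_reals all_analysis.
From mathcomp Require Import ring lra.
Import Order.TTheory GRing.Theory Num.Theory.
Import numFieldNormedType.Exports.
Local Open Scope classical_set_scope.
Local Open Scope ring_scope.

(** * The exponents *)

Section Exponents.
Variable R : realType.
Implicit Types a b x d N P T K : R.

Lemma powR_addE a x y : 0 < a -> a `^ (x + y) = a `^ x * a `^ y.
Proof. by move=> a0; rewrite powRD // (gt_eqF a0) implybT. Qed.

Lemma powR_sqr a d : 0 < a -> (a ^+ 2) `^ d = a `^ (2 * d).
Proof. by move=> a0; rewrite powRrM powR_mulrn // ltW. Qed.

Lemma le_powR a b d : 0 < a -> a <= b -> 0 <= d -> a `^ d <= b `^ d.
Proof. by move=> a0 ab d0; rewrite ge0_ler_powR ?nnegrE ?(ltW a0) // ltW // (lt_le_trans a0). Qed.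

Lemma root_le T K N P k i j : 0 <= T -> 1 <= K -> 0 <= N -> 0 <= P -> (0 < k)%N ->
  T ^+ k <= K * (N ^+ i * P ^+ j) ->
  T <= K * (N `^ (i%:R / k%:R) * P `^ (j%:R / k%:R)).
Proof.
move=> T0 K1 N0 P0 k0 le; have K0 : 0 <= K by apply: le_trans K1.
have kR : (k%:R : R) != 0 by rewrite pnatr_eq0 -lt0n.
rewrite -(ler_pXn2r k0) ?nnegrE //; last by rewrite !mulr_ge0 ?powR_ge0.
apply: le_trans le _; rewrite !exprMn -!powR_mulrn ?powR_ge0 // -!powRrM !divfK //.
rewrite ler_wpM2r ?mulr_ge0 ?powR_ge0 //.
by rewrite powR_mulrn // ler_eXnr.
Qed.

Lemma dense_bound N P x : 1 <= N -> 0 < P -> P <= N ^+ 2 -> 0 <= x -> x <= 33 / 47 ->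
  N `^ (28 / 47) * P `^ (33 / 47) <= N `^ (2 - 2 * x) * P `^ x.
Proof.
move=> N1 P0 PN x0 x1; have N0 : 0 < N by lra.
have -> : (33 / 47 : R) = x + (33 / 47 - x) by ring.
rewrite powR_addE // mulrCA mulrC ler_wpM2r ?powR_ge0 //.
have -> : 2 - 2 * x = 28 / 47 + 2 * (33 / 47 - x) :> R by field.
rewrite (powR_addE (28 / 47)) // ler_wpM2l ?powR_ge0 // -powR_sqr // le_powR //; lra.
Qed.

Lemma many_pairs_bound N P x : 1 <= N -> 0 < P -> P <= N ^+ 2 -> 0 <= x -> x <= 1 ->
  P <= N `^ (2 - 2 * x) * P `^ x.
Proof.
move=> N1 P0 PN x0 x1; have N0 : 0 < N by lra.
have e : P = P `^ (1 - x) * P `^ x by rewrite -powR_addE // subrK powRr1 // ltW.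
rewrite [X in X <= _]e ler_wpM2r ?powR_ge0 //.
have -> : 2 - 2 * x = 2 * (1 - x) :> R by ring.
rewrite -powR_sqr // le_powR //; lra.
Qed.

(** On the curve [N = P^2] the left side equals [N]. For smaller [P] the summand [N] suffices; for
    larger [P], raising the exponent of [P] by [2 d] and lowering that of [N] by [d] only increases
    the term. *)
Lemma sparse_bound N P b : 1 <= N -> 1 <= P -> 14 / 26 <= b ->
  N `^ (19 / 26) * P `^ (14 / 26) <= N `^ (1 - b / 2) * P `^ b + N.
Proof.
move=> N1 P1 b1; have N0 : 0 < N by lra. have P0 : 0 < P by lra.
have [NP|PN] := leP N (P ^+ 2).
  apply: le_trans (_ : N `^ (1 - b / 2) * P `^ b <= _); last by rewrite lerDl ltW.
  have -> : (19 / 26 : R) = (1 - b / 2) + (b / 2 - 7 / 26) by field.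
  rewrite (powR_addE (1 - b / 2)) // -mulrA ler_wpM2l ?powR_ge0 //.
  have -> : b = 2 * (b / 2 - 7 / 26) + 14 / 26 by field.
  rewrite (powR_addE (2 * _)) // ler_wpM2r ?powR_ge0 // -powR_sqr // (_ : _ / 2 - 7 / 26 = b / 2 - 7 / 26); last by field.
  rewrite le_powR //; lra.
apply: le_trans (_ : N <= _); last by rewrite lerDr mulr_ge0 ?powR_ge0.
have -> : (14 / 26 : R) = 2 * (7 / 26) by field.
have e : N = N `^ (19 / 26) * N `^ (7 / 26).
  by rewrite -powR_addE // (_ : _ + _ = 1) ?powRr1 ?ltW //; field.
rewrite -powR_sqr // [X in _ <= X]e ler_wpM2l ?powR_ge0 // le_powR ?exprn_gt0 //; lra.
Qed.

Lemma saturated_bound N P x : 1 <= N -> N ^+ 2 <= P -> 0 <= x -> N ^+ 2 <= N `^ (2 - 2 * x) * P `^ x.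
Proof.
move=> N1 NP x0; have N0 : 0 < N by lra.
have e : N ^+ 2 = N `^ (2 - 2 * x) * N `^ (2 * x).
  by rewrite -powR_addE // subrK powR_mulrn // ltW.
by rewrite [X in X <= _]e ler_wpM2l ?powR_ge0 // -powR_sqr // le_powR // exprn_gt0.
Qed.

(** [K] is chosen before [b] and [x], and both bounds of the theorem are instances. *)
Lemma alg_bound : exists2 K : R, 0 <= K & forall b x n (G : digraph n) (q : seq ('I_n * 'I_n)),
  14 / 26 <= b -> 0 <= x -> x <= 33 / 47 ->
  #|alg G q|%:R <= K * (n%:R `^ (1 - b / 2) * (size q)%:R `^ b
     + n%:R `^ (2 - 2 * x) * (size q)%:R `^ x + n%:R).
Proof.
have [K K0 tri] := size_trichotomy; exists (K%:R + 2) => [|b x n G q b1 x0 x1].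
  by rewrite addr_ge0.
set A := _ * _ `^ b; set B := _ * _ `^ x; have A0 : 0 <= A by rewrite mulr_ge0 ?powR_ge0.
have B0 : 0 <= B by rewrite mulr_ge0 ?powR_ge0.
have K1 : 1 <= (K%:R : R) by rewrite ler1n.
have rhs0 : 0 <= (K%:R + 2) * (A + B + n%:R) by rewrite mulr_ge0 ?addr_ge0.
have [q0|q0] := eqVneq q [::]; first by rewrite q0 /= cards0.
have n0 : (0 < n)%N by case: n G q {A B A0 B0 rhs0} q0 => // G; case=> // -[[]].
have p0 : (0 < size q)%N by rewrite lt0n size_eq0.
have N1 : 1 <= (n%:R : R) by rewrite ler1n.
have P1 : 1 <= ((size q)%:R : R) by rewrite ler1n.
have [NP|PN] := leP (n%:R ^+ 2 : R) (size q)%:R.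
  have := saturated_bound N1 NP x0; rewrite -/B => le.
  have : (#|alg G q|%:R : R) <= n%:R ^+ 2.
    rewrite -natrX ler_nat; apply: leq_trans (max_card _) _.
    by rewrite card_prod card_ord mulnn.
  nra.
have P0 : 0 < ((size q)%:R : R) by lra.
have size_le := alg_size G q0.
have := tri _ _ (path_system G q); rewrite /= !card_ord.
move: size_le; set T := (\sum_j _)%N => size_le.
have {}size_le : (#|alg G q|%:R : R) <= 2 * n%:R + T%:R by rewrite -natrM -natrD ler_nat.
have T0 : 0 <= (T%:R : R) by [].
case=> [T1|T1|T1].
- have {}T1 : T%:R <= K%:R * (n%:R + (size q)%:R) :> R by rewrite -natrD -natrM ler_nat.
  have : (size q)%:R <= B by apply: many_pairs_bound N1 P0 (ltW PN) x0 _; lra.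
  nra.
- have {}T1 : T%:R ^+ 26 <= K%:R * (n%:R ^+ 19 * (size q)%:R ^+ 14) :> R.
    by rewrite -!natrX -!natrM ler_nat.
  have := root_le T0 K1 _ _ _ T1; rewrite !ler0n => /(_ isT isT isT).
  have := sparse_bound N1 P1 b1; rewrite -/A; nra.
- have {}T1 : T%:R ^+ 47 <= K%:R * (n%:R ^+ 28 * (size q)%:R ^+ 33) :> R.
    by rewrite -!natrX -!natrM ler_nat.
  have := root_le T0 K1 _ _ _ T1; rewrite !ler0n => /(_ isT isT isT).
  have := dense_bound N1 P0 (ltW PN) x0 x1; rewrite -/B; nra.
Qed.
End Exponents.

(** The cubic is negative at [33 / 47], and so is [slope], its divided difference between [33 / 47]
    and [alpha]. A root to the right is therefore impossible. The sign of [slope] follows by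
    bounding the square of [alpha] by its chord on the interval. *)
Lemma root_upper_bound (R : realType) (alpha : R) :
  4 * alpha ^+ 3 - 13 * alpha ^+ 2 + 10 * alpha - 2 = 0 -> 7 / 10 <= alpha <= 1 ->
  alpha <= 33 / 47.
Proof.
move=> root /andP[a1 a2]; rewrite leNgt; apply/negP => lt.
pose slope := 4 * (alpha ^+ 2 + alpha * (33 / 47) + (33 / 47) ^+ 2) - 13 * (alpha + 33 / 47) + 10.
have : (alpha - 7 / 10) * (1 - alpha) >= 0 by rewrite mulr_ge0 ?subr_ge0.
have -> : (alpha - 7 / 10) * (1 - alpha) = 17 / 10 * alpha - 7 / 10 - alpha ^+ 2 by field.
move=> convex; have neg : slope < 0 by rewrite /slope; lra.
have : (alpha - 33 / 47) * slope < 0 by rewrite pmulr_rlt0 // subr_gt0.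
rewrite (_ : _ * _ = 4 * alpha ^+ 3 - 13 * alpha ^+ 2 + 10 * alpha - 2
  - (4 * (33 / 47) ^+ 3 - 13 * (33 / 47) ^+ 2 + 10 * (33 / 47) - 2)); last by rewrite /slope; field.
by rewrite root; lra.
Qed.

Theorem theorem2 (R : realType) (alpha : R)
    (alpha_root : 4 * alpha ^+ 3 - 13 * alpha ^+ 2 + 10 * alpha - 2 = 0)
    (alpha_itv : 7 / 10 <= alpha <= 1) :
  exists A : online_algorithm,
  [/\ online_reachability_preserver A,
      polynomial_time A,
      exists (C : R) (eps1 eps2 : nat -> R),
      [/\ eps1 @ \oo --> (0 : R),
          eps2 @ \oo --> (0 : R)
        & forall (n : nat) (G : digraph n) (q : seq ('I_n * 'I_n)),
          #|A n G q|%:R <=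
          C * (n%:R `^ ((2 + alpha) / (3 + alpha) + eps1 n)
                 * (size q)%:R `^ (2 / (3 + alpha))
               + n%:R `^ (2 - 2 * alpha + eps2 n) * (size q)%:R `^ alpha
               + n%:R)]
    & exists C : R,
      forall (n : nat) (G : digraph n) (q : seq ('I_n * 'I_n)),
      #|A n G q|%:R <=
      C * (n%:R `^ (72 / 100) * (size q)%:R `^ (56 / 100)
           + n%:R `^ (6 / 10) * (size q)%:R `^ (7 / 10)
           + n%:R)].
Proof.
have [K _ bound] := alg_bound R; have a_ub := root_upper_bound alpha_root alpha_itv.
have [a_lb _] := andP alpha_itv.
exists alg; split; [exact: alg_preserver | exact: alg_polynomial | |].
- exists K, (fun=> 0), (fun=> 0); split; [exact: cvg_cst | exact: cvg_cst | move=> n G q].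
  (* The exponents of the first term are [1 - b / 2] and [b] for [b = 2 / (3 + alpha)]. *)
  have -> : (2 + alpha) / (3 + alpha) + 0 = 1 - 2 / (3 + alpha) / 2 by field; lra.
  rewrite addr0; apply: bound => //; last by lra.
  (* [14 / 26 <= b] amounts to [alpha <= 5 / 7], which is weaker than [alpha <= 33 / 47]. *)
  by rewrite ler_pdivlMr; lra.
exists K => n G q.
have := bound (56 / 100) (7 / 10) n G q; rewrite (_ : 1 - 56 / 100 / 2 = 72 / 100); last by field.
rewrite (_ : 2 - 2 * (7 / 10) = 6 / 10); last by field.
by apply; lra.
Qed.
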